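(* Any $3$-dimensional flat $(-4)$-biharmonic integral $\mathcal{C}$-parallel submanifold $M^{3}$ of $\mathbb{S}^{7}(1)$ is given locally by $$ \begin{aligned} x(u,v,w)=&\frac{\lambda}{\sqrt{\lambda^{2}+1}}\exp\left(\mathrm{i}\left(\tfrac{1}{\lambda}u\right)\right)\mathcal{E}_{1} +\frac{1}{\sqrt{(\gamma-\alpha)(2\gamma-\alpha)}}\exp(-\mathrm{i}(\lambda u-(\gamma-\alpha)v))\mathcal{E}_{2}\\ &+\frac{1}{\sqrt{\rho_{1}(\rho_{1}+\rho_{2})}}\exp(-\mathrm{i}(\lambda u+\gamma v+\rho_{1}w))\mathcal{E}_{3} +\frac{1}{\sqrt{\rho_{2}(\rho_{1}+\rho_{2})}}\exp(-\mathrm{i}(\lambda u+\gamma v-\rho_{2}w))\mathcal{E}_{4}, \end{aligned} $$ where $\rho_{1,2}=\frac{1}{2}\left(\sqrt{4\gamma(2\gamma-\alpha)+\delta^{2}}\pm\delta\right)$, $-1<\lambda<0$, $0<\alpha\leq\frac{\lambda^2-1}{\lambda}$, $\alpha\geq\delta\geq 0$, $\alpha>2\gamma$, $\lambda^{2}\neq\frac{1}{3}$, the tuple $(\lambda,\alpha,\gamma,\delta)$ being one of the following $$ \left(-\sqrt{\tfrac{4-\sqrt{13}}{3}},\ \sqrt{\tfrac{7-\sqrt{13}}{6}},\ -\sqrt{\tfrac{7-\sqrt{13}}{6}},\ 0\right), $$ $$ \left(-\sqrt{\tfrac{1}{5+2\sqrt{3}}},\ \sqrt{\tfrac{45+21\sqrt{3}}{13}},\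 -\sqrt{\tfrac{6}{21+11\sqrt{3}}},\ 0\right), $$ or $$ \left(-\sqrt{\tfrac{1}{6+\sqrt{13}}},\ \sqrt{\tfrac{523+139\sqrt{13}}{138}},\ -\sqrt{\tfrac{79-17\sqrt{13}}{138}},\ \sqrt{\tfrac{14+2\sqrt{13}}{3}}\right), $$ and $\{\mathcal{E}_i\}_{i=1}^4$ is an orthonormal basis of $\mathbb{C}^4$ with respect to the usual Hermitian inner product.
   Context: Everything is smooth; manifolds are connected. $\mathbb{S}^7(1)$ is the unit sphere $\mathbb{S}^{7}=\{z\in\mathbb{C}^{4}:|z|=1\}$ with standard metric $g$ and the canonical Sasakian structure $\xi=-\mathcal{J}z$ ($\mathcal{J}$ the complex structure of $\mathbb{C}^{4}$), $\eta=g(\cdot,\xi)$, $\varphi=s\circ\mathcal{J}$ ($s$ the orthogonal projection onto $T_z\mathbb{S}^7$). An integral submanifold $M$ is a submanifold with $\eta(X)=0$ for all $X$ tangent to $M$. $B$ is its second fundamental form, $\nabla^\perp$ the normal connection. $M$ is integral $\mathcal{C}$-parallel if it is integral and $(\nabla^\perp B)(X,Y,Z)=g(\varphi X,B(Y,Z))\xi$ for all tangent $X,Y,Z$, where $(\nabla^{\perp}B)(X,Y,Z)=\nabla^{\perp}_{X}B(Y,Z)-B(\nabla_{X}Y,Z)-B(Y,\nabla_{X}Z)$. For a map $\psi:(M,g)\to(N,h)$ let $\tau(\psi)=\operatorname{trace}\nabla d\psi$, $E(\psi)=\frac12\int_M|d\psi|^2v_g$, $E_2(\psi)=\frac12\int_M|\tau(\psi)|^2v_g$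 and $\tau_2(\psi)=-\Delta\tau(\psi)-\operatorname{trace}R^N(d\psi,\tau(\psi))d\psi$ ($\Delta=-\operatorname{trace}\nabla^2$). $\psi$ is $(-4)$-biharmonic if it is a critical point of $E_2(\psi)-4E(\psi)$, i.e. $\tau_2(\psi)+4\tau(\psi)=0$. A submanifold is $(-4)$-biharmonic if its inclusion map is. $\rho_1$ corresponds to the sign $+$ and $\rho_2$ to the sign $-$.
   Formalization: The submanifold is also assumed not minimal (tension field not identically zero): the flat minimal integral C-parallel torus ½(e^{iθ1},…,e^{iθ4}), θ1+…+θ4=0, is trivially (-4)-biharmonic but is not of the displayed form. *)

(* Defs.v *)
From HB Require Import structures.
From mathcomp Require Import all_boot all_order all_algebra.
From mathcomp Require Import all_classical all_reals all_analysis.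
From mathcomp Require Import complex.

Set Implicit Arguments.
Unset Strict Implicit.
Unset Printing Implicit Defensive.
Import Order.TTheory GRing.Theory Num.Theory.
Import numFieldNormedType.Exports.

Local Open Scope classical_set_scope.
Local Open Scope ring_scope.

(* C^n as a real normed space: the pair (a, b) is the vector a + i b.  This
   makes the real derivatives ['D_v] and [differentiable] of the library
   directly available; [toC] below is the identification with complex rows. *)
Notation Cvec R n := ('rV[R]_n * 'rV[R]_n)%type.

Section ComplexSpace.
Variables (R : realType) (n : nat).

Definition toC (z : Cvec R n) : 'rV[R[i]]_n :=
  \row_k Complex (z.1 0 k) (z.2 0 k).

Definition Jmul (z : Cvec R n) : Cvec R n := (- z.2, z.1).

(* The Euclidean inner product, i.e. the real part of the Hermitian one. *)
Definition rdot (z w : Cvec R n) : R :=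
  \sum_k (z.1 0 k * w.1 0 k + z.2 0 k * w.2 0 k).

Definition hdot (z w : 'rV[R[i]]_n) : R[i] :=
  \sum_k z 0 k * conjc (w 0 k).

Definition expi (theta : R) : R[i] := Complex (cos theta) (sin theta).

End ComplexSpace.

Section Sphere.
Variables (R : realType) (n : nat).
Implicit Types (z v a b c : Cvec R n) (X Y Z : Cvec R n -> Cvec R n).

Definition on_sphere z : Prop := rdot z z = 1.

(* Orthogonal projection onto the tangent space of the unit sphere at z. *)
Definition tang z v : Cvec R n := v - rdot v z *: z.

Definition xi z : Cvec R n := - Jmul z.
Definition eta z v : R := rdot v (xi z).
Definition phi z v : Cvec R n := tang z (Jmul v).

(* For X, Y tangent to the sphere along the sphere, the Levi-Civita connection
   of the sphere is the tangential part of the flat derivative of C^n. *)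
Definition sphere_nabla X Y : Cvec R n -> Cvec R n :=
  fun z => tang z ('D_(X z) Y z).

Definition sphere_bracket X Y : Cvec R n -> Cvec R n :=
  fun z => 'D_(X z) Y z - 'D_(Y z) X z.

(* The curvature tensor R(a, b)c of the sphere at z, for a, b, c tangent at z,
   with R(X, Y) = [nabla_X, nabla_Y] - nabla_[X, Y]; the tangent vector a is
   extended to the tangent vector field y |-> tang y a. *)
Definition sphere_curv z a b c : Cvec R n :=
  let X := tang ^~ a in let Y := tang ^~ b in let Z := tang ^~ c in
  sphere_nabla X (sphere_nabla Y Z) z - sphere_nabla Y (sphere_nabla X Z) z
  - sphere_nabla (sphere_bracket X Y) Z z.

End Sphere.

Section Smooth.
Variables (R : realType) (m : nat) (W : normedModType R).

Fixpoint iter_partial (s : seq 'I_m) (f : 'rV[R]_m -> W) : 'rV[R]_m -> W :=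
  if s is i :: s' then 'D_(delta_mx 0 i) (iter_partial s' f) else f.

(* C^oo on an open set U: all iterated partial derivatives are differentiable. *)
Definition smooth_on (U : set 'rV[R]_m) (f : 'rV[R]_m -> W) : Prop :=
  forall (s : seq 'I_m) (t : 'rV[R]_m), U t ->
    differentiable (iter_partial s f) t.

End Smooth.

(* Geometry of a parametrized submanifold f : U -> sphere in C^n, U open in R^m.
   A vector field on U is given by its components X : 'rV_m -> 'rV_m, and a
   vector field along f by a map V : 'rV_m -> Cvec R n. *)
Section Parametrized.
Variables (R : realType) (m n : nat) (f : 'rV[R]_m -> Cvec R n).
Implicit Types (t : 'rV[R]_m) (v : Cvec R n).
Implicit Types (X Y Z : 'rV[R]_m -> 'rV[R]_m) (V : 'rV[R]_m -> Cvec R n).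

Definition ebase (i : 'I_m) : 'rV[R]_m := delta_mx 0 i.

Definition push X : 'rV[R]_m -> Cvec R n := fun t => 'D_(X t) f t.

Definition gram t : 'M[R]_m :=
  \matrix_(i, j) rdot ('D_(ebase i) f t) ('D_(ebase j) f t).

Definition ginv t : 'M[R]_m := invmx (gram t).

(* christoffel i j k = Gamma^k_{ij} *)
Definition christoffel (i j k : 'I_m) t : R :=
  2^-1 * \sum_l ginv t k l *
    ('D_(ebase i) (fun s => gram s j l : R^o) t
     + 'D_(ebase j) (fun s => gram s i l : R^o) t
     - 'D_(ebase l) (fun s => gram s i j : R^o) t).

Definition nabla X Y : 'rV[R]_m -> 'rV[R]_m := fun t =>
  'D_(X t) Y t
  + \row_k \sum_i \sum_j X t 0 i * Y t 0 j * christoffel i j k t.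

Definition bracket X Y : 'rV[R]_m -> 'rV[R]_m := fun t =>
  'D_(X t) Y t - 'D_(Y t) X t.

Definition riemann X Y Z : 'rV[R]_m -> 'rV[R]_m := fun t =>
  nabla X (nabla Y Z) t - nabla Y (nabla X Z) t - nabla (bracket X Y) Z t.

(* Trace with respect to the induced metric. *)
Definition trace_g
    (Q : ('rV[R]_m -> 'rV[R]_m) -> ('rV[R]_m -> 'rV[R]_m) ->
         'rV[R]_m -> Cvec R n) : 'rV[R]_m -> Cvec R n := fun t =>
  \sum_i \sum_j ginv t i j *: Q (cst (ebase i)) (cst (ebase j)) t.

(* The connection of the pull-back bundle f^*(T sphere). *)
Definition nabla_pull X V : 'rV[R]_m -> Cvec R n := fun t =>
  tang (f t) ('D_(X t) V t).

(* nabla df *)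
Definition hess_map X Y : 'rV[R]_m -> Cvec R n := fun t =>
  nabla_pull X (push Y) t - push (nabla X Y) t.

Definition tension : 'rV[R]_m -> Cvec R n := trace_g hess_map.

(* nabla^2_{X, Y} V *)
Definition hess_pull V X Y : 'rV[R]_m -> Cvec R n := fun t =>
  nabla_pull X (nabla_pull Y V) t - nabla_pull (nabla X Y) V t.

Definition laplacian V : 'rV[R]_m -> Cvec R n := fun t =>
  - trace_g (hess_pull V) t.

Definition bitension : 'rV[R]_m -> Cvec R n := fun t =>
  - laplacian tension t
  - trace_g (fun X Y s => sphere_curv (f s) (push X s) (tension s) (push Y s)) t.

(* Orthogonal projection onto the normal space, inside the tangent space of the
   sphere, of the image of df. *)
Definition normal t v : Cvec R n :=
  tang (f t) v
  - \sum_i \sum_j (ginv t i j * rdot v ('D_(ebase i) f t)) *: 'D_(ebase j) f t.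

Definition sff Y Z : 'rV[R]_m -> Cvec R n := fun t =>
  normal t ('D_(Y t) (push Z) t).

Definition nabla_perp X V : 'rV[R]_m -> Cvec R n := fun t =>
  normal t ('D_(X t) V t).

Definition nabla_sff X Y Z : 'rV[R]_m -> Cvec R n := fun t =>
  nabla_perp X (sff Y Z) t - sff (nabla X Y) Z t - sff Y (nabla X Z) t.

Variable U : set 'rV[R]_m.

Definition flat_on : Prop :=
  forall X Y Z, smooth_on U X -> smooth_on U Y -> smooth_on U Z ->
  forall t, U t -> riemann X Y Z t = 0.

Definition integral_on : Prop :=
  forall X t, U t -> eta (f t) (push X t) = 0.

Definition C_parallel_on : Prop :=
  forall X Y Z, smooth_on U X -> smooth_on U Y -> smooth_on U Z ->
  forall t, U t ->
    nabla_sff X Y Z t = rdot (phi (f t) (push X t)) (sff Y Z t) *: xi (f t).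

Definition minimal_on : Prop := forall t, U t -> tension t = 0.

(* The Euler-Lagrange equation of E_2 + lam E. *)
Definition biharmonic_on (lam : R) : Prop :=
  forall t, U t -> bitension t - lam *: tension t = 0.

End Parametrized.

Record chart (R : realType) (m : nat) (M : topologicalType) := Chart {
  source : set M;
  target : set 'rV[R]_m;
  coord : M -> 'rV[R]_m;
  param : 'rV[R]_m -> M;
  open_source : open source;
  open_target : open target;
  coord_target : forall p, source p -> target (coord p);
  param_source : forall t, target t -> source (param t);
  coordK : forall p, source p -> param (coord p) = p;
  paramK : forall t, target t -> coord (param t) = t;
  coord_continuous : forall p, source p -> {for p, continuous coord};
  param_continuous : forall t, target t -> {for t, continuous param}
}.

Section Submanifold.
Variables (R : realType) (m n : nat) (M : topologicalType).
Implicit Types (c : chart R m M) (A : set (chart R m M)) (x : M -> Cvec R n).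

Definition smooth_transition c c' : Prop :=
  smooth_on (target c `&` param c @^-1` source c') (coord c' \o param c).

Definition compatible c c' : Prop :=
  smooth_transition c c' /\ smooth_transition c' c.

Definition smooth_atlas A : Prop :=
  (forall p, exists2 c, A c & source c p) /\
  (forall c c', A c -> A c' -> compatible c c').

Definition connected_manifold A : Prop :=
  [/\ hausdorff_space M, @second_countable M, connected [set: M]
    & smooth_atlas A].

(* c is a chart of the smooth structure defined by the atlas A. *)
Definition smooth_chart A c : Prop := forall c', A c' -> compatible c c'.

Definition sphere_submanifold A x : Prop :=
  (forall p, on_sphere (x p)) /\
  (forall c, A c -> smooth_on (target c) (x \o param c) /\
     forall t v, target c t -> 'D_v (x \o param c) t = 0 -> v = 0).

Definition flat A x : Prop :=
  forall c, A c -> flat_on (x \o param c) (target c).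

Definition integral_C_parallel A x : Prop :=
  forall c, A c -> integral_on (x \o param c) (target c) /\
                   C_parallel_on (x \o param c) (target c).

Definition minimal A x : Prop :=
  forall c, A c -> minimal_on (x \o param c) (target c).

Definition biharmonic A (lam : R) x : Prop :=
  forall c, A c -> biharmonic_on (x \o param c) (target c) lam.

End Submanifold.

(* Main.v *)
Require Import Defs.
From HB Require Import structures.
From mathcomp Require Import all_boot all_order all_algebra.
From mathcomp Require Import all_classical all_reals all_analysis.
From mathcomp Require Import complex ring lra.

Set Implicit Arguments.
Unset Strict Implicit.
Unset Printing Implicit Defensive.
Import Order.TTheory GRing.Theory Num.Theory.
Import numFieldNormedType.Exports.

Local Open Scope classical_set_scope.
Local Open Scope complex_scope.
Local Open Scope ring_scope.

(* Let f be a local parametrization of M in C^4, with metric g, and let S be the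
   shape coefficients, obtained from <d_i d_j f, J d_k f> by raising k.  By the
   Gauss equation of a flat metric, the skew-hermitian endomorphisms
   f |-> d_i f, d_j f |-> - g_ij f + i S_ij^k d_k f of C^4 at a point commute, so
   they share a unitary eigenbasis (E_a).  Put z_a = <f, E_a> and
   dz_a / z_a = rho + i theta.  C-parallelism turns rho and the defect
   theta_i theta_j - g_ij - S_ij^k theta_k into solutions of a homogeneous linear
   first order system which vanish at the point; hence they vanish around it and
   |z_a|^2 = p_a is locally constant: M lies locally in a torus.

   The tension field is then sum_a (4 - 1/p_a) z_a E_a.  Its squared norm T is
   independent of the choice of (E_a), hence constant on the connected M, and
   (-4)-biharmonicity says (4 - 1/p_a)^2 + 4 (4 - 1/p_a) = T for every a.  So
   1/p_a takes two values, of sum 12 (one value would give T = 0, the minimal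
   case), and sum_a p_a = 1 leaves three tori, told apart by T.

   The phases theta_a of the z_a satisfy sum_a p_a theta_a = const.  For vectors
   mu_a of R^3 with <mu_a, mu_b> = - 1 + delta_ab / p_a, the map
   u = sum_a p_a theta_a mu_a is therefore a local chart in which
   theta_a = <mu_a, u>; the frequencies of the theorem are such vectors. *)

(** * Smooth functions and vector calculus *)

(** Eigenspaces of the commuting family might a priori change dimension from point to point, so a
    smooth moving eigenbasis is not sought. The basis [E] is found at one point and then kept
    constant in C^4. Each z = <f, E_a> satisfies d_j d_i z = Gamma_ji^k d_k z - g_ji z + i S_ji^k
    d_k z, and division by z gives a Riccati equation for w = dz / z. Its real part has the defect
    as the source of rho. Since g and S are parallel, the covariant derivative of the defect
    involves only d theta, whose deviation from Gamma theta is linear in rho. This is why the system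
    closes up and is homogeneous. Bases found at different points are never matched with each other:
    T alone compares them.

    The condition on the mu_a says that the rows sqrt(p_a) (1, mu_a) form an orthogonal 4 x 4
    matrix. The differentials of the phases obey the same relation for the induced metric, so u is a
    local isometry into R^3 and the mu_a are determined up to an orthogonal transformation. The
    frequencies of the theorem are the solution whose first three rows are lower triangular. *)

Section Calculus.
Variable R : realType.

Lemma derive_linear_comp (V W X : normedModType R) (L : {linear W -> X})
    (F : V -> W) (t v : V) : continuous L -> differentiable F t ->
  differentiable (L \o F) t /\ 'D_v (L \o F) t = L ('D_v F t).
Proof.
move=> cL dF; have dL : differentiable L (F t) by exact: linear_differentiable.
have dLF : differentiable (L \o F) t by exact: differentiable_comp.
by split=> //; rewrite !deriveE// diff_comp// diff_lin.
Qed.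

Lemma derive_chain (V W X : normedModType R) (F : V -> W) (G : W -> X)
    (t v : V) : differentiable F t -> differentiable G (F t) ->
  'D_v (G \o F) t = 'D_('D_v F t) G (F t).
Proof.
move=> dF dG.
have dGF : differentiable (G \o F) t by exact: differentiable_comp.
by rewrite !deriveE// diff_comp.
Qed.

Lemma derive_sum_basis m (W : normedModType R) (F : 'rV[R]_m -> W)
    (t v : 'rV[R]_m) : differentiable F t ->
  'D_v F t = \sum_i v 0 i *: 'D_(ebase R i) F t.
Proof.
move=> dF; rewrite deriveE// [in LHS](row_sum_delta v) linear_sum.
by apply: eq_bigr => i _; rewrite linearZ deriveE.
Qed.

Lemma open_near_eq (T : topologicalType) X (U : set T) (F G : T -> X) (t : T) :
  open U -> {in U, F =1 G} -> U t -> {near nbhs t, F =1 G}.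
Proof.
move=> oU FG Ut; near=> s; apply: FG; rewrite inE.
by near: s; apply: open_nbhs_nbhs.
Unshelve. all: by end_near. Qed.

(** An estimate near [x] transfers at once to functions that agree near [x], and it is the form in
    which the inverse map of a diffeomorphism is controlled. *)
Lemma diff_epsP (V W : normedModType R) (F : V -> W) (L : {linear V -> W})
    (x : V) : continuous L ->
  (forall e, 0 < e -> \forall y \near x,
     `|F y - F x - L (y - x)| <= e * `|y - x|) ->
  differentiable F x /\ 'd F x = L :> (V -> W).
Proof.
move=> cL FL.
have E : F \o shift x = cst (F x) + L +o_ 0 id.
  apply/eqaddoP => e e0 /=.
  have := FL e e0; rewrite (near_shift 0) /=.
  by apply: filterS => h; rewrite subr0 /= addrK !fctE /= opprD addrA.
split; last exact: diff_unique.
apply/diff_locallyP; rewrite (diff_unique cL E); split=> //.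
Qed.

Lemma diff_eps (V W : normedModType R) (F : V -> W) (x : V) :
  differentiable F x -> forall e, 0 < e -> \forall y \near x,
     `|F y - F x - 'd F x (y - x)| <= e * `|y - x|.
Proof.
move=> /diff_locally /eqaddoP E e e0.
rewrite (near_shift 0 x) /=; have := E e e0.
by apply: filterS => y; rewrite subr0 !fctE /= addrK opprD addrA.
Qed.

Lemma near_eq_differentiable (V W : normedModType R) (F G : V -> W) (t : V) :
  {near nbhs t, F =1 G} -> differentiable F t -> differentiable G t.
Proof.
move=> FG dF; have FGt := nbhs_singleton FG.
apply: (proj1 (@diff_epsP _ _ G ('d F t) t _ _)); first exact: diff_continuous.
move=> e e0; near=> y; have <- : F y = G y by near: y.
by rewrite -FGt; near: y; exact: diff_eps.
Unshelve. all: by end_near. Qed.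

Lemma derive_ext (V W : normedModType R) (U : set V) (F G : V -> W) (t v : V) :
  open U -> (forall s, U s -> F s = G s) -> U t -> 'D_v F t = 'D_v G t.
Proof.
by move=> oU FG Ut; apply: near_eq_derive; apply: open_near_eq oU _ Ut => s /[!inE]/FG.
Qed.

Lemma differentiable_ext (V W : normedModType R) (U : set V) (F G : V -> W)
    (t : V) : open U -> (forall s, U s -> F s = G s) -> U t ->
  differentiable F t -> differentiable G t.
Proof.
move=> oU FG Ut; apply: near_eq_differentiable.
by apply: open_near_eq oU _ Ut => s /[!inE]/FG.
Qed.

End Calculus.

(** * Smooth real functions of several variables *)

Section SmoothClass.
Variables (R : realType) (m : nat).
Implicit Types (U V : set 'rV[R]_m) (F G : 'rV[R]_m -> R).

(** [Ck k] means k times differentiable; level 0 imposes nothing, not even continuity. Only the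
    conjunction over all k is used in the end, and recursion on k makes the product, quotient and
    chain rules inductions on the order. *)
Fixpoint Ck k U F : Prop :=
  if k is k'.+1 then
    (forall t, U t -> differentiable F t) /\
    (forall i, Ck k' U ('D_(ebase R i) F))
  else True.

Definition smoothF U F : Prop := forall k, Ck k U F.

Lemma Ck_ext k U F G : open U -> (forall t, U t -> F t = G t) ->
  Ck k U F -> Ck k U G.
Proof.
move=> oU; elim: k F G => [//|k IH] F G FG [dF DF]; split.
  by move=> t Ut; exact: differentiable_ext oU FG Ut (dF t Ut).
by move=> i; apply: IH (DF i) => t Ut; exact: derive_ext oU FG Ut.
Qed.

Lemma CkW k U F : Ck k.+1 U F -> Ck k U F.
Proof.
elim: k F => [//|k IH] F [dF DF]; split=> // i; exact: IH (DF i).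
Qed.

Lemma CkS k U V F : U `<=` V -> Ck k V F -> Ck k U F.
Proof.
move=> UV; elim: k F => [//|k IH] F [dF DF]; split=> [t /UV/dF//|i].
exact: IH (DF i).
Qed.

Lemma Ck_cst k U (c : R) : Ck k U (cst c).
Proof.
elim: k c => [//|k IH] c; split=> [t _|i]; first exact: differentiable_cst.
have -> : 'D_(ebase R i) (cst c) = cst 0 :> ('rV[R]_m -> R).
  by apply/funext => t; rewrite derive_cst.
exact: IH.
Qed.

Lemma CkD k U F G : open U -> Ck k U F -> Ck k U G -> Ck k U (F \+ G).
Proof.
move=> oU; elim: k F G => [//|k IH] F G [dF DF] [dG DG]; split.
  by move=> t Ut; apply: differentiableD; [exact: dF|exact: dG].
move=> i; apply: Ck_ext (IH _ _ (DF i) (DG i)) => // t Ut /=.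
by rewrite deriveD//; apply: diff_derivable; [exact: dF|exact: dG].
Qed.

Lemma CkM k U F G : open U -> Ck k U F -> Ck k U G -> Ck k U (F \* G).
Proof.
move=> oU; elim: k F G => [//|k IH] F G CF CG.
have [[dF DF] [dG DG]] := (CF, CG); split.
  by move=> t Ut; apply: differentiableM; [exact: dF|exact: dG].
move=> i; apply: Ck_ext (CkD oU (IH _ _ (CkW CF) (DG i))
                                (IH _ _ (CkW CG) (DF i))) => // t Ut /=.
by rewrite deriveM//; apply: diff_derivable; [exact: dF|exact: dG].
Qed.

Lemma CkN k U F : open U -> Ck k U F -> Ck k U (fun t => - F t).
Proof.
move=> oU CF; apply: Ck_ext (CkM oU (@Ck_cst k U (-1)) CF) => // t _ /=.
by rewrite mulN1r.
Qed.

Lemma CkV k U F : open U -> (forall t, U t -> F t != 0) ->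
  Ck k U F -> Ck k U (fun t => (F t)^-1).
Proof.
move=> oU F0; elim: k F F0 => [//|k IH] F F0 CF.
have [dF DF] := CF; have CV := IH F F0 (CkW CF); split.
  by move=> t Ut; apply: differentiableV; [exact: dF|exact: F0].
move=> i; apply: Ck_ext (CkM oU (CkN oU (CkM oU CV CV)) (DF i)) => // t Ut /=.
rewrite deriveV ?F0//; last by apply: diff_derivable; exact: dF.
by rewrite -exprVn expr2.
Qed.

Lemma Ck_sum k U I (r : seq I) (P : pred I) (F : I -> 'rV[R]_m -> R) :
  open U -> (forall i, Ck k U (F i)) ->
  Ck k U (fun t => \sum_(i <- r | P i) F i t).
Proof.
move=> oU SF; elim: r => [|i r IH].
  by apply: Ck_ext (Ck_cst k U 0) => // t _; rewrite big_nil.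
case: (boolP (P i)) => Pi; last first.
  by apply: Ck_ext IH => // t _; rewrite big_cons (negbTE Pi).
by apply: Ck_ext (CkD oU (SF i) IH) => // t _; rewrite big_cons Pi.
Qed.

Lemma smooth_ext U F G : open U -> (forall t, U t -> F t = G t) ->
  smoothF U F -> smoothF U G.
Proof. by move=> oU FG SF k; exact: Ck_ext (SF k). Qed.

Lemma smoothS U V F : U `<=` V -> smoothF V F -> smoothF U F.
Proof. by move=> UV SF k; exact: CkS (SF k). Qed.

Lemma smooth_diff U F t : smoothF U F -> U t -> differentiable F t.
Proof. by move=> /(_ 1%N) [dF _]; exact: dF. Qed.

Lemma smooth_derivable U F t v : smoothF U F -> U t -> derivable F t v.
Proof. by move=> sF Ut; apply: diff_derivable; exact: smooth_diff Ut. Qed.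

Lemma smooth_partial U F i : smoothF U F -> smoothF U ('D_(ebase R i) F).
Proof. by move=> SF k; have [_] := SF k.+1; exact. Qed.

Lemma smooth_cst U c : smoothF U (fun=> c).
Proof. by move=> k; exact: Ck_cst. Qed.

Lemma smoothD U F G : open U -> smoothF U F -> smoothF U G ->
  smoothF U (fun t => F t + G t).
Proof. by move=> oU SF SG k; exact: CkD. Qed.

Lemma smoothN U F : open U -> smoothF U F -> smoothF U (fun t => - F t).
Proof. by move=> oU SF k; exact: CkN. Qed.

Lemma smoothB U F G : open U -> smoothF U F -> smoothF U G ->
  smoothF U (fun t => F t - G t).
Proof. by move=> oU SF SG k; apply: CkD => //; exact: CkN. Qed.

Lemma smoothM U F G : open U -> smoothF U F -> smoothF U G ->
  smoothF U (fun t => F t * G t).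
Proof. by move=> oU SF SG k; exact: CkM. Qed.

Lemma smooth_inv U F : open U -> (forall t, U t -> F t != 0) ->
  smoothF U F -> smoothF U (fun t => (F t)^-1).
Proof. by move=> oU F0 SF k; exact: CkV. Qed.

Lemma smooth_sum U I (r : seq I) (P : pred I) (F : I -> 'rV[R]_m -> R) :
  open U -> (forall i, smoothF U (F i)) ->
  smoothF U (fun t => \sum_(i <- r | P i) F i t).
Proof. by move=> oU SF k; apply: Ck_sum => // i; exact: SF. Qed.

Lemma smooth_prod U I (r : seq I) (P : pred I) (F : I -> 'rV[R]_m -> R) :
  open U -> (forall i, smoothF U (F i)) ->
  smoothF U (fun t => \prod_(i <- r | P i) F i t).
Proof.
move=> oU SF; elim: r => [|i r IH].
  by apply: smooth_ext (smooth_cst U 1) => // t _; rewrite big_nil.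
case: (boolP (P i)) => Pi; last first.
  by apply: smooth_ext IH => // t _; rewrite big_cons (negbTE Pi).
by apply: smooth_ext (smoothM oU (SF i) IH) => // t _; rewrite big_cons Pi.
Qed.

Lemma smooth_det U n (A : 'rV[R]_m -> 'M[R]_n) : open U ->
  (forall i j, smoothF U (fun t => A t i j)) -> smoothF U (fun t => \det (A t)).
Proof.
move=> oU SA; apply: smooth_sum => // s; apply: smoothM => //.
  exact: smooth_cst.
by apply: smooth_prod => // i; exact: SA.
Qed.

Lemma smooth_invmx U n (A : 'rV[R]_m -> 'M[R]_n) : open U ->
  (forall t, U t -> A t \in unitmx) ->
  (forall i j, smoothF U (fun t => A t i j)) ->
  forall i j, smoothF U (fun t => invmx (A t) i j).
Proof.
move=> oU uA SA i j.
have S : smoothF U (fun t => (\det (A t))^-1 * cofactor (A t) j i).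
  apply: smoothM => //.
    apply: smooth_inv => // [t /uA|]; last exact: smooth_det.
    by rewrite unitmxE unitfE.
  apply: smoothM => //; first exact: smooth_cst.
  apply: smooth_det => // k l.
  by apply: smooth_ext (SA (lift j k) (lift i l)) => // t _; rewrite !mxE.
apply: smooth_ext S => // t Ut; rewrite /invmx uA// !mxE//.
Qed.

End SmoothClass.

Section SmoothMaps.
Variables (R : realType).

(** A partial derivative of [F \o h] is a sum of products of a smooth function and some
    ['D_j F \o h], so the induction on the order keeps [h] fixed and generalizes [F]. *)
Lemma smooth_comp m n (U : set 'rV[R]_m) (V : set 'rV[R]_n)
    (h : 'rV[R]_m -> 'rV[R]_n) (F : 'rV[R]_n -> R) :
  open U -> (forall t, U t -> V (h t)) ->
  (forall t, U t -> differentiable h t) ->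
  (forall j, smoothF U (fun t => h t 0 j)) -> smoothF V F ->
  smoothF U (F \o h).
Proof.
move=> oU UV dh Sh SF k; elim: k F SF => [//|k IH] F SF.
have dF t : U t -> differentiable F (h t) by move=> /UV; exact: smooth_diff.
split=> [t Ut|i]; first by apply: differentiable_comp; [exact: dh|exact: dF].
apply: (@Ck_ext _ _ k U (fun t => \sum_j 'D_(ebase R i) (fun s => h s 0 j) t *
          'D_(ebase R j) F (h t))) => // [t Ut|].
  rewrite derive_chain//; [|exact: dh|exact: dF].
  rewrite [RHS]derive_sum_basis; last exact: dF.
  apply: eq_bigr => j _; congr (_ * _).
  by rewrite derive_mx ?mxE//; apply: diff_derivable; exact: dh.
apply: Ck_sum => // j; apply: CkM => //; first exact: smooth_partial.
by apply: (IH ('D_(ebase R j) F)); exact: smooth_partial.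
Qed.

(** The head of the list is the outermost derivative, whereas passing from f to one of its partial
    derivatives adds an innermost one. *)
Lemma iter_partial_rcons m (W : normedModType R) s i (f : 'rV[R]_m -> W) :
  iter_partial (rcons s i) f = iter_partial s ('D_(ebase R i) f).
Proof. by elim: s => [//|j s IH] /=; rewrite IH. Qed.

Lemma smooth_on_partial m (W : normedModType R) U i (f : 'rV[R]_m -> W) :
  smooth_on U f -> smooth_on U ('D_(ebase R i) f).
Proof. by move=> Sf s t Ut; rewrite -iter_partial_rcons; exact: Sf. Qed.

Lemma smooth_on_linear m (W : normedModType R) (U : set 'rV[R]_m)
    (f : 'rV[R]_m -> W) (L : {linear W -> R}) :
  open U -> continuous L -> smooth_on U f -> smoothF U (L \o f).
Proof.
move=> oU cL Sf k; elim: k f Sf => [//|k IH] f Sf.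
have df t : U t -> differentiable f t by exact: (Sf [::]).
split=> [t Ut|i]; first exact: (derive_linear_comp 0 cL (df t Ut)).1.
apply: Ck_ext (IH _ (smooth_on_partial i Sf)) => // t Ut /=.
by rewrite (derive_linear_comp _ cL (df t Ut)).2.
Qed.

Lemma differentiable_rV (V : normedModType R) n (f : V -> 'rV[R]_n) t :
  (forall j, differentiable (fun s => f s 0 j) t) -> differentiable f t.
Proof.
move=> df.
have -> : f = fun s => \sum_j (fun j s => f s 0 j *: delta_mx 0 j) j s.
  by apply/funext => s; rewrite [LHS]row_sum_delta.
have -> : (fun s => \sum_j f s 0 j *: delta_mx 0 j : 'rV[R]_n) =
   \sum_j (fun s => f s 0 j *: delta_mx 0 j : 'rV[R]_n).
  by apply/funext => s; rewrite fct_sumE.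
apply: differentiable_sum => j.
exact: (@differentiableZl _ _ _ (fun s => f s 0 j)).
Qed.

Lemma smooth_on_rV m n (U : set 'rV[R]_m) (f : 'rV[R]_m -> 'rV[R]_n) :
  open U -> (forall j, smoothF U (fun s => f s 0 j)) -> smooth_on U f.
Proof.
move=> oU Sf.
have H s : forall j, smoothF U (fun t => iter_partial s f t 0 j).
  elim: s => [//|i s IH] j /=.
  apply: smooth_ext (smooth_partial i (IH j)) => // t Ut.
  rewrite derive_mx ?mxE//; apply: diff_derivable; apply: differentiable_rV.
  by move=> l; apply: smooth_diff Ut; exact: IH.
by move=> s t Ut; apply: differentiable_rV => j; apply: smooth_diff Ut; exact: H.
Qed.

Lemma smooth_on_cst m (W : normedModType R) (U : set 'rV[R]_m) (c : W) :
  smooth_on U (cst c).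
Proof.
have H s : exists c', iter_partial s (cst c : 'rV[R]_m -> W) = cst c'.
  elim: s => [|i s [c' /= ->]]; first by exists c.
  by exists 0; apply/funext => t; rewrite derive_cst.
by move=> s t _; have [c' ->] := H s; exact: differentiable_cst.
Qed.

End SmoothMaps.

(** * Mean values and symmetry of second derivatives *)

Section MeanValue.
Variable R : realType.

Lemma differentiable_id (V : normedModType R) (x : V) :
  differentiable (fun y : V => y) x.
Proof. exact: (@ex_diff _ _ _ _ _ id id). Qed.

Lemma derive_translate (V : normedModType R) (c x v : V) :
  'D_v (fun y => y + c) x = v.
Proof.
have [_] := is_deriveD (is_derive_id x v) (is_derive_cst c x v).
by rewrite addr0.
Qed.

Lemma mean_value_segment (V : normedModType R) (F : V -> R) (x v : V) :
  (forall s, 0 <= s <= 1 -> differentiable F (x + s *: v)) ->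
  exists2 s, 0 <= s <= 1 & F (x + v) - F x = 'D_v F (x + s *: v).
Proof.
move=> dF; pose h (s : R^o) : V := x + s *: v; pose G := F \o h.
have dh (s : R^o) : is_derive s (1 : R^o) h v.
  have H : is_derive s (1 : R^o) (cst x + ( *:%R^~ v)) (0 + v).
    apply: is_deriveD; apply: DeriveDef.
      by apply: diff_derivable; apply: differentiableZl; exact: differentiable_id.
    by rewrite deriveE// diff_val scale1r.
  by rewrite add0r in H; exact: H.
have dhs s : differentiable h s.
  by apply/derivable1_diffP; have [] := dh s.
have dG (s : R^o) : 0 <= (s : R) <= 1 -> is_derive s (1 : R^o) G ('D_v F (h s)).
  move=> s01; have dGs : differentiable G s.
    by apply: differentiable_comp => //; exact: dF.
  apply: DeriveDef; first exact: diff_derivable.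
  by rewrite derive_chain//; [have [_ ->] := dh s|exact: dF].
have [||c] := @MVT_segment R G (fun s => 'D_v F (h s)) 0 1 ler01.
- by move=> s /[!in_itv]/= /andP[s0 s1]; apply: dG; rewrite !ltW.
- apply: continuous_in_subspaceT => s /[!inE]/= /[!in_itv]/= s01.
  by apply: differentiable_continuous; apply/derivable1_diffP; have [] := dG s s01.
rewrite in_itv/= => c01 E; exists c => //.
by move: E; rewrite /G /h /= scale1r scale0r addr0 subr0 mulr1.
Qed.

Lemma rV_norm_le n (v : 'rV[R]_n) c : 0 <= c ->
  (forall j, `|v 0 j| <= c) -> `|v| <= c.
Proof.
move=> c0 vc; rewrite [`|v|]mx_normrE; apply: bigmax_le => // -[i j] _ /=.
by rewrite (ord1 i).
Qed.

Lemma rV_coord_le n (v : 'rV[R]_n) j : `|v 0 j| <= `|v|.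
Proof. by rewrite [`|v|]mx_normrE; exact: (le_bigmax _ _ (0, j)). Qed.

Lemma ebase_norm_le n (i : 'I_n) : `|ebase R i| <= 1.
Proof.
apply: rV_norm_le => // j; rewrite mxE eqxx /=.
by case: (j == i); rewrite ?normr1 ?normr0.
Qed.

Lemma smooth_continuous m (U : set 'rV[R]_m) F t : smoothF U F -> U t ->
  {for t, continuous F}.
Proof. by move=> SF Ut; apply: differentiable_continuous; exact: smooth_diff Ut. Qed.

(** The mean value theorem is applied along e_i to the increment of F along e_j, and then along e_j
    to the derivative of F along e_i. The left-hand side is symmetric in i and j, which is what
    [partialC] exploits. *)
Lemma second_difference m (U : set 'rV[R]_m) F (t : 'rV[R]_m) (i j : 'I_m) (h r : R) :
  smoothF U F -> (forall s, `|s - t| < r -> U s) -> 0 < h -> h * 2 < r ->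
  exists2 s, `|s - t| <= h * 2 &
    F (t + h *: ebase R i + h *: ebase R j) - F (t + h *: ebase R i)
     - F (t + h *: ebase R j) + F t
    = h ^+ 2 * 'D_(ebase R j) ('D_(ebase R i) F) s.
Proof.
move=> SF rU h0 hr.
have near_pt (a b : R) : 0 <= a <= 1 -> 0 <= b <= 1 ->
  `|t + a *: (h *: ebase R i) + b *: (h *: ebase R j) - t| <= h * 2.
  move=> /andP[a0 a1] /andP[b0 b1].
  rewrite [X in `|X|]addrC -!addrA addKr.
  have aux (c : R) l : 0 <= c -> c <= 1 -> `|c *: (h *: ebase R l)| <= h.
    move=> c0 c1; have ch : 0 <= c * h by rewrite mulr_ge0// ltW.
    rewrite scalerA normrZ ger0_norm//.
    apply: (le_trans (ler_wpM2l ch (ebase_norm_le l))).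
    by rewrite mulr1 ler_piMl// ltW.
  by rewrite (le_trans (ler_normD _ _))// mulr_natr mulr2n lerD ?aux.
have Upt a b : 0 <= a <= 1 -> 0 <= b <= 1 ->
    U (t + a *: (h *: ebase R i) + b *: (h *: ebase R j)).
  by move=> a01 b01; apply: rU; rewrite (le_lt_trans (near_pt _ _ a01 b01)).
have i01 : 0 <= (1 : R) <= 1 by rewrite ler01 lexx.
have z01 : 0 <= (0 : R) <= 1 by rewrite ler01 lexx.
pose G s := F (s + h *: ebase R j) - F s.
have dshift s : differentiable (fun s => s + h *: ebase R j : 'rV[R]_m) s.
  by apply: differentiableD; [exact: differentiable_id|exact: differentiable_cst].
have dG a : 0 <= a <= 1 ->
    differentiable (fun s => F (s + h *: ebase R j)) (t + a *: (h *: ebase R i)) /\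
    differentiable F (t + a *: (h *: ebase R i)).
  move=> a01; split.
    apply: (@differentiable_comp _ _ _ _ (fun s => s + h *: ebase R j)) => //.
    by apply: smooth_diff SF _; have := Upt a 1 a01 i01; rewrite scale1r.
  by apply: smooth_diff SF _; have := Upt a 0 a01 z01; rewrite scale0r addr0.
have [a a01 Ea] := @mean_value_segment _ G t (h *: ebase R i)
  (fun s s01 => differentiableB (dG s s01).1 (dG s s01).2).
have [dG1 dG2] := dG a a01.
have Db (b : R) (F' : 'rV[R]_m -> R) l s : differentiable F' s ->
  'D_(b *: ebase R l) F' s = b * 'D_(ebase R l) F' s.
  by move=> dF; rewrite !deriveE// linearZ.
have EG : 'D_(h *: ebase R i) G (t + a *: (h *: ebase R i)) =
    h * ('D_(ebase R i) F (t + a *: (h *: ebase R i) + h *: ebase R j)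
         - 'D_(ebase R i) F (t + a *: (h *: ebase R i))).
  rewrite Db; last exact: (differentiableB dG1 dG2).
  have -> := deriveB (@diff_derivable _ _ _ _ _ (ebase R i) dG1)
                     (@diff_derivable _ _ _ _ _ (ebase R i) dG2).
  have U1 := Upt a 1 a01 i01; rewrite scale1r in U1.
  have -> := derive_chain (ebase R i) (dshift (t + a *: (h *: ebase R i)))
    (smooth_diff SF U1).
  by rewrite derive_translate.
have [b b01 Eb] := @mean_value_segment _ ('D_(ebase R i) F)
  (t + a *: (h *: ebase R i)) (h *: ebase R j)
  (fun b b01 => smooth_diff (smooth_partial i SF) (Upt a b a01 b01)).
exists (t + a *: (h *: ebase R i) + b *: (h *: ebase R j)); first exact: near_pt.
move: Eb; rewrite Db; last exact: smooth_diff (smooth_partial i SF) (Upt a b a01 b01).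
move=> Eb; rewrite expr2 -mulrA -Eb -EG -Ea /G; ring.
Qed.

Lemma dist_le_split (x y z e : R) :
  `|y - x| < e / 2 -> `|z - x| < e / 2 -> `|y - z| <= e.
Proof.
move=> H1 H2; rewrite -(subrK x y) -addrA -[x - z]opprB.
by rewrite (le_trans (ler_normB _ _))// [leRHS]splitr lerD// ltW.
Qed.

(** One and the same second difference equals h^2 times either mixed derivative, each at a point
    within 2 h of [t]. Both mixed derivatives are continuous at [t], so their values there differ by
    at most any e > 0. *)
Lemma partialC m (U : set 'rV[R]_m) F (t : 'rV[R]_m) (i j : 'I_m) :
  open U -> smoothF U F -> U t ->
  'D_(ebase R i) ('D_(ebase R j) F) t = 'D_(ebase R j) ('D_(ebase R i) F) t.
Proof.
move=> oU SF Ut; apply/subr0_eq/eqP; rewrite -normr_le0; apply/ler_addgt0Pr => e e0.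
rewrite add0r.
have cD k l := smooth_continuous (smooth_partial k (smooth_partial l SF)) Ut.
have e2 : 0 < e / 2 by rewrite divr_gt0.
have /cvgrPdist_lt /(_ _ e2) Nij := cD i j.
have /cvgrPdist_lt /(_ _ e2) Nji := cD j i.
have NU : nbhs t U by exact: open_nbhs_nbhs.
have /nbhs_ballP[r /= r0 rP] : nbhs t (fun s => U s /\
   (`|'D_(ebase R i) ('D_(ebase R j) F) t - 'D_(ebase R i) ('D_(ebase R j) F) s| < e / 2 /\
   `|'D_(ebase R j) ('D_(ebase R i) F) t - 'D_(ebase R j) ('D_(ebase R i) F) s| < e / 2)).
  exact: filterI NU (filterI Nij Nji).
pose h := r / 4; have h0 : 0 < h by rewrite divr_gt0.
have h20 : h ^+ 2 != 0 by rewrite expf_neq0 ?gt_eqF.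
have hr : h * 2 < r by rewrite /h; lra.
have rU s : `|s - t| < r -> U s.
  by move=> st; apply: (rP s _).1; rewrite -ball_normE /= distrC.
have [s1 s1t E1] := second_difference i j SF rU h0 hr.
have [s2 s2t E2] := second_difference j i SF rU h0 hr.
have B1 : ball t r s1 by rewrite -ball_normE /= distrC (le_lt_trans s1t).
have B2 : ball t r s2 by rewrite -ball_normE /= distrC (le_lt_trans s2t).
have [_ [_ H1]] := rP _ B1; have [_ [H2 _]] := rP _ B2.
have swap (x y z w : R) : x - y - z + w = x - z - y + w by rewrite [x - y - z]addrAC.
have E : h ^+ 2 * 'D_(ebase R j) ('D_(ebase R i) F) s1 =
         h ^+ 2 * 'D_(ebase R i) ('D_(ebase R j) F) s2.
  apply: etrans (esym E1) (etrans _ E2).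
  rewrite [t + h *: ebase R j + _]addrAC.
  move: (F _) (F _) (F _) (F _) => x y z w; exact: swap.
rewrite (mulfI h20 E) in H1; exact: dist_le_split H2 H1.
Qed.

End MeanValue.

(** * Uniqueness for linear systems of partial differential equations *)

Section Uniqueness.
Variables (R : realType) (m : nat).

(** The function exp(- a s) h(s) has nonpositive derivative, so the mean value theorem on [0, 1]
    gives h(1) <= 0. *)
Lemma gronwall0 (h dh : R -> R) (a : R) :
  (forall s, 0 <= s <= 1 -> is_derive (s : R^o) (1 : R^o) h (dh s)) ->
  (forall s, 0 <= s <= 1 -> dh s <= a * h s) ->
  (forall s, 0 <= s <= 1 -> 0 <= h s) ->
  h 0 = 0 -> h 1 = 0.
Proof.
move=> Dh hle h0 h00; pose k (s : R) := expR (- a * s) * h s.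
have dE (s : R) : is_derive (s : R^o) (1 : R^o) (fun s => expR (- a * s) : R^o)
    (- a * expR (- a * s)).
  have H : is_derive (s : R^o) (1 : R^o) (fun s => - a * s : R^o) (- a).
    have := @is_deriveZ _ _ _ (id : R^o -> R^o) (- a) s 1 1 (is_derive_id _ _).
    by rewrite /GRing.scale /= mulr1.
  have := @is_derive1_comp _ expR (fun s => - a * s) s _ _ (is_derive_expR _) H.
  by rewrite mulrC.
have Dk s : 0 <= s <= 1 ->
    is_derive (s : R^o) (1 : R^o) k (expR (- a * s) * dh s - a * k s).
  move=> s01; have H := is_deriveM (dE s) (Dh s s01).
  apply: (is_derive_eq H); rewrite /GRing.scale /= /k; ring.
have [||c c01 Ec] := @MVT_segment R k (fun s => expR (- a * s) * dh s - a * k s) 0 1 ler01.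
- by move=> s /[!in_itv]/= /andP[s0 s1]; apply: Dk; rewrite !ltW.
- apply: continuous_in_subspaceT => s /[!inE]/= /[!in_itv]/= s01.
  by apply: differentiable_continuous; apply/derivable1_diffP; have [] := Dk s s01.
rewrite in_itv/= in c01.
have k1 : k 1 <= 0.
  have -> : k 1 = k 1 - k 0 by rewrite /k h00 mulr0 subr0.
  rewrite Ec subr0 mulr1 /k mulrCA -mulrBr pmulr_rle0 ?expR_gt0// subr_le0.
  exact: hle.
have i01 : 0 <= (1 : R) <= 1 by rewrite ler01 lexx.
apply/eqP; rewrite eq_le h0// andbT.
by move: k1; rewrite /k pmulr_rle0 ?expR_gt0.
Qed.

(** Along the segment from [t0] to [t] the system becomes an ordinary differential inequality. It is
    applied to the sum of the squares of the [G j], which unlike the sum of absolute values is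
    differentiable. *)
Lemma uniqueness_ball (I : finType) (G : I -> 'rV[R]_m -> R) (t0 : 'rV[R]_m)
    (r C : R) :
  (forall t, ball t0 r t -> forall i, differentiable (G i) t) ->
  (forall t, ball t0 r t -> forall i k,
     `|'D_(ebase R k) (G i) t| <= C * \sum_j `|G j t|) ->
  (forall i, G i t0 = 0) -> forall t, ball t0 r t -> forall i, G i t = 0.
Proof.
move=> dG DG G0 t Bt i; pose v := t - t0.
pose g (s : R^o) := t0 + s *: v.
have Bg s : 0 <= (s : R) <= 1 -> ball t0 r (g s).
  move=> /andP[s0 s1]; move: Bt; rewrite -!ball_normE /= /g opprD addNKr normrN.
  rewrite normrZ ger0_norm// distrC -/v; apply: le_lt_trans.
  by rewrite ler_piMl.
pose N t := \sum_j `|G j t|.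
have N0 s : 0 <= N s by exact: sumr_ge0.
pose h (s : R) := \sum_j G j (g s) ^+ 2.
pose K := `|C| * \sum_k `|v 0 k|.
have K0 : 0 <= K by rewrite mulr_ge0 ?sumr_ge0.
have Dv s j : 0 <= (s : R) <= 1 -> `|'D_v (G j) (g s)| <= K * N (g s).
  move=> s01; rewrite derive_sum_basis; last exact: dG (Bg s s01) j.
  apply: (le_trans (ler_norm_sum _ _ _)); rewrite /K mulrAC mulr_sumr.
  apply: ler_sum => k _; rewrite normrZ mulrC ler_wpM2r//.
  by rewrite (le_trans (DG _ (Bg s s01) j k))// ler_wpM2r ?ler_norm ?N0.
clearbody K.
have Dg (s : R^o) : is_derive s (1 : R^o) g v.
  have H : is_derive s (1 : R^o) (cst t0 + ( *:%R^~ v)) (0 + v).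
    apply: is_deriveD; apply: DeriveDef.
      by apply: diff_derivable; apply: differentiableZl; exact: differentiable_id.
    by rewrite deriveE// diff_val scale1r.
  by rewrite add0r in H; exact: H.
have DGg s j : 0 <= (s : R) <= 1 ->
    is_derive (s : R^o) (1 : R^o) (G j \o g) ('D_v (G j) (g s)).
  move=> s01; have dgs : differentiable g s.
    by apply/derivable1_diffP; have [] := Dg s.
  have dGs : differentiable (G j \o g) s.
    by apply: differentiable_comp => //; exact: dG (Bg s s01) j.
  apply: DeriveDef; first exact: diff_derivable.
  by rewrite derive_chain//; [have [_ ->] := Dg s|exact: dG (Bg s s01) j].
pose dh (s : R) := \sum_j 2 * G j (g s) * 'D_v (G j) (g s).
have Dh s : 0 <= s <= 1 -> is_derive (s : R^o) (1 : R^o) h (dh s).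
  move=> s01.
  have E (r' : seq I) : is_derive (s : R^o) (1 : R^o)
     (fun s => \sum_(j <- r') G j (g s) ^+ 2 : R^o)
     (\sum_(j <- r') 2 * G j (g s) * 'D_v (G j) (g s)).
    elim: r' => [|j r' IH].
      under eq_fun do rewrite big_nil; rewrite big_nil; exact: is_derive_cst.
    under eq_fun do rewrite big_cons; rewrite big_cons.
    apply: is_deriveD; have H := is_deriveM (DGg s j s01) (DGg s j s01).
    have E : (G j \o g) * (G j \o g) = (fun s => G j (g s) ^+ 2).
      by apply/funext => x; rewrite expr2.
    rewrite -E; apply: (is_derive_eq H); rewrite /GRing.scale /=.
    move: ('D_v _ _) (G j (g s)) => x y; ring.
  exact: E.
have h1 : h 1 = 0.
  (* The derivative is at most 2 K N^2, and N^2 <= #|I| h by Cauchy-Schwarz, in the form x y <= (x^2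
     + y^2) / 2 summed over all pairs. *)
  apply: (@gronwall0 h dh (2 * K * #|I|%:R)) => //.
  - move=> s s01.
    have : dh s <= 2 * K * N (g s) ^+ 2.
      rewrite expr2 mulrA /N [leRHS]mulr_sumr; apply: ler_sum => j _.
      rewrite (le_trans (ler_norm _))// !normrM ger0_norm//.
      have := ler_wpM2l (normr_ge0 (G j (g s))) (Dv s j s01).
      rewrite -/(N (g s)) [2 * K * N _ * _]mulrC.
      move: `|'D_v _ _| `|G j _| (N (g s)) => x y z; lra.
    move/le_trans; apply; rewrite -!mulrA ler_wpM2l// ler_wpM2l// /N /h expr2.
    rewrite mulr_suml.
    have -> : #|I|%:R * (\sum_j G j (g s) ^+ 2) =
        \sum_i \sum_j (G i (g s) ^+ 2 + G j (g s) ^+ 2) / 2.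
      under [RHS]eq_bigr do rewrite -mulr_suml big_split /= mulrDl !mulr_suml.
      rewrite big_split /= exchange_big /= !sumr_const -mulrnDl -big_split /=.
      rewrite mulr_natl; congr (_ *+ _); apply: eq_bigr => j _.
      by rewrite -splitr.
    apply: ler_sum => j _; rewrite mulr_sumr; apply: ler_sum => k _.
    rewrite -[G j _ ^+ 2]real_normK ?num_real// -[G k _ ^+ 2]real_normK ?num_real//.
    move: `|G j _| `|G k _| => x y.
    by have := sqr_ge0 (x - y); rewrite sqrrB; lra.
  - by move=> s _; apply: sumr_ge0 => j _; exact: sqr_ge0.
  - by rewrite /h /g scale0r addr0; apply: big1 => j _; rewrite G0 expr0n.
have : G i (g 1) ^+ 2 <= 0.
  rewrite -h1 /h (bigD1 i)//= lerDl; apply: sumr_ge0 => j _; exact: sqr_ge0.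
rewrite /g scale1r /v addrC subrK => H; apply/eqP.
by rewrite -sqrf_eq0 eq_le H sqr_ge0.
Qed.

(** F = O(N) at [t0]. This class is stable under sums and under multiplication by functions
    continuous at [t0], so a homogeneous linear system is recognized from the shape of its
    right-hand side, without explicit constants. *)
Definition dominated (t0 : 'rV[R]_m) (N F : 'rV[R]_m -> R) :=
  exists2 C, 0 <= C & \forall t \near t0, `|F t| <= C * N t.

Section Dominated.
Variables (t0 : 'rV[R]_m) (N : 'rV[R]_m -> R).
Hypothesis N0 : forall t, 0 <= N t.
Implicit Types F G : 'rV[R]_m -> R.

Lemma dominatedD F G : dominated t0 N F -> dominated t0 N G ->
  dominated t0 N (fun t => F t + G t).
Proof.
move=> [C C0 HF] [D D0 HG]; exists (C + D); first exact: addr_ge0.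
apply: (@filterS2 _ (nbhs t0) (nbhs_filter t0) _ _ _ _ HF HG) => t Ft Gt.
by rewrite (le_trans (ler_normD _ _))// mulrDl lerD.
Qed.

Lemma dominatedN F : dominated t0 N F -> dominated t0 N (fun t => - F t).
Proof. by move=> [C C0 HF]; exists C => //; apply: (@filterS _ (nbhs t0) (nbhs_filter t0) _ _ _ HF) => t; rewrite normrN. Qed.

Lemma dominated0 : dominated t0 N (fun=> 0).
Proof.
exists 0 => //; apply: (@filterE _ (nbhs t0) (nbhs_filter t0)) => t.
by rewrite normr0 mul0r.
Qed.

Lemma dominated_sum I (r : seq I) (F : I -> 'rV[R]_m -> R) :
  (forall i, dominated t0 N (F i)) -> dominated t0 N (fun t => \sum_(i <- r) F i t).
Proof.
move=> HF; elim: r => [|i r IH].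
  by under eq_fun do rewrite big_nil; exact: dominated0.
by under eq_fun do rewrite big_cons; exact: dominatedD.
Qed.

Lemma dominatedMl F G : {for t0, continuous G} -> dominated t0 N F ->
  dominated t0 N (fun t => G t * F t).
Proof.
move=> cG [C C0 HF]; exists ((`|G t0| + 1) * C).
  by rewrite mulr_ge0 ?addr_ge0.
have /cvgrPdist_lt /(_ _ ltr01) HG := cG.
apply: (@filterS2 _ (nbhs t0) (nbhs_filter t0) _ _ _ _ HF HG) => t Ft Gt; rewrite normrM -mulrA ler_pM//.
rewrite -[G t](subrK (G t0)) addrC (le_trans (ler_normD _ _))// lerD2l.
by rewrite distrC ltW.
Qed.

Lemma dominated_near F G : {near nbhs t0, F =1 G} -> dominated t0 N F ->
  dominated t0 N G.
Proof.
move=> FG [C C0 HF]; exists C => //.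
by apply: (@filterS2 _ (nbhs t0) (nbhs_filter t0) _ _ _ _ FG HF) => t ->.
Qed.

End Dominated.

Lemma uniqueness_near (I : finType) (G : I -> 'rV[R]_m -> R) (t0 : 'rV[R]_m) :
  (\forall t \near t0, forall i, differentiable (G i) t) ->
  (forall i k, dominated t0 (fun t => \sum_j `|G j t|) ('D_(ebase R k) (G i))) ->
  (forall i, G i t0 = 0) -> \forall t \near t0, forall i, G i t = 0.
Proof.
move=> dG DG G0; pose N t := \sum_j `|G j t|.
have N0 t : 0 <= N t by exact: sumr_ge0.
pose C i k := sval (cid2 (DG i k)).
have C0 i k : 0 <= C i k by rewrite /C; case: cid2.
have HC i k : \forall t \near t0, `|'D_(ebase R k) (G i) t| <= C i k * N t.
  by rewrite /C; case: cid2.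
pose D := \sum_i \sum_k C i k.
have CD i k : C i k <= D.
  rewrite /D (bigD1 i)//= (bigD1 k)//= -addrA lerDl addr_ge0// sumr_ge0// => j _.
  exact: sumr_ge0.
have H : \forall t \near t0, (forall i, differentiable (G i) t) /\
     forall i k, `|'D_(ebase R k) (G i) t| <= D * N t.
  apply: (@filterI _ (nbhs t0) (nbhs_filter t0)) dG _.
  apply: (@filter_forall _ _ _ (nbhs t0) (nbhs_filter t0)) => i.
  apply: (@filter_forall _ _ _ (nbhs t0) (nbhs_filter t0)) => k.
  apply: (@filterS _ (nbhs t0) (nbhs_filter t0) _ _ _ (HC i k)) => t /le_trans.
  by apply; rewrite ler_wpM2r.
have /nbhs_ballP[r /= r0 rP] := H.
apply/nbhs_ballP; exists r => // t Bt.
apply: (@uniqueness_ball I G t0 r D) => //.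
- by move=> s /rP[].
- by move=> s /rP[].
Qed.

End Uniqueness.

(** The contraction principle in [local_surj] is applied in this complete space. *)
HB.instance Definition _ (R : realType) m n := Complete.on 'M[R]_(m.+1, n.+1).

(** * The inverse function theorem *)

Section InverseFunction.
Variable R : realType.

Lemma derive_coord m (t v : 'rV[R]_m) (j : 'I_m) :
  'D_v (fun t : 'rV[R]_m => t 0 j) t = v 0 j.
Proof.
by rewrite -[in RHS](derive_id t v) derive_mx ?mxE//; exact: derivable_id.
Qed.

Lemma smooth_coord m (U : set 'rV[R]_m) (j : 'I_m) :
  smoothF U (fun t : 'rV[R]_m => t 0 j).
Proof.
case=> [//|k]; split=> [t _|i]; first exact: differentiable_coord.
have -> : 'D_(ebase R i) (fun t : 'rV[R]_m => t 0 j) = cst (ebase R i 0 j).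
  by apply/funext => t; rewrite derive_coord.
exact: Ck_cst.
Qed.

Lemma mulmxr_continuous m n (A : 'M[R]_(m, n)) :
  continuous (mulmxr A : 'rV[R]_m -> 'rV[R]_n).
Proof.
move=> v; apply: differentiable_continuous; apply: differentiable_rV => j.
apply: (@smooth_diff _ _ setT) => //.
have S : smoothF setT (fun s : 'rV[R]_m => \sum_k s 0 k * A k j).
  apply: smooth_sum => [|k]; first exact: openT.
  by apply: smoothM; [exact: openT|exact: smooth_coord|exact: smooth_cst].
by apply: smooth_ext S => [|s _]; [exact: openT|rewrite mxE].
Qed.

Lemma ball_segment m (t0 x y : 'rV[R]_m) r s : ball t0 r x -> ball t0 r y ->
  0 <= s <= 1 -> ball t0 r (x + s *: (y - x)).
Proof.
rewrite -ball_normE /= => Bx By /andP[s0 s1].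
have -> : t0 - (x + s *: (y - x)) = (1 - s) *: (t0 - x) + s *: (t0 - y).
  by apply/rowP => j; rewrite !mxE; ring.
have s10 : 0 <= 1 - s by rewrite subr_ge0.
rewrite (le_lt_trans (ler_normD _ _))// !normrZ !ger0_norm//.
have [->|sn0] := eqVneq s 0; first by rewrite subr0 mul1r mul0r addr0.
have sp : 0 < s by rewrite lt_neqAle eq_sym sn0.
rewrite [ltRHS](_ : r = (1 - s) * r + s * r); last by ring.
by rewrite ler_ltD ?ltr_pM2l// ler_wpM2l// ltW.
Qed.

Variables (n : nat) (U : set 'rV[R]_n.+1) (u : 'rV[R]_n.+1 -> 'rV[R]_n.+1).
Hypotheses (oU : open U) (Su : forall j, smoothF U (fun t => u t 0 j)).

(** Transposed Jacobian: rows are indexed by directions, so that it acts on row vectors from the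
    right. *)
Definition jac t : 'M[R]_n.+1 :=
  \matrix_(i, j) 'D_(ebase R i) (fun s => u s 0 j) t.

Lemma smooth_rV_diff t : U t -> differentiable u t.
Proof. by move=> Ut; apply: differentiable_rV => j; exact: smooth_diff (Su j) Ut. Qed.

Lemma derive_jac t v : U t -> 'D_v u t = v *m jac t.
Proof.
move=> Ut; rewrite derive_sum_basis; last exact: smooth_rV_diff.
apply/rowP => j; rewrite !mxE summxE; apply: eq_bigr => i _.
rewrite !mxE derive_mx ?mxE//; apply: diff_derivable; exact: smooth_rV_diff.
Qed.

Lemma smooth_jac i j : smoothF U (fun t => jac t i j).
Proof.
by apply: smooth_ext (smooth_partial i (Su j)) => // t _; rewrite mxE.
Qed.

Lemma jac_unit t : U t -> (forall v, 'D_v u t = 0 -> v = 0) -> jac t \in unitmx.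
Proof.
move=> Ut inj; rewrite unitmxE unitfE; apply/negP => /det0P[v v0 vJ].
by move/eqP: v0; apply; apply: inj; rewrite derive_jac.
Qed.

Section Local.
Variables (t0 : 'rV[R]_n.+1) (r K : R) (A : 'M[R]_n.+1).
Let B := ball t0 r.
Hypotheses (r0 : 0 < r) (BU : B `<=` U) (K0 : 0 < K)
  (uJ : forall t, B t -> jac t \in unitmx) (uA : A \in unitmx)
  (AK : forall v : 'rV[R]_n.+1, `|v *m A| <= K * `|v|)
  (contr : forall x y, B x -> B y ->
     `|(u y - u x) *m A - (y - x)| <= 2^-1 * `|y - x|).

(** By [contr], u followed by A is a perturbation of the identity with Lipschitz constant 1/2, so it
    shrinks distances by a factor of at most 2, and A stretches them by at most K. *)
Lemma local_lipschitz_inverse x y : B x -> B y -> `|y - x| <= 2 * K * `|u y - u x|.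
Proof.
move=> Bx By; have H1 := contr Bx By; have H2 := AK (u y - u x).
have : `|y - x| <= `|(u y - u x) *m A| + 2^-1 * `|y - x|.
  rewrite -[X in `|X| <= _](subKr ((u y - u x) *m A)) (le_trans (ler_normB _ _))//.
  by rewrite lerD2l.
by move: `|_ *m A| `|y - x| `|u y - u x| H2 => a b c H2; lra.
Qed.

(** Solving u y = z amounts to finding a fixed point of the simplified Newton map y - (u y - z) A,
    which [contr] makes a contraction of ratio 1/2. *)
Lemma local_surj x : B x -> nbhs (u x) (u @` B).
Proof.
move=> Bx; have /nbhs_ballP[rho /= rho0 rhoB] : nbhs x B.
  by apply: open_nbhs_nbhs; split=> //; exact: ball_open.
pose s := rho / 2; have s0 : 0 < s by rewrite divr_gt0.
pose D : set 'rV[R]_n.+1 := closed_ball x s.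
have DE y : D y <-> `|x - y| <= s by rewrite /D closed_ballE.
have DB y : D y -> B y.
  by move=> /DE xy; apply: rhoB; rewrite -ball_normE /= (le_lt_trans xy)// /s; lra.
(* If |u x - z| < s / (2 K), then T moves the centre x by at most s / 2, and the ratio 1/2 then
   keeps the closed ball of radius s invariant. *)
have e0 : 0 < s / (2 * K) by rewrite divr_gt0// mulr_gt0.
apply/nbhs_ballP; exists (s / (2 * K)) => //= z; rewrite -ball_normE /= => uxz.
pose T y := y - (u y - z) *m A.
have TT y1 y2 : B y1 -> B y2 -> `|T y2 - T y1| <= 2^-1 * `|y2 - y1|.
  move=> B1 B2; have := contr B1 B2; rewrite -normrN; congr (`|_| <= _).
  by rewrite /T !mulmxBl; apply/rowP => j; rewrite !mxE; ring.
have TD : {homo T : y / D y >-> D y}.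
  move=> y Dy; apply/DE; have Txx : `|x - T x| <= 2^-1 * s.
    rewrite /T opprB addrC subrK (le_trans (AK _))//.
    rewrite (le_trans (ler_wpM2l (ltW K0) (ltW uxz)))//.
    by rewrite le_eqVlt; apply/orP; left; apply/eqP; field; rewrite gt_eqF.
  have Txy := TT _ _ (DB _ Dy) Bx.
  have -> : x - T y = (x - T x) + (T x - T y) by rewrite subrKA.
  rewrite (le_trans (ler_normD _ _))//.
  have xy : `|x - y| <= s by apply/DE.
  by move: `|T x - T y| `|x - y| `|x - T x| Txx Txy xy => a b c; lra.
have ctr : is_contraction (mkfun_fun TD).
  have h0 : 0 <= (2^-1 : R) by rewrite invr_ge0.
  exists (NngNum h0); split => /=.
    by rewrite invf_lt1// ltr1n.
  by move=> [y1 y2] [/= D1 D2]; exact: TT _ _ (DB _ D2) (DB _ D1).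
have [||p Dp pT] := banach_fixed_point ctr.
- exact: closed_ball_closed.
- by exists x; apply/DE; rewrite subrr normr0 ltW.
exists p; first exact: DB.
have : (u p - z) *m A = 0.
  have : p = T p by exact: pT.
  by move/eqP; rewrite /T eq_sym subr_eq addrC -subr_eq subrr eq_sym => /eqP.
move/(congr1 (mulmxr (invmx A))); rewrite /= mulmxK// mul0mx.
by move/eqP; rewrite subr_eq0 => /eqP.
Qed.

Definition local_inverse y := xget t0 [set x | B x /\ u x = y].

Lemma local_inverseP y : (u @` B) y -> B (local_inverse y) /\ u (local_inverse y) = y.
Proof.
by move=> [x Bx uxy]; apply: (@xgetPex _ t0 [set x | B x /\ u x = y]); exists x.
Qed.

Lemma local_inverseK x : B x -> local_inverse (u x) = x.
Proof.
move=> Bx; have [Bg ug] := local_inverseP (ex_intro2 _ _ x Bx erefl).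
have := local_lipschitz_inverse Bx Bg; rewrite ug subrr normr0 mulr0.
by rewrite normr_le0 subr_eq0 => /eqP.
Qed.

Lemma local_image_open : open (u @` B).
Proof. by rewrite openE => _ [x Bx <-]; exact: local_surj. Qed.

(** The Lipschitz bound on the inverse turns the error o(|z - x|) of the derivative of u into o(|u z
    - u x|). *)
Lemma local_inverse_diff x : B x ->
  differentiable local_inverse (u x) /\
  'd local_inverse (u x) = mulmxr (invmx (jac x)) :> ('rV_n.+1 -> 'rV_n.+1).
Proof.
move=> Bx; apply: diff_epsP; first exact: mulmxr_continuous.
move=> e e0; have [C C0 HC] := linear_lipschitz (@mulmxr_continuous _ _ (invmx (jac x))).
(* The factor C comes from the inverse Jacobian and 2 K from the Lipschitz bound on the inverse. *)
have e'0 : 0 < e / (C * (2 * K)) by rewrite divr_gt0// mulr_gt0// mulr_gt0.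
have /nbhs_ballP[d /= d0 dP] := diff_eps (smooth_rV_diff (BU Bx)) e'0.
have dK : 0 < d / (2 * K) by rewrite divr_gt0// mulr_gt0.
have : nbhs (u x) (fun y => (u @` B) y /\ ball (u x) (d / (2 * K)) y).
  by apply: filterI; [exact: local_surj|exact: nbhsx_ballx].
apply: (@filterS _ (nbhs (u x)) (nbhs_filter (u x))) => _ [[z Bz <-]].
rewrite -ball_normE /= => uxz; rewrite !local_inverseK//.
have zx := local_lipschitz_inverse Bx Bz.
have Bdz : ball x d z.
  rewrite -ball_normE /= distrC (le_lt_trans zx)// distrC.
  by rewrite mulrC -ltr_pdivlMr// mulr_gt0.
have := dP _ Bdz; rewrite -deriveE; last exact: smooth_rV_diff (BU Bx).
rewrite derive_jac; last exact: BU.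
move=> H.
have -> : z - x - (u z - u x) *m invmx (jac x) =
   - mulmxr (invmx (jac x)) (u z - u x - (z - x) *m jac x).
  by rewrite /= [in RHS]mulmxBl mulmxK ?uJ// opprB.
rewrite normrN (le_trans (HC _))//.
rewrite (le_trans (ler_wpM2l (ltW C0) H))//.
rewrite (le_trans (ler_wpM2l (ltW C0) (ler_wpM2l (ltW e'0) zx)))//.
rewrite le_eqVlt; apply/orP; left; apply/eqP.
move: `|u z - u x| => c; field.
by rewrite !gt_eqF.
Qed.

(** Quantifying over all F closes the induction: a partial derivative of [F \o local_inverse] is
    again of the form [G \o local_inverse], with G built from the inverse Jacobian and the
    derivatives of F. *)
Lemma smooth_comp_inverse F : smoothF B F -> smoothF (u @` B) (F \o local_inverse).
Proof.
move=> SF k; elim: k F SF => [//|k IH] F SF.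
have oB : open B by exact: ball_open.
have dF t : B t -> differentiable F t by exact: smooth_diff.
split=> [_ [x Bx <-]|i].
  apply: differentiable_comp; first exact: (local_inverse_diff Bx).1.
  by rewrite local_inverseK//; exact: dF.
pose G t := \sum_j invmx (jac t) i j * 'D_(ebase R j) F t.
have SG : smoothF B G.
  apply: smooth_sum => // j; apply: smoothM => //; last exact: smooth_partial.
  apply: smooth_invmx => // k' l; exact: smoothS BU (smooth_jac k' l).
apply: Ck_ext local_image_open _ (IH G SG) => _ [x Bx <-] /=.
have dFx : differentiable F (local_inverse (u x)) by rewrite local_inverseK//; exact: dF.
have -> := derive_chain (ebase R i) (local_inverse_diff Bx).1 dFx.
rewrite local_inverseK// [RHS]derive_sum_basis; last exact: dF.
rewrite deriveE; last exact: (local_inverse_diff Bx).1.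
rewrite (local_inverse_diff Bx).2.
by apply: eq_bigr => j _; rewrite /= -rowE mxE.
Qed.

End Local.

Lemma inverse_function t0 : U t0 -> (forall v, 'D_v u t0 = 0 -> v = 0) ->
  exists V g, [/\ open V, V `<=` U & V t0] /\
   [/\ open (u @` V), forall t, V t -> g (u t) = t,
       forall y, (u @` V) y -> {for y, continuous g} &
       forall F, smoothF V F -> smoothF (u @` V) (F \o g)].
Proof.
move=> Ut0 inj; have uJ0 := jac_unit Ut0 inj.
pose A := invmx (jac t0).
have [K K0 AK] := linear_lipschitz (@mulmxr_continuous _ _ A).
(* The components of u A minus the identity; their derivatives vanish at [t0]. *)
pose w j t := \sum_k u t 0 k * A k j - t 0 j.
have Sw j : smoothF U (w j).
  apply: smoothB => //; last exact: smooth_coord.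
  by apply: smooth_sum => // k; apply: smoothM => //; exact: smooth_cst.
have Dw t i j : U t -> 'D_(ebase R i) (w j) t = (jac t *m A - 1%:M) i j.
  move=> Ut; rewrite mxE [in LHS]/w.
  have E k : smoothF U (fun t => u t 0 k * A k j).
    by apply: smoothM => //; exact: smooth_cst.
  have S : smoothF U (fun t => \sum_k u t 0 k * A k j) by exact: smooth_sum.
  have -> := deriveB (smooth_derivable (v := ebase R i) S Ut)
    (smooth_derivable (v := ebase R i) (@smooth_coord _ U j) Ut).
  rewrite derive_coord !mxE eqxx /= eq_sym; congr (_ - _).
  have -> : (fun t => \sum_k u t 0 k * A k j) = \sum_k (fun t => u t 0 k * A k j).
    by apply/funext => s; rewrite fct_sumE.
  have H : forall k, derivable (fun t => u t 0 k * A k j) t (ebase R i).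
    by move=> k; exact: smooth_derivable (E k) Ut.
  rewrite (derive_sum H); apply: eq_bigr => k _; rewrite mxE.
  by rewrite [RHS]mulrC; exact: (deriveMr (A k j) (smooth_derivable (v := ebase R i) (Su k) Ut)).
have Dw0 i j : 'D_(ebase R i) (w j) t0 = 0.
  by rewrite Dw// /A mulmxV// subrr mxE.
(* An increment of [w j] is a sum of n + 1 terms, each at most e |y - x|; this e makes the total |y
   - x| / 2. *)
pose e : R := (2 * n.+1%:R)^-1; have e0 : 0 < e by rewrite invr_gt0 mulr_gt0.
have N1 : \forall t \near t0, forall i j, `|'D_(ebase R i) (w j) t| < e.
  apply: (@filter_forall _ _ _ (nbhs t0) (nbhs_filter t0)) => i.
  apply: (@filter_forall _ _ _ (nbhs t0) (nbhs_filter t0)) => j.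
  have /cvgrPdist_lt /(_ _ e0) := smooth_continuous (smooth_partial i (Sw j)) Ut0.
  apply: (@filterS _ (nbhs t0) (nbhs_filter t0)) => t.
  by rewrite Dw0 sub0r normrN.
have N2 : \forall t \near t0, \det (jac t) != 0.
  have := smooth_continuous (smooth_det oU smooth_jac) Ut0.
  move=> /cvgr_neq0; apply; rewrite -unitfE -unitmxE; exact: uJ0.
have NU : nbhs t0 U by exact: open_nbhs_nbhs.
have /nbhs_ballP[r /= r0 rP] : nbhs t0 (fun t => U t /\ (\det (jac t) != 0 /\
   forall i j, `|'D_(ebase R i) (w j) t| < e)).
  exact: (@filterI _ (nbhs t0) (nbhs_filter t0) _ _ NU
    (@filterI _ (nbhs t0) (nbhs_filter t0) _ _ N2 N1)).
have BU : ball t0 r `<=` U by move=> t /rP[].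
have BJ t : ball t0 r t -> jac t \in unitmx.
  by move=> /rP[_ [d0 _]]; rewrite unitmxE unitfE.
have contr x y : ball t0 r x -> ball t0 r y ->
     `|(u y - u x) *m A - (y - x)| <= 2^-1 * `|y - x|.
  move=> Bx By; apply: rV_norm_le => [|j]; first by rewrite mulr_ge0.
  have -> : ((u y - u x) *m A - (y - x)) 0 j = w j y - w j x.
    by rewrite /w mulmxBl !mxE; ring.
  have Bs s : 0 <= s <= 1 -> ball t0 r (x + s *: (y - x)) by exact: ball_segment.
  have [s s01] := @mean_value_segment _ _ (w j) x (y - x)
    (fun s s01 => smooth_diff (Sw j) (BU _ (Bs s s01))).
  rewrite [x + (y - x)]addrC subrK => ->.
  rewrite derive_sum_basis; last exact: smooth_diff (Sw j) (BU _ (Bs s s01)).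
  have [_ [_ He]] := rP _ (Bs s s01).
  apply: (le_trans (ler_norm_sum _ _ _)).
  apply: (@le_trans _ _ (\sum_(i < n.+1) `|y - x| * e)).
    apply: ler_sum => i _; rewrite normrZ ler_pM//; last exact: ltW.
    exact: rV_coord_le.
  rewrite sumr_const card_ord -mulr_natr /e le_eqVlt; apply/orP; left; apply/eqP.
  by move: `|y - x| => c; field.
have uA : A \in unitmx by rewrite unitmx_inv.
exists (ball t0 r), (local_inverse t0 r); split.
  by split=> //; [exact: ball_open|exact: ballxx].
split.
- exact: (@local_image_open t0 r K A).
- by move=> t Bt; exact: (@local_inverseK t0 r K A).
- move=> _ [x Bx <-]; apply: differentiable_continuous.
  exact: (@local_inverse_diff t0 r K A _ _ _ _ _ _ x Bx).1.
- by move=> F SF; exact: (@smooth_comp_inverse t0 r K A).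
Qed.

End InverseFunction.

Opaque derive.

(** * Geometry of Legendrian patches *)

Section EuclideanStructure.
Variables (R : realType) (n : nat).
Local Notation W := (Cvec R n).
Implicit Types (u v w : W).

Lemma rdotC v w : rdot v w = rdot w v.
Proof. by apply: eq_bigr => k _; ring. Qed.

Lemma rdotDl u v w : rdot (u + v) w = rdot u w + rdot v w.
Proof. by rewrite -big_split; apply: eq_bigr => k _ /=; rewrite !mxE; ring. Qed.

Lemma rdotZl a v w : rdot (a *: v) w = a * rdot v w.
Proof. by rewrite mulr_sumr; apply: eq_bigr => k _ /=; rewrite !mxE; ring. Qed.

Lemma rdotNl v w : rdot (- v) w = - rdot v w.
Proof. by rewrite -scaleN1r rdotZl mulN1r. Qed.

Lemma rdotBl u v w : rdot (u - v) w = rdot u w - rdot v w.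
Proof. by rewrite rdotDl rdotNl. Qed.

Lemma rdot0l w : rdot 0 w = 0.
Proof. by rewrite -(scale0r (0 : W)) rdotZl mul0r. Qed.

Lemma rdotDr w u v : rdot w (u + v) = rdot w u + rdot w v.
Proof. by rewrite !(rdotC w) rdotDl. Qed.

Lemma rdotZr a v w : rdot w (a *: v) = a * rdot w v.
Proof. by rewrite !(rdotC w) rdotZl. Qed.

Lemma rdotNr v w : rdot w (- v) = - rdot w v.
Proof. by rewrite !(rdotC w) rdotNl. Qed.

Lemma rdotBr w u v : rdot w (u - v) = rdot w u - rdot w v.
Proof. by rewrite !(rdotC w) rdotBl. Qed.

Lemma rdot0r w : rdot w 0 = 0.
Proof. by rewrite rdotC rdot0l. Qed.

Lemma rdot_suml I (r : seq I) (P : pred I) (F : I -> W) w :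
  rdot (\sum_(i <- r | P i) F i) w = \sum_(i <- r | P i) rdot (F i) w.
Proof.
elim: r => [|i r IH]; first by rewrite !big_nil rdot0l.
by rewrite !big_cons; case: ifP => _ //; rewrite rdotDl IH.
Qed.

Lemma rdot_sumr I (r : seq I) (P : pred I) (F : I -> W) w :
  rdot w (\sum_(i <- r | P i) F i) = \sum_(i <- r | P i) rdot w (F i).
Proof. by rewrite rdotC rdot_suml; apply: eq_bigr => i _; rewrite rdotC. Qed.

Lemma rdot_eq0 v : rdot v v = 0 -> v = 0.
Proof.
move=> v0; have E k : v.1 0 k * v.1 0 k + v.2 0 k * v.2 0 k = 0.
  apply/eqP; rewrite eq_le addr_ge0 -?expr2 ?sqr_ge0// andbT -v0 /rdot.
  rewrite (bigD1 k)//= !expr2 lerDl; apply: sumr_ge0 => j _.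
  by rewrite addr_ge0// -expr2 sqr_ge0.
have E1 k : v.1 0 k = 0 /\ v.2 0 k = 0.
  have := E k; move/eqP; rewrite paddr_eq0 -?expr2 ?sqr_ge0// !sqrf_eq0.
  by move=> /andP[/eqP ? /eqP ?].
rewrite [LHS]surjective_pairing; congr pair; apply/rowP => k; rewrite mxE.
  exact: (E1 k).1.
exact: (E1 k).2.
Qed.

Lemma rdot_inj v : (forall w, rdot v w = 0) -> v = 0.
Proof. by move=> H; exact: rdot_eq0. Qed.

Lemma rdot_ext v w : (forall u, rdot v u = rdot w u) -> v = w.
Proof.
by move=> H; apply/subr0_eq/rdot_inj => u; rewrite rdotBl H subrr.
Qed.

Lemma JmulD v w : Jmul (v + w) = Jmul v + Jmul w.
Proof. by rewrite /Jmul /= opprD. Qed.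

Lemma JmulZ a v : Jmul (a *: v) = a *: Jmul v.
Proof. by rewrite /Jmul /= -scalerN. Qed.

Lemma JmulJ v : Jmul (Jmul v) = - v.
Proof. by case: v. Qed.

Lemma rdotJ v w : rdot (Jmul v) w = - rdot v (Jmul w).
Proof. by rewrite -sumrN; apply: eq_bigr => k _ /=; rewrite !mxE; ring. Qed.

Lemma rdotJJ v w : rdot (Jmul v) (Jmul w) = rdot v w.
Proof. by rewrite rdotJ JmulJ rdotNr opprK. Qed.

Lemma rdotJv v : rdot v (Jmul v) = 0.
Proof.
have := rdotJ v v; rewrite rdotC => H.
by apply/eqP; rewrite -[_ == 0](mulrn_eq0 _ 2) mulr2n {1}H addNr.
Qed.

Definition rdotl w v : R := rdot v w.

Lemma rdotl_linear w : linear (rdotl w : W -> R^o).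
Proof. by move=> a u v; rewrite /rdotl rdotDl rdotZl. Qed.

HB.instance Definition _ w := GRing.isLinear.Build R W R^o _ (rdotl w) (rdotl_linear w).

Lemma rdotl_continuous w : continuous (rdotl w).
Proof.
move=> v; apply: differentiable_continuous; rewrite /rdotl /rdot.
have dfst (x : W) : differentiable (fst : W -> 'rV[R]_n) x.
  by apply: linear_differentiable => y; exact: cvg_fst.
have dsnd (x : W) : differentiable (snd : W -> 'rV[R]_n) x.
  by apply: linear_differentiable => y; exact: cvg_snd.
have -> : (fun v => \sum_k (v.1 0 k * w.1 0 k + v.2 0 k * w.2 0 k)) =
   \sum_k (fun v : W => v.1 0 k * w.1 0 k + v.2 0 k * w.2 0 k).
  by apply/funext => x; rewrite fct_sumE.
apply: differentiable_sum => k; apply: differentiableD; apply: differentiableM.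
- exact: (@differentiable_comp _ _ _ _ fst _ _ (dfst v) (differentiable_coord _ _ _)).
- exact: differentiable_cst.
- exact: (@differentiable_comp _ _ _ _ snd _ _ (dsnd v) (differentiable_coord _ _ _)).
- exact: differentiable_cst.
Qed.

Section VectorSmooth.
Variable m : nat.
Implicit Types (U : set 'rV[R]_m) (F G : 'rV[R]_m -> W) (t : 'rV[R]_m).

(* Equivalent to [smooth_on], but reduces every differentiation rule for vectors
   to the one for real functions. *)
Definition smoothV U F : Prop := forall w, smoothF U (fun t => rdot (F t) w).

Lemma smooth_on_smoothV U F : open U -> smooth_on U F -> smoothV U F.
Proof.
move=> oU SF w.
exact: (@smooth_on_linear R m _ U F (rdotl w) oU (@rdotl_continuous w) SF).
Qed.

Lemma re_rdot v k : v.1 0 k = rdot v (delta_mx 0 k, 0).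
Proof.
rewrite /rdot (bigD1 k)//= !mxE !eqxx mulr0 addr0 mulr1 big1 ?addr0// => j jk.
by rewrite !mxE eqxx (negbTE jk) !mulr0 addr0.
Qed.

Lemma im_rdot v k : v.2 0 k = rdot v (0, delta_mx 0 k).
Proof.
rewrite /rdot (bigD1 k)//= !mxE !eqxx mulr0 add0r mulr1 big1 ?addr0// => j jk.
by rewrite !mxE eqxx (negbTE jk) !mulr0 addr0.
Qed.

Lemma smoothV_diff U F t : smoothV U F -> U t -> differentiable F t.
Proof.
move=> SF Ut.
have -> : F = (fun s => ((F s).1, (F s).2)).
  by apply/funext => s; rewrite -surjective_pairing.
apply: differentiable_pair; apply: differentiable_rV => k.
  by under eq_fun do rewrite re_rdot; exact: smooth_diff (SF _) Ut.
by under eq_fun do rewrite im_rdot; exact: smooth_diff (SF _) Ut.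
Qed.

Lemma derive_rdotl F t (d : 'rV[R]_m) w : differentiable F t ->
  'D_d (fun s => rdot (F s) w) t = rdot ('D_d F t) w.
Proof.
move=> dF; exact: (derive_linear_comp (L := rdotl w) d (@rdotl_continuous w) dF).2.
Qed.

Lemma smoothV_ext U F G : open U -> (forall t, U t -> F t = G t) ->
  smoothV U F -> smoothV U G.
Proof.
by move=> oU FG SF w; apply: smooth_ext (SF w) => // t Ut; rewrite FG.
Qed.

Lemma smoothV_partial U F i : open U -> smoothV U F -> smoothV U ('D_(ebase R i) F).
Proof.
move=> oU SF w; apply: smooth_ext (smooth_partial i (SF w)) => // t Ut.
by rewrite derive_rdotl//; exact: smoothV_diff Ut.
Qed.

Lemma smoothVS U V F : U `<=` V -> smoothV V F -> smoothV U F.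
Proof. by move=> UV SF w; exact: smoothS UV (SF w). Qed.

Lemma smoothVD U F G : open U -> smoothV U F -> smoothV U G ->
  smoothV U (fun t => F t + G t).
Proof.
move=> oU SF SG w; apply: smooth_ext (smoothD oU (SF w) (SG w)) => // t _.
by rewrite rdotDl.
Qed.

Lemma smoothVN U F : open U -> smoothV U F -> smoothV U (fun t => - F t).
Proof.
move=> oU SF w; apply: smooth_ext (smoothN oU (SF w)) => // t _.
by rewrite rdotNl.
Qed.

Lemma smoothVB U F G : open U -> smoothV U F -> smoothV U G ->
  smoothV U (fun t => F t - G t).
Proof. by move=> oU SF SG; apply: smoothVD => //; exact: smoothVN. Qed.

Lemma smoothVZ U (a : 'rV[R]_m -> R) F : open U -> smoothF U a -> smoothV U F ->
  smoothV U (fun t => a t *: F t).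
Proof.
move=> oU Sa SF w; apply: smooth_ext (smoothM oU Sa (SF w)) => // t _.
by rewrite rdotZl.
Qed.

Lemma smoothV_sum U I (r : seq I) (P : pred I) (F : I -> 'rV[R]_m -> W) :
  open U -> (forall i, smoothV U (F i)) ->
  smoothV U (fun t => \sum_(i <- r | P i) F i t).
Proof.
move=> oU SF w.
apply: smooth_ext (@smooth_sum _ _ U _ r P _ oU (fun i => SF i w)) => // t _.
by rewrite rdot_suml.
Qed.

Lemma smoothVJ U F : open U -> smoothV U F -> smoothV U (fun t => Jmul (F t)).
Proof.
move=> oU SF w; apply: smooth_ext (smoothN oU (SF (Jmul w))) => // t _.
by rewrite rdotJ.
Qed.

Lemma smooth_rdot U F G : open U -> smoothV U F -> smoothV U G ->
  smoothF U (fun t => rdot (F t) (G t)).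
Proof.
move=> oU SF SG; apply: smooth_sum => // k; apply: smoothD => //; apply: smoothM => //.
- by apply: smooth_ext (SF (delta_mx 0 k, 0)) => // t _; rewrite re_rdot.
- by apply: smooth_ext (SG (delta_mx 0 k, 0)) => // t _; rewrite re_rdot.
- by apply: smooth_ext (SF (0, delta_mx 0 k)) => // t _; rewrite im_rdot.
- by apply: smooth_ext (SG (0, delta_mx 0 k)) => // t _; rewrite im_rdot.
Qed.

Lemma rdot_coord (x y : W) : rdot x y =
  \sum_k (rdot x (delta_mx 0 k, 0) * rdot y (delta_mx 0 k, 0) +
          rdot x (0, delta_mx 0 k) * rdot y (0, delta_mx 0 k)).
Proof. by apply: eq_bigr => k _; rewrite -!re_rdot -!im_rdot. Qed.

Opaque rdot.

Lemma is_derive_mulr (V : normedModType R) (f g : V -> R) (t d : V) a b :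
  is_derive t d f a -> is_derive t d g b ->
  is_derive t d (f * g) (a * g t + f t * b).
Proof.
move=> Hf Hg; apply: (is_derive_eq (is_deriveM Hf Hg)).
by rewrite /GRing.scale /= addrC mulrC.
Qed.

Lemma is_derive_rdot (V : normedModType R) (F G : V -> W) (t d : V) a b :
  (forall w, is_derive t d (fun s => rdot (F s) w) (rdot a w)) ->
  (forall w, is_derive t d (fun s => rdot (G s) w) (rdot b w)) ->
  is_derive t d (fun s => rdot (F s) (G s)) (rdot a (G t) + rdot (F t) b).
Proof.
move=> dF dG.
pose A k := (delta_mx 0 k : 'rV[R]_n, 0 : 'rV[R]_n) : W.
pose B k := (0 : 'rV[R]_n, delta_mx 0 k : 'rV[R]_n) : W.
have E x y : rdot x y = \sum_k (rdot x (A k) * rdot y (A k) + rdot x (B k) * rdot y (B k)).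
  exact: rdot_coord.
have -> : (fun s => rdot (F s) (G s)) = \sum_k ((fun s => rdot (F s) (A k)) *
   (fun s => rdot (G s) (A k)) + (fun s => rdot (F s) (B k)) * (fun s => rdot (G s) (B k))).
  by apply/funext => s; rewrite E fct_sumE.
have H k := is_deriveD (is_derive_mulr (dF (A k)) (dG (A k)))
                       (is_derive_mulr (dF (B k)) (dG (B k))).
apply: (is_derive_eq (is_derive_sum H)).
rewrite (E a) (E (F t) b) -big_split; apply: eq_bigr => k _; exact: addrACA.
Qed.

Lemma is_derive_rdotl F t (d : 'rV[R]_m) w : differentiable F t ->
  is_derive t d (fun s => rdot (F s) w) (rdot ('D_d F t) w).
Proof.
move=> dF; apply: DeriveDef; last exact: derive_rdotl.
apply: diff_derivable.
exact: (derive_linear_comp (L := rdotl w) d (@rdotl_continuous w) dF).1.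
Qed.

End VectorSmooth.

End EuclideanStructure.

(* Sealed, since unification is prone to unfolding derivatives. *)
HB.lock Definition pd (R : realType) (m : nat) (W : normedModType R) (i : 'I_m)
  (F : 'rV[R]_m -> W) (t : 'rV[R]_m) : W := 'D_(ebase R i) F t.

(** * Differentiation rules for coordinate derivatives *)

Section Partial.
Variables (R : realType) (m : nat) (U : set 'rV[R]_m) (oU : open U).
Implicit Types (F G : 'rV[R]_m -> R) (t : 'rV[R]_m) (i j : 'I_m).

Lemma pdE (W : normedModType R) i (F : 'rV[R]_m -> W) t :
  'D_(ebase R i) F t = pd i F t.
Proof. by rewrite pd.unlock. Qed.

Lemma pd_ext (W : normedModType R) (F G : 'rV[R]_m -> W) t i :
  (forall s, U s -> F s = G s) -> U t -> pd i F t = pd i G t.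
Proof. by rewrite pd.unlock => FG Ut; exact: derive_ext oU FG Ut. Qed.

Lemma pd_cst (W : normedModType R) (c : W) t i : pd i (fun=> c) t = 0.
Proof. by rewrite pd.unlock derive_cst. Qed.

Lemma derive_pd (W : normedModType R) (F : 'rV[R]_m -> W) t v :
  differentiable F t -> 'D_v F t = \sum_i v 0 i *: pd i F t.
Proof. by move=> dF; rewrite derive_sum_basis// pd.unlock. Qed.

Lemma smooth_pd F i : smoothF U F -> smoothF U (pd i F).
Proof. by rewrite pd.unlock; exact: smooth_partial. Qed.

Lemma is_derive_pd F t i : smoothF U F -> U t ->
  is_derive t (ebase R i) F (pd i F t).
Proof.
by rewrite pd.unlock => SF Ut; apply: DeriveDef => //; exact: smooth_derivable Ut.
Qed.

Lemma pd_val (W : normedModType R) (F : 'rV[R]_m -> W) t i (a : W) :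
  is_derive t (ebase R i) F a -> pd i F t = a.
Proof. by rewrite pd.unlock => -[]. Qed.

Lemma pdD F G t i : smoothF U F -> smoothF U G -> U t ->
  pd i (fun s => F s + G s) t = pd i F t + pd i G t.
Proof.
by move=> SF SG Ut; apply/pd_val; apply: is_deriveD; exact: is_derive_pd.
Qed.

Lemma pdN F t i : smoothF U F -> U t -> pd i (fun s => - F s) t = - pd i F t.
Proof. by move=> SF Ut; apply/pd_val; apply: is_deriveN; exact: is_derive_pd. Qed.

Lemma pdB F G t i : smoothF U F -> smoothF U G -> U t ->
  pd i (fun s => F s - G s) t = pd i F t - pd i G t.
Proof.
by move=> SF SG Ut; apply/pd_val; apply: is_deriveB; exact: is_derive_pd.
Qed.

Lemma pdM F G t i : smoothF U F -> smoothF U G -> U t ->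
  pd i (fun s => F s * G s) t = pd i F t * G t + F t * pd i G t.
Proof.
by move=> SF SG Ut; apply/pd_val; apply: is_derive_mulr; exact: is_derive_pd.
Qed.

Lemma pd_sum I (r : seq I) (F : I -> 'rV[R]_m -> R) t i :
  (forall k, smoothF U (F k)) -> U t ->
  pd i (fun s => \sum_(k <- r) F k s) t = \sum_(k <- r) pd i (F k) t.
Proof.
move=> SF Ut; elim: r => [|k r IH].
  by under eq_fun do rewrite big_nil; rewrite big_nil pd_cst.
under eq_fun do rewrite big_cons; rewrite big_cons -IH pdD//.
exact: smooth_sum.
Qed.

Lemma pdC F t i j : smoothF U F -> U t -> pd i (pd j F) t = pd j (pd i F) t.
Proof. by rewrite pd.unlock => SF Ut; exact: partialC Ut. Qed.

Variable n : nat.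
Implicit Types (f g : 'rV[R]_m -> Cvec R n).

Lemma smoothV_pd f i : smoothV U f -> smoothV U (pd i f).
Proof. by rewrite pd.unlock; exact: smoothV_partial. Qed.

Lemma is_derive_rdotl_pd f t i w : smoothV U f -> U t ->
  is_derive t (ebase R i) (fun s => rdot (f s) w) (rdot (pd i f t) w).
Proof.
move=> Sf Ut; rewrite pd.unlock; apply: is_derive_rdotl; exact: smoothV_diff Ut.
Qed.

Lemma pd_rdot f g t i : smoothV U f -> smoothV U g -> U t ->
  pd i (fun s => rdot (f s) (g s)) t = rdot (pd i f t) (g t) + rdot (f t) (pd i g t).
Proof.
move=> Sf Sg Ut; apply/pd_val; apply: is_derive_rdot => w;
  exact: is_derive_rdotl_pd.
Qed.

Lemma pd_rdotl f w t i : smoothV U f -> U t ->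
  pd i (fun s => rdot (f s) w) t = rdot (pd i f t) w.
Proof. by move=> Sf Ut; apply/pd_val; exact: is_derive_rdotl_pd. Qed.

Lemma pdVD f g t i : smoothV U f -> smoothV U g -> U t ->
  pd i (fun s => f s + g s) t = pd i f t + pd i g t.
Proof.
move=> Sf Sg Ut; apply: rdot_ext => w; rewrite rdotDl -!pd_rdotl//; last exact: smoothVD.
by under [in LHS]eq_fun do rewrite rdotDl; rewrite pdD.
Qed.

Lemma pdVN f t i : smoothV U f -> U t -> pd i (fun s => - f s) t = - pd i f t.
Proof.
move=> Sf Ut; apply: rdot_ext => w; rewrite rdotNl -!pd_rdotl//; last exact: smoothVN.
by under [in LHS]eq_fun do rewrite rdotNl; rewrite pdN.
Qed.

Lemma pdVZ F f t i : smoothF U F -> smoothV U f -> U t ->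
  pd i (fun s => F s *: f s) t = pd i F t *: f t + F t *: pd i f t.
Proof.
move=> SF Sf Ut; apply: rdot_ext => w.
rewrite rdotDl !rdotZl -!pd_rdotl//; last exact: smoothVZ.
by under [in LHS]eq_fun do rewrite rdotZl; rewrite pdM.
Qed.

Lemma pdV_sum I (r : seq I) (f : I -> 'rV[R]_m -> Cvec R n) t i :
  (forall k, smoothV U (f k)) -> U t ->
  pd i (fun s => \sum_(k <- r) f k s) t = \sum_(k <- r) pd i (f k) t.
Proof.
move=> Sf Ut; apply: rdot_ext => w; rewrite rdot_suml -pd_rdotl//; last exact: smoothV_sum.
under [in LHS]eq_fun do rewrite rdot_suml.
rewrite pd_sum; [|by move=> k; exact: Sf|exact: Ut].
by apply: eq_bigr => k _; rewrite pd_rdotl.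
Qed.

Lemma pdVJ f t i : smoothV U f -> U t -> pd i (fun s => Jmul (f s)) t = Jmul (pd i f t).
Proof.
move=> Sf Ut; apply: rdot_ext => w; rewrite rdotJ -!pd_rdotl//; last exact: smoothVJ.
by under [in LHS]eq_fun do rewrite rdotJ; rewrite pdN.
Qed.

Lemma pdVC f t i j : smoothV U f -> U t -> pd i (pd j f) t = pd j (pd i f) t.
Proof.
move=> Sf Ut; apply: rdot_ext => w.
have E k l : rdot (pd k (pd l f) t) w = pd k (pd l (fun s => rdot (f s) w)) t.
  rewrite -pd_rdotl//; last exact: smoothV_pd.
  by apply: pd_ext => // s Us; rewrite pd_rdotl.
by rewrite !E pdC.
Qed.

Lemma derive_pdV f t v : smoothV U f -> U t ->
  'D_v f t = \sum_i v 0 i *: pd i f t.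
Proof. by move=> Sf Ut; apply: derive_pd; exact: smoothV_diff Ut. Qed.

End Partial.

Transparent derive.

Section ComplexFrame.
Variables (R : realType) (n : nat).
Local Notation W := (Cvec R n).
Implicit Types (u v w : W).

Transparent rdot.
Lemma hdot_toC v w : hdot (toC v) (toC w) = Complex (rdot v w) (rdot v (Jmul w)).
Proof.
rewrite /hdot /rdot /=.
elim: (index_enum _) => [|k r IH]; first by rewrite !big_nil.
rewrite !big_cons IH !mxE /=; congr Complex; ring.
Qed.
Opaque rdot.

Lemma toC_inj v w : toC v = toC w -> v = w.
Proof.
move=> E; rewrite [v]surjective_pairing [w]surjective_pairing; congr pair;
  apply/rowP => k; have /rowP/(_ k) := E; rewrite !mxE => -[] //.
Qed.

Lemma toCD v w : toC (v + w) = toC v + toC w.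
Proof. by apply/rowP => k; rewrite !mxE. Qed.

Lemma toC0 : toC (0 : W) = 0.
Proof. by apply/rowP => k; rewrite !mxE. Qed.

Lemma toCJ v : toC (Jmul v) = 'i *: toC v.
Proof.
apply/rowP => k; rewrite !mxE /= -complexiE; apply/eqP; rewrite eq_complex /=.
by rewrite !mul0r !mul1r sub0r add0r !eqxx.
Qed.

Lemma toCZ a v : toC (a *: v) = a%:C *: toC v.
Proof.
apply/rowP => k; rewrite !mxE /=; apply/eqP; rewrite eq_complex /=.
by rewrite !mul0r subr0 addr0 !eqxx.
Qed.

Lemma toC_sum I (r : seq I) (P : pred I) (F : I -> W) :
  toC (\sum_(i <- r | P i) F i) = \sum_(i <- r | P i) toC (F i).
Proof.
elim: r => [|i r IH]; first by rewrite !big_nil toC0.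
by rewrite !big_cons; case: ifP => _ //; rewrite toCD IH.
Qed.

End ComplexFrame.

Lemma pd_const (R : realType) (m : nat) (U : set 'rV[R]_m) (F : 'rV[R]_m -> R)
    (c : R) t i : open U -> (forall s, U s -> F s = c) -> U t -> pd i F t = 0.
Proof. by move=> oU Fc Ut; rewrite (pd_ext oU i Fc Ut) pd_cst. Qed.

Record legendrian_patch (R : realType) (m n : nat) (U : set 'rV[R]_m)
    (f : 'rV[R]_m -> Cvec R n) : Prop := LegendrianPatch {
  patch_open : open U;
  patch_smooth : smoothV U f;
  patch_sphere : forall t, U t -> on_sphere (f t);
  patch_immersion : forall t v, U t -> 'D_v f t = 0 -> v = 0;
  patch_integral : integral_on f U
}.

(** * The moving frame of a Legendrian patch *)

Section ChartGeometry.
Variables (R : realType) (m : nat) (U : set 'rV[R]_m) (f : 'rV[R]_m -> Cvec R m.+1).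
Hypothesis LP : legendrian_patch U f.
Let oU : open U. Proof. exact: patch_open LP. Qed.
Let Sf : smoothV U f. Proof. exact: patch_smooth LP. Qed.
Implicit Types (t : 'rV[R]_m) (i j k l : 'I_m).

Let Sd i : smoothV U (pd i f). Proof. exact: smoothV_pd. Qed.
Let Sdd i j : smoothV U (pd i (pd j f)). Proof. exact: smoothV_pd. Qed.

Lemma push_cst i t : push f (cst (ebase R i)) t = pd i f t.
Proof. by rewrite /push /= pdE. Qed.

Lemma gramE t i j : gram f t i j = rdot (pd i f t) (pd j f t).
Proof. by rewrite mxE !pdE. Qed.

Opaque gram.

Lemma gramC t i j : gram f t i j = gram f t j i.
Proof. by rewrite !gramE rdotC. Qed.

Lemma dot_ff t : U t -> rdot (f t) (f t) = 1.
Proof. by move=> Ut; exact: (patch_sphere LP Ut). Qed.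

Lemma dot_df_f t i : U t -> rdot (pd i f t) (f t) = 0.
Proof.
move=> Ut; have := pd_rdot i Sf Sf Ut.
rewrite (pd_const i oU (fun s => @dot_ff s) Ut).
rewrite (rdotC (f t)) => /esym/eqP.
by rewrite -mulr2n mulrn_eq0 /= => /eqP.
Qed.

Lemma dot_df_Jf t i : U t -> rdot (pd i f t) (Jmul (f t)) = 0.
Proof.
move=> Ut; have := patch_integral LP (cst (ebase R i)) Ut.
by rewrite /Defs.eta /Defs.xi rdotNr push_cst => /eqP; rewrite oppr_eq0 => /eqP.
Qed.

Lemma dot_f_Jdf t i : U t -> rdot (f t) (Jmul (pd i f t)) = 0.
Proof. by move=> Ut; rewrite rdotC rdotJ dot_df_Jf// oppr0. Qed.

Lemma ddfC t i j : U t -> pd i (pd j f) t = pd j (pd i f) t.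
Proof. by move=> Ut; exact: pdVC Ut. Qed.

Lemma dot_ddf_Jf_df t i j : U t ->
  rdot (pd i (pd j f) t) (Jmul (f t)) + rdot (pd j f t) (Jmul (pd i f t)) = 0.
Proof.
move=> Ut; rewrite -(pdVJ oU i Sf Ut) -(pd_rdot i (Sd j) (smoothVJ oU Sf) Ut).
by rewrite (pd_const i oU (fun s => @dot_df_Jf s j) Ut).
Qed.

(** In the derivative of <d_j f, J f> = 0 along i, the term with d_i d_j f is symmetric in i and j
    and the other one is antisymmetric, so both vanish. Tangent spaces of integral submanifolds are
    thus totally real. *)
Lemma dot_df_Jdf t i j : U t -> rdot (pd i f t) (Jmul (pd j f t)) = 0.
Proof.
move=> Ut; have H1 := dot_ddf_Jf_df i j Ut; have := dot_ddf_Jf_df j i Ut.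
rewrite (ddfC j i Ut) -[X in _ + X]opprK -rdotJ [rdot (Jmul _) _]rdotC => H2.
have : 2 * rdot (pd j f t) (Jmul (pd i f t)) = 0.
  by move: H1 H2; move: (rdot _ _) (rdot _ _) => x y; lra.
move=> /eqP; rewrite mulf_eq0 pnatr_eq0 /= => /eqP H.
by rewrite rdotC rdotJ H oppr0.
Qed.

Lemma dot_ddf_Jf t i j : U t -> rdot (pd i (pd j f) t) (Jmul (f t)) = 0.
Proof.
by move=> Ut; have := dot_ddf_Jf_df i j Ut; rewrite dot_df_Jdf// addr0.
Qed.

Lemma dot_ddf_f t i j : U t -> rdot (pd i (pd j f) t) (f t) = - gram f t i j.
Proof.
move=> Ut; have := pd_rdot i (Sd j) Sf Ut.
rewrite (pd_const i oU (fun s => @dot_df_f s j) Ut).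
by rewrite gramC gramE => /esym/eqP; rewrite addr_eq0 => /eqP.
Qed.

(** The position vector together with the tangent vectors: m + 1 real-independent vectors spanning a
    totally real subspace, hence a complex basis of C^(m+1). *)
Definition frame (a : 'I_m.+1) t : Cvec R m.+1 :=
  if unlift ord0 a is Some i then pd i f t else f t.

Lemma frame0 t : frame ord0 t = f t.
Proof. by rewrite /frame unlift_none. Qed.

Lemma frameS t i : frame (lift ord0 i) t = pd i f t.
Proof. by rewrite /frame liftK. Qed.

Lemma dot_frame_Jframe t a b : U t -> rdot (frame a t) (Jmul (frame b t)) = 0.
Proof.
move=> Ut; case: (unliftP ord0 a) => [i|] ->; case: (unliftP ord0 b) => [j|] ->;
  rewrite ?frame0 ?frameS.
- exact: dot_df_Jdf.
- exact: dot_df_Jf.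
- exact: dot_f_Jdf.
- exact: rdotJv.
Qed.

Definition frame_gram t : 'M[R]_m.+1 := \matrix_(a, b) rdot (frame a t) (frame b t).

Definition frame_mx t : 'M[R[i]]_m.+1 := \matrix_a toC (frame a t).

Lemma sum_df_eq0 t (v : 'rV[R]_m) : U t -> \sum_i v 0 i *: pd i f t = 0 -> v = 0.
Proof. by move=> Ut; rewrite -(derive_pdV _ Sf Ut); exact: (patch_immersion LP Ut). Qed.

Lemma gram_unit t : U t -> gram f t \in unitmx.
Proof.
move=> Ut; rewrite unitmxE unitfE; apply/negP => /det0P[v /eqP v0 vG].
apply: v0; apply: (sum_df_eq0 Ut); apply: rdot_eq0.
rewrite rdot_suml big1// => i _; rewrite rdotZl rdot_sumr.
rewrite (_ : \sum_j _ = (v *m gram f t) 0 i); first by rewrite vG mxE mulr0.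
by rewrite mxE; apply: eq_bigr => j _; rewrite rdotZr gramC gramE.
Qed.

Lemma frame_gram_unit t : U t -> frame_gram t \in unitmx.
Proof.
move=> Ut; rewrite unitmxE unitfE; apply/negP => /det0P[v /eqP v0 vG].
have V0 : \sum_a v 0 a *: frame a t = 0.
  apply: rdot_eq0; rewrite rdot_suml big1// => a _.
  rewrite rdotZl rdot_sumr.
  rewrite (_ : \sum_j _ = (v *m frame_gram t) 0 a); first by rewrite vG mxE mulr0.
  by rewrite mxE; apply: eq_bigr => b _; rewrite rdotZr mxE rdotC.
have v00 : v 0 ord0 = 0.
  have := congr1 (fun w => rdot w (f t)) V0.
  rewrite rdot0l rdot_suml big_ord_recl /= rdotZl frame0 dot_ff// mulr1.
  by rewrite big1 ?addr0// => i _; rewrite rdotZl frameS dot_df_f// mulr0.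
have vS : (\row_i v 0 (lift ord0 i)) = 0.
  apply: (sum_df_eq0 Ut); rewrite -[RHS]V0 big_ord_recl v00 scale0r add0r.
  by apply: eq_bigr => i _; rewrite frameS mxE.
apply: v0; apply/rowP => a; rewrite mxE; case: (unliftP ord0 a) => [i|] -> //.
by have /rowP/(_ i) := vS; rewrite !mxE.
Qed.

Local Notation adj M := (map_mx conjc (trmx M)).

Lemma frame_mxE t a b : U t ->
  hdot (toC (frame a t)) (toC (frame b t)) = (frame_gram t a b)%:C.
Proof. by move=> Ut; rewrite hdot_toC dot_frame_Jframe// mxE. Qed.

Lemma frame_mx_adj t : U t ->
  frame_mx t *m adj (frame_mx t) = map_mx (real_complex R) (frame_gram t).
Proof.
move=> Ut; apply/matrixP => a b; rewrite mxE [RHS]mxE -frame_mxE//.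
by apply: eq_bigr => k _; rewrite !mxE.
Qed.

Lemma frame_mx_unit t : U t -> frame_mx t \in unitmx.
Proof.
move=> Ut; have : frame_mx t *m adj (frame_mx t) \in unitmx.
  by rewrite frame_mx_adj// map_unitmx frame_gram_unit.
by rewrite unitmx_mul => /andP[].
Qed.

(** The hypotheses say that v is Hermitian-orthogonal to every row of [frame_mx], which is
    invertible because its Hermitian Gram matrix is the real matrix [frame_gram]. *)
Lemma frame_complete t v : U t -> (forall a, rdot v (frame a t) = 0) ->
  (forall a, rdot v (Jmul (frame a t)) = 0) -> v = 0.
Proof.
move=> Ut v0 vJ0; apply: toC_inj; rewrite toC0.
have uP : adj (frame_mx t) \in unitmx.
  by have := frame_mx_unit Ut; rewrite -unitmx_tr -(map_unitmx conjc).
have : toC v *m adj (frame_mx t) = 0.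
  apply/rowP => a; rewrite !mxE.
  have H : hdot (toC v) (toC (frame a t)) = 0 by rewrite hdot_toC v0 vJ0.
  rewrite -[RHS]H.
  by apply: eq_bigr => k _; rewrite !mxE.
by move/(congr1 (mulmx^~ (invmx (adj (frame_mx t))))); rewrite /= mulmxK// mul0mx.
Qed.

Lemma frame_ext t v w : U t -> rdot v (f t) = rdot w (f t) ->
  rdot v (Jmul (f t)) = rdot w (Jmul (f t)) ->
  (forall i, rdot v (pd i f t) = rdot w (pd i f t)) ->
  (forall i, rdot v (Jmul (pd i f t)) = rdot w (Jmul (pd i f t))) -> v = w.
Proof.
move=> Ut H1 H2 H3 H4; apply/subr0_eq/(frame_complete Ut) => a; rewrite rdotBl;
  case: (unliftP ord0 a) => [i|] ->; rewrite ?frame0 ?frameS ?H1 ?H2 ?H3 ?H4 subrr//.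
Qed.

Local Notation dd i j t := (pd i (pd j f) t).
Local Notation Gam := (christoffel f).

Lemma smooth_gram i j : smoothF U (fun t => gram f t i j).
Proof.
by apply: smooth_ext (smooth_rdot oU (Sd i) (Sd j)) => // t _; rewrite gramE.
Qed.

Lemma smooth_ginv i j : smoothF U (fun t => ginv f t i j).
Proof. by apply: (smooth_invmx oU gram_unit) => k l; exact: smooth_gram. Qed.

Lemma gram_sym t : (gram f t)^T = gram f t.
Proof. by apply/matrixP => i j; rewrite mxE gramC. Qed.

Lemma ginvC t i j : ginv f t i j = ginv f t j i.
Proof. by rewrite /ginv -[in RHS]gram_sym -trmx_inv mxE. Qed.

Lemma lower_raise t (x : 'I_m -> R) j : U t ->
  \sum_k (\sum_l ginv f t k l * x l) * gram f t k j = x j.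
Proof.
move=> Ut; transitivity (((\row_l x l) *m ginv f t *m gram f t) 0 j).
  rewrite [RHS]mxE; apply: eq_bigr => k _; rewrite [X in _ = X * _]mxE; congr (_ * _).
  by apply: eq_bigr => l _; rewrite [X in _ = X * _]mxE mulrC ginvC.
by rewrite mulmxKV ?gram_unit// mxE.
Qed.

Lemma raise_lower t (y : 'I_m -> R) k : U t ->
  \sum_l ginv f t k l * (\sum_j y j * gram f t j l) = y k.
Proof.
move=> Ut; transitivity (((\row_l y l) *m gram f t *m ginv f t) 0 k).
  rewrite [RHS]mxE; apply: eq_bigr => l _.
  rewrite [LHS]mulrC (ginvC t k l) [X in _ = X * _]mxE; congr (_ * _).
  by apply: eq_bigr => j _; rewrite [X in _ = X * _]mxE.
by rewrite mulmxK ?gram_unit// mxE.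
Qed.

Lemma gram_inj t (y z : 'I_m -> R) : U t ->
  (forall l, \sum_j y j * gram f t j l = \sum_j z j * gram f t j l) -> y =1 z.
Proof.
move=> Ut yz k; rewrite -(raise_lower y k Ut) -(raise_lower z k Ut).
by apply: eq_bigr => l _; rewrite yz.
Qed.

Lemma derive_gram t i j l : U t ->
  'D_(ebase R i) (fun s => gram f s j l : R^o) t =
  rdot (dd i j t) (pd l f t) + rdot (pd j f t) (dd i l t).
Proof.
move=> Ut; rewrite -(pd_rdot i (Sd j) (Sd l) Ut).
rewrite -[LHS]/('D_(ebase R i) (fun s => gram f s j l) t) pdE.
by apply: (pd_ext oU) => // s _; rewrite gramE.
Qed.

(** The metric is induced from a flat space, so in the Koszul formula all terms cancel except twice
    <d_i d_j f, d_l f>. *)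
Lemma christoffelE t i j k : U t ->
  Gam i j k t = \sum_l ginv f t k l * rdot (dd i j t) (pd l f t).
Proof.
move=> Ut; rewrite /christoffel mulr_sumr; apply: eq_bigr => l _.
rewrite !derive_gram// (ddfC j i Ut) (ddfC l i Ut) (ddfC l j Ut).
rewrite [rdot (pd j f t) _]rdotC [rdot (pd i f t) (dd j l t)]rdotC.
move: (ginv _ _ _ _) (rdot _ _) (rdot _ _) (rdot _ _) => a b c d; by field.
Qed.

Lemma dot_ddf_df t i j l : U t ->
  rdot (dd i j t) (pd l f t) = \sum_k Gam i j k t * gram f t k l.
Proof.
move=> Ut; rewrite -[LHS](lower_raise (fun l => rdot (dd i j t) (pd l f t)) l Ut).
by apply: eq_bigr => k _; rewrite christoffelE.
Qed.

Lemma smooth_christoffel i j k : smoothF U (Gam i j k).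
Proof.
have S : smoothF U (fun t => \sum_l ginv f t k l * rdot (dd i j t) (pd l f t)).
  apply: smooth_sum => // l; apply: smoothM => //; first exact: smooth_ginv.
  exact: smooth_rdot.
by apply: smooth_ext S => // t Ut; rewrite christoffelE.
Qed.

(** The cubic form <B(d_i, d_j), J d_k> of a Legendrian immersion; it is totally symmetric, by
    [cubicC] and [cubicCr]. *)
Definition cubic i j k t : R := rdot (dd i j t) (Jmul (pd k f t)).

Lemma cubicC t i j k : U t -> cubic i j k t = cubic j i k t.
Proof. by move=> Ut; rewrite /cubic ddfC. Qed.

(** This is the derivative of the totally real condition <d_j f, J d_k f> = 0 along i. *)
Lemma cubicCr t i j k : U t -> cubic i j k t = cubic i k j t.
Proof.
move=> Ut; have := pd_rdot i (Sd j) (smoothVJ oU (Sd k)) Ut.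
rewrite (pd_const i oU (fun s => @dot_df_Jdf s j k) Ut) (pdVJ oU i (Sd k) Ut).
rewrite [X in _ + X]rdotC rdotJ /cubic => /esym/eqP.
by rewrite subr_eq0 => /eqP.
Qed.

Lemma smooth_cubic i j k : smoothF U (cubic i j k).
Proof. by apply: smooth_rdot => //; exact: smoothVJ. Qed.

Definition shape i j k t : R := \sum_l ginv f t k l * cubic i j l t.

Lemma smooth_shape i j k : smoothF U (shape i j k).
Proof.
apply: smooth_sum => // l; apply: smoothM => //; first exact: smooth_ginv.
exact: smooth_cubic.
Qed.

Lemma shapeC t i j k : U t -> shape i j k t = shape j i k t.
Proof. by move=> Ut; apply: eq_bigr => l _; rewrite cubicC. Qed.

Lemma shape_gram t i j l : U t -> \sum_k shape i j k t * gram f t k l = cubic i j l t.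
Proof. by move=> Ut; exact: (lower_raise (fun l => cubic i j l t) l Ut). Qed.

(** The Gauss formula, in the real basis formed by the frame and its image under J. The component
    along J f is absent by [dot_ddf_Jf]. *)
Lemma ddfE t i j : U t -> dd i j t =
  \sum_k Gam i j k t *: pd k f t - gram f t i j *: f t
  + \sum_k shape i j k t *: Jmul (pd k f t).
Proof.
move=> Ut; apply: (frame_ext Ut) => [||l|l]; rewrite rdotDl rdotBl !rdot_suml rdotZl.
- rewrite dot_ddf_f// dot_ff// mulr1 !big1 ?sub0r ?addr0// => k _.
    by rewrite rdotZl rdotJ dot_df_Jf// oppr0 mulr0.
  by rewrite rdotZl dot_df_f// mulr0.
- rewrite dot_ddf_Jf// rdotJv mulr0 !big1 ?subr0 ?addr0// => k _.
    by rewrite rdotZl rdotJJ dot_df_f// mulr0.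
  by rewrite rdotZl dot_df_Jf// mulr0.
- rewrite dot_ddf_df// [rdot (f t) _]rdotC dot_df_f// mulr0 subr0.
  rewrite [X in _ = _ + X]big1 ?addr0 => [|k _].
    by apply: eq_bigr => k _; rewrite rdotZl gramE.
  by rewrite rdotZl rdotJ dot_df_Jdf// oppr0 mulr0.
- rewrite dot_f_Jdf// mulr0 subr0 -/(cubic i j l t) -(shape_gram i j l Ut).
  rewrite [X in _ = X + _]big1 ?add0r => [|k _].
    by apply: eq_bigr => k _; rewrite rdotZl rdotJJ gramE.
  by rewrite rdotZl dot_df_Jdf// mulr0.
Qed.

Lemma dot_normal_Jdf t v l : U t ->
  rdot (normal f t v) (Jmul (pd l f t)) = rdot v (Jmul (pd l f t)).
Proof.
move=> Ut; rewrite /normal /tang !rdotBl rdotZl dot_f_Jdf// mulr0 subr0.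
rewrite rdot_suml big1 ?subr0// => i _; rewrite rdot_suml big1// => j _.
by rewrite rdotZl !pdE dot_df_Jdf// mulr0.
Qed.

Lemma push_cstF i : push f (cst (ebase R i)) = pd i f.
Proof. by apply/funext => t; exact: push_cst. Qed.

Lemma sff_cst t i j : U t ->
  sff f (cst (ebase R i)) (cst (ebase R j)) t = \sum_k shape i j k t *: Jmul (pd k f t).
Proof.
move=> Ut; rewrite /sff push_cstF pdE.
apply: (frame_ext Ut) => [||l|l]; rewrite [RHS]rdot_suml.
- rewrite [RHS]big1 => [|k _]; last by rewrite rdotZl rdotJ dot_df_Jf// oppr0 mulr0.
  rewrite /normal /tang !rdotBl rdotZl dot_ff// mulr1 subrr sub0r.
  rewrite rdot_suml big1 ?oppr0// => k _; rewrite rdot_suml big1// => l _.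
  by rewrite rdotZl !pdE dot_df_f// mulr0.
- rewrite [RHS]big1 => [|k _]; last by rewrite rdotZl rdotJJ dot_df_f// mulr0.
  rewrite /normal /tang !rdotBl rdotZl rdotJv mulr0 subr0 dot_ddf_Jf// sub0r.
  rewrite rdot_suml big1 ?oppr0// => k _; rewrite rdot_suml big1// => l _.
  by rewrite rdotZl !pdE dot_df_Jf// mulr0.
- rewrite [RHS]big1 => [|k _]; last by rewrite rdotZl rdotJ dot_df_Jdf// oppr0 mulr0.
  rewrite /normal /tang !rdotBl rdotZl [rdot (f t) _]rdotC dot_df_f// mulr0 subr0.
  apply/eqP; rewrite subr_eq0 eq_sym; apply/eqP.
  rewrite -[RHS](lower_raise (fun l => rdot (dd i j t) (pd l f t)) l Ut) rdot_suml.
  under eq_bigr do rewrite rdot_suml.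
  rewrite exchange_big; apply: eq_bigr => k _; rewrite mulr_suml.
  by apply: eq_bigr => p _; rewrite rdotZl !pdE gramE (ginvC t k p).
- rewrite dot_normal_Jdf// -/(cubic i j l t) -(shape_gram i j l Ut).
  by apply: eq_bigr => k _; rewrite rdotZl rdotJJ gramE.
Qed.

Lemma nabla_row (v : 'rV[R]_m) i t :
  \row_k \sum_a \sum_b ebase R i 0 a * v 0 b * Gam a b k t =
  \row_k \sum_b v 0 b * Gam i b k t.
Proof.
apply/rowP => k; rewrite !mxE (bigD1 i)//= [X in _ + X]big1 ?addr0.
  by apply: eq_bigr => b _; rewrite mxE !eqxx mul1r.
by move=> a ai; apply: big1 => b _; rewrite mxE (negbTE ai) andbF !mul0r.
Qed.

Lemma nabla_cst i j :
  nabla f (cst (ebase R i)) (cst (ebase R j)) = fun t => \row_k Gam i j k t.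
Proof.
apply/funext => t; rewrite /nabla derive_cst add0r nabla_row.
apply/rowP => k; rewrite !mxE (bigD1 j)//= mxE !eqxx mul1r big1 ?addr0// => b bj.
by rewrite mxE (negbTE bj) andbF mul0r.
Qed.

(** * Parallelism of the shape coefficients *)

Section Parallel.
Hypothesis par : C_parallel_on f U.

(** Pairing the C-parallel equation with J d_l f removes its right-hand side, since xi is orthogonal
    to J d_l f. What remains says that the shape tensor is parallel for the Levi-Civita
    connection. *)
Lemma cubic_parallel t i j k l : U t ->
  \sum_p (pd k (shape i j p) t * gram f t p l
          + shape i j p t * rdot (dd k p t) (pd l f t)) =
  \sum_p Gam k i p t * cubic p j l t + \sum_p Gam k j p t * cubic i p l t.
Proof.
move=> Ut.
have := par (@smooth_on_cst _ _ _ U (ebase R k)) (@smooth_on_cst _ _ _ U (ebase R i))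
  (@smooth_on_cst _ _ _ U (ebase R j)) Ut.
move/(congr1 (fun v => rdot v (Jmul (pd l f t)))).
rewrite rdotZl /Defs.xi rdotNl rdotJJ [rdot (f t) _]rdotC dot_df_f// oppr0 mulr0.
have rdot3 (v1 v2 v3 w : Cvec R m.+1) :
    rdot (v1 - v2 - v3) w = rdot v1 w - rdot v2 w - rdot v3 w by rewrite 2!rdotBl.
move/(etrans (esym (rdot3 _ _ _ _))) => H.
have SJ p : smoothV U (fun s => Jmul (pd p f s)) by exact: smoothVJ.
have E1 : rdot (nabla_perp f (cst (ebase R k)) (sff f (cst (ebase R i)) (cst (ebase R j))) t)
    (Jmul (pd l f t)) = \sum_p (pd k (shape i j p) t * gram f t p l
          + shape i j p t * rdot (dd k p t) (pd l f t)).
  rewrite /nabla_perp (dot_normal_Jdf _ l Ut) pdE (pd_ext oU k (fun s => @sff_cst s i j) Ut).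
  have S p : smoothV U (fun s => shape i j p s *: Jmul (pd p f s)).
    by apply: smoothVZ => //; exact: smooth_shape.
  rewrite (pdV_sum oU _ k S Ut).
  rewrite rdot_suml; apply: eq_bigr => p _.
  rewrite (pdVZ oU k (smooth_shape i j p) (SJ p) Ut) rdotDl !rdotZl rdotJJ gramE.
  by rewrite (pdVJ oU k (Sd p) Ut) rdotJJ.
have E2 : rdot (sff f (nabla f (cst (ebase R k)) (cst (ebase R i))) (cst (ebase R j)) t)
    (Jmul (pd l f t)) = \sum_p Gam k i p t * cubic p j l t.
  rewrite /sff (dot_normal_Jdf _ l Ut) push_cstF nabla_cst (derive_pdV _ (Sd j) Ut).
  by rewrite rdot_suml; apply: eq_bigr => p _; rewrite rdotZl mxE.
(* Here the differentiated field has variable coefficients, but the derivatives of the Christoffel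
   symbols multiply tangent vectors, which are orthogonal to J d_l f. *)
have E3 : rdot (sff f (cst (ebase R i)) (nabla f (cst (ebase R k)) (cst (ebase R j))) t)
    (Jmul (pd l f t)) = \sum_p Gam k j p t * cubic i p l t.
  rewrite /sff (dot_normal_Jdf _ l Ut) nabla_cst /= pdE.
  have E s : U s -> push f (fun t => \row_q Gam k j q t) s =
      \sum_p Gam k j p s *: pd p f s.
    by move=> Us; rewrite /push (derive_pdV _ Sf Us); apply: eq_bigr => p _; rewrite mxE.
  have S p : smoothV U (fun s => Gam k j p s *: pd p f s).
    by apply: smoothVZ => //; exact: smooth_christoffel.
  rewrite (pd_ext oU i E Ut) (pdV_sum oU _ i S Ut).
  rewrite rdot_suml; apply: eq_bigr => p _.
  rewrite (pdVZ oU i (smooth_christoffel k j p) (Sd p) Ut) rdotDl !rdotZl.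
  by rewrite dot_df_Jdf// mulr0 add0r.
apply/eqP; rewrite -subr_eq0 opprD addrA; apply/eqP; apply: etrans H.
by congr (_ - _ - _); [exact: esym E1|exact: esym E2|exact: esym E3].
Qed.

Lemma shape_parallel t i j k n : U t -> pd k (shape i j n) t =
  \sum_p Gam k i p t * shape p j n t + \sum_p Gam k j p t * shape i p n t
  - \sum_p Gam k p n t * shape i j p t.
Proof.
move=> Ut; apply: (@gram_inj t (fun n => pd k (shape i j n) t)
  (fun n => \sum_p Gam k i p t * shape p j n t + \sum_p Gam k j p t * shape i p n t
  - \sum_p Gam k p n t * shape i j p t)) => // l.
have := cubic_parallel i j k l Ut; rewrite big_split /= => /eqP.
rewrite -subr_eq0 opprD addrA; set A := \sum_j _ => H.
have -> : A = \sum_p Gam k i p t * cubic p j l t + \sum_p Gam k j p t * cubic i p l t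
   - \sum_p shape i j p t * rdot (dd k p t) (pd l f t).
  by move: H; move: (\sum_p _) (\sum_p _) (\sum_p _) => x y z /eqP H; lra.
under [in RHS]eq_bigr do rewrite mulrBl mulrDl !mulr_suml.
rewrite sumrB big_split /=; congr (_ + _ - _).
- rewrite exchange_big; apply: eq_bigr => p _ /=.
  by rewrite -(shape_gram p j l Ut) mulr_sumr; apply: eq_bigr => q _; rewrite mulrA.
- rewrite exchange_big; apply: eq_bigr => p _ /=.
  by rewrite -(shape_gram i p l Ut) mulr_sumr; apply: eq_bigr => q _; rewrite mulrA.
- rewrite exchange_big; apply: eq_bigr => p _ /=.
  rewrite dot_ddf_df// mulr_sumr; apply: eq_bigr => q _; ring.
Qed.

End Parallel.

(** * The Gauss equation of a flat metric *)

Section Flat.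
Hypothesis flatU : flat_on f U.

Lemma christoffel_flat t i j k l : U t ->
  pd i (Gam j k l) t + \sum_q Gam j k q t * Gam i q l t =
  pd j (Gam i k l) t + \sum_q Gam i k q t * Gam j q l t.
Proof.
move=> Ut.
have := flatU (@smooth_on_cst _ _ _ U (ebase R i)) (@smooth_on_cst _ _ _ U (ebase R j))
  (@smooth_on_cst _ _ _ U (ebase R k)) Ut.
have E a b : nabla f (cst (ebase R a)) (nabla f (cst (ebase R b)) (cst (ebase R k))) t
    = \row_p (pd a (Gam b k p) t + \sum_q Gam b k q t * Gam a q p t).
  rewrite nabla_cst /nabla nabla_row; apply/rowP => p; rewrite !mxE; congr (_ + _).
    rewrite derive_mx ?mxE.
      by rewrite pdE; apply: (pd_ext oU) => // s _; rewrite mxE.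
    apply: diff_derivable; apply: differentiable_rV => q.
    under eq_fun do rewrite mxE; exact: smooth_diff (smooth_christoffel b k q) Ut.
  by apply: eq_bigr => q _; rewrite mxE.
have B0 : nabla f (bracket (cst (ebase R i)) (cst (ebase R j))) (cst (ebase R k)) t = 0.
  rewrite /nabla /bracket derive_cst add0r; apply/rowP => p; rewrite !mxE.
  apply: big1 => a _; apply: big1 => b _.
  by rewrite !derive_cst subrr mxE !mul0r.
rewrite /riemann !E B0 subr0 => /rowP/(_ l); rewrite !mxE => /eqP.
by rewrite subr_eq0 => /eqP.
Qed.

Lemma dot_dddf t i j k l : U t ->
  rdot (pd i (pd j (pd k f)) t) (pd l f t) =
  \sum_q (pd i (Gam j k q) t + \sum_p Gam j k p t * Gam i p q t) * gram f t q l
  - gram f t j k * gram f t i l - \sum_p shape j k p t * cubic i p l t.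
Proof.
move=> Ut; rewrite (pd_ext oU i (fun s => @ddfE s j k) Ut).
have SJ p : smoothV U (fun s => Jmul (pd p f s)) by exact: smoothVJ.
have S1 p : smoothV U (fun s => Gam j k p s *: pd p f s).
  by apply: smoothVZ => //; exact: smooth_christoffel.
have S2 p : smoothV U (fun s => shape j k p s *: Jmul (pd p f s)).
  by apply: smoothVZ => //; exact: smooth_shape.
have S3 : smoothV U (fun s => gram f s j k *: f s).
  by apply: smoothVZ => //; exact: smooth_gram.
have S4 := @smoothV_sum _ _ _ U _ (index_enum 'I_m) xpredT _ oU S1.
have S5 := @smoothV_sum _ _ _ U _ (index_enum 'I_m) xpredT _ oU S2.
rewrite (pdVD oU i (smoothVB oU S4 S3) S5 Ut).
rewrite (pdVD oU i S4 (smoothVN oU S3) Ut) (pdVN oU i S3 Ut).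
rewrite (pdV_sum oU _ i S1 Ut) (pdV_sum oU _ i S2 Ut).
rewrite (pdVZ oU i (smooth_gram j k) Sf Ut).
rewrite rdotDl rdotBl rdotDl !rdotZl [rdot (f t) _]rdotC dot_df_f// mulr0 add0r.
rewrite -gramE !rdot_suml; congr (_ - _ + _).
  transitivity (\sum_p (pd i (Gam j k p) t * gram f t p l +
      \sum_q (Gam j k p t * Gam i p q t) * gram f t q l)).
    apply: eq_bigr => p _.
    rewrite (pdVZ oU i (smooth_christoffel j k p) (Sd p) Ut) rdotDl !rdotZl.
    rewrite -gramE dot_ddf_df// mulr_sumr; congr (_ + _).
    by apply: eq_bigr => q _; rewrite mulrA.
  rewrite big_split /= exchange_big /= -big_split /=; apply: eq_bigr => q _.
  by rewrite mulrDl mulr_suml.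
rewrite -sumrN; apply: eq_bigr => p _.
rewrite (pdVZ oU i (smooth_shape j k p) (SJ p) Ut) rdotDl !rdotZl.
rewrite rdotJ dot_df_Jdf// oppr0 mulr0 add0r (pdVJ oU i (Sd p) Ut).
by rewrite rdotJ mulrN.
Qed.

(** The tangential parts of d_i d_j d_k f and d_j d_i d_k f agree. Their Christoffel terms agree
    too, because the curvature vanishes, so the remaining terms must be equal. *)
Lemma gauss t i j k l : U t ->
  gram f t j k * gram f t i l + \sum_p shape j k p t * cubic i p l t =
  gram f t i k * gram f t j l + \sum_p shape i k p t * cubic j p l t.
Proof.
move=> Ut; have := dot_dddf i j k l Ut.
rewrite (pdVC oU i j (Sd k) Ut) dot_dddf//.
under eq_bigr do rewrite -(christoffel_flat i j k _ Ut).
move: (\sum_q _) (\sum_p _) (\sum_p _) => x y z H; lra.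
Qed.

End Flat.

End ChartGeometry.

Transparent gram.

(** * The common eigenbasis *)

Section SkewDiag.
Local Open Scope sesquilinear_scope.
Variables (R : realType) (n : nat).

Lemma adjM k (A B : 'M[R[i]]_k) : (A *m B)^t* = B^t* *m A^t*.
Proof. by rewrite trmx_mul map_mxM. Qed.

Lemma conj_comm (Q A B : 'M[R[i]]_n) : Q \in unitmx -> A *m B = B *m A ->
  (invmx Q *m A *m Q) *m (invmx Q *m B *m Q) =
  (invmx Q *m B *m Q) *m (invmx Q *m A *m Q).
Proof.
move=> uQ AB.
have H X Y : (invmx Q *m X *m Q) *m (invmx Q *m Y *m Q) = invmx Q *m (X *m Y) *m Q.
  by rewrite !mulmxA mulmxK.
by rewrite !H AB.
Qed.

Lemma conj_intertwine (Q A : 'M[R[i]]_n) : Q \in unitmx ->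
  A *m Q = Q *m (invmx Q *m A *m Q).
Proof. by move=> uQ; rewrite -(mulmxA (invmx Q)) mulKVmx. Qed.

(** A commuting family is triangular in a common unitary basis. Skewness survives the unitary change
    of basis, and a triangular skew-hermitian matrix is diagonal with imaginary entries. Eigenvalues
    may be repeated. *)
Lemma skew_codiag (I : finType) (K : I -> 'M[R[i]]_n) :
  (forall i j, K i *m K j = K j *m K i) -> (forall i, (K i)^t* = - K i) ->
  exists2 P : 'M[R[i]]_n, P \is unitarymx &
    exists mu : I -> 'I_n -> R, forall i,
      K i *m P^t* = P^t* *m diag_mx (\row_a Complex 0 (mu i a)).
Proof.
move=> KC Kskew; have [|P uP /allP tP] := @cotrigonalization _ n [seq K i | i <- enum I].
  by move=> _ _ /mapP[i _ ->] /mapP[j _ ->]; exact: KC.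
have [T TE] : exists T, forall i, T i = P *m K i *m P^t* by exists (fun i => P *m K i *m P^t*).
have Ttrig i : is_trig_mx (T i).
  have /= := tP (K i) (map_f K (mem_enum I i)).
  by rewrite TE /similar_to conjymx.
have Tskew i : (T i)^t* = - T i.
  by rewrite TE !adjM trmxCK Kskew mulNmx mulmxN mulmxA.
have Tij i a b : T i a b = - conjc (T i b a).
  have /matrixP/(_ a b) := Tskew i; rewrite !mxE => E.
  by rewrite -[LHS]opprK -E.
have Tdiag i : T i = diag_mx (\row_a Complex 0 (complex.Im (T i a a))).
  apply/matrixP => a b; rewrite !mxE; case: (eqVneq a b) => [<-|ab].
    have := Tij i a a; case: (T i a a) => x y /= [xx yy].
    rewrite mulr1n; apply/eqP; rewrite eq_complex /= eqxx andbT; apply/eqP.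
    by move: xx; lra.
  rewrite mulr0n; have [lab|lba] := ltnP a b.
    by have /is_trig_mxP := Ttrig i; apply.
  rewrite Tij; have /is_trig_mxP -> // := Ttrig i; first by rewrite conjc0 oppr0.
  by rewrite ltn_neqAle lba andbT eq_sym.
exists P => //; exists (fun i a => complex.Im (T i a a)) => i.
have uP' : P^t* *m P = 1%:M.
  by have := mulVmx (unitarymx_unit uP); rewrite invmx_unitary.
by rewrite -Tdiag TE !mulmxA uP' mul1mx.
Qed.

End SkewDiag.

Section Diagonalization.
Local Open Scope sesquilinear_scope.
Variables (R : realType) (m : nat) (U : set 'rV[R]_m) (f : 'rV[R]_m -> Cvec R m.+1).
Hypothesis LP : legendrian_patch U f.
Hypothesis flatU : flat_on f U.
Variable t : 'rV[R]_m.
Hypothesis Ut : U t.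
Implicit Types (i j k l : 'I_m).

Local Notation S i j k := (shape f i j k t).
Local Notation g i j := (gram f t i j).
Local Notation Phi := (frame_mx f t).

(* The matrix, in the frame (f, d_1 f, .., d_m f) of C^(m+1), of the skew-hermitian
   endomorphism f |-> d_i f, d_j f |-> - g_ij f + i S_ij^k d_k f. *)
Definition connection_mx i : 'M[R[i]]_m.+1 := \matrix_(b, c)
  match unlift ord0 b, unlift ord0 c with
  | None, None => 0
  | None, Some k => (k == i)%:R
  | Some j, None => Complex (- g i j) 0
  | Some j, Some k => Complex 0 (S i j k)
  end.
Local Notation M := connection_mx.

Lemma connection00 i : M i ord0 ord0 = 0.
Proof. by rewrite [LHS]mxE unlift_none. Qed.

Lemma connection0S i k : M i ord0 (lift ord0 k) = (k == i)%:R.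
Proof. by rewrite [LHS]mxE unlift_none liftK. Qed.

Lemma connectionS0 i j : M i (lift ord0 j) ord0 = Complex (- g i j) 0.
Proof. by rewrite [LHS]mxE unlift_none liftK. Qed.

Lemma connectionSS i j k : M i (lift ord0 j) (lift ord0 k) = Complex 0 (S i j k).
Proof. by rewrite [LHS]mxE !liftK. Qed.

Lemma sumC (I : Type) (r : seq I) (F G : I -> R) :
  \sum_(x <- r) Complex (F x) (G x) = Complex (\sum_(x <- r) F x) (\sum_(x <- r) G x).
Proof.
elim: r => [|x r IH]; first by rewrite !big_nil.
by rewrite !big_cons IH.
Qed.

Lemma connection_row0 i n (A : 'M[R[i]]_(m.+1, n)) b :
  (M i *m A) ord0 b = A (lift ord0 i) b.
Proof.
rewrite mxE big_ord_recl connection00 mul0r add0r (bigD1 i)//=.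
rewrite connection0S eqxx mul1r big1 ?addr0// => k ki.
by rewrite connection0S (negbTE ki) mul0r.
Qed.

Lemma connection_rowS i j n (A : 'M[R[i]]_(m.+1, n)) b :
  (M i *m A) (lift ord0 j) b =
  Complex (- g i j) 0 * A ord0 b + \sum_k Complex 0 (S i j k) * A (lift ord0 k) b.
Proof.
rewrite mxE big_ord_recl connectionS0; congr (_ + _).
by apply: eq_bigr => k _; rewrite connectionSS.
Qed.

(** In the row of f the identity is the symmetry of g and of S in their lower indices. In a tangent
    row, the tangent columns give the Gauss equation with one index raised, and the column of f
    gives the total symmetry of [cubic]. *)
Lemma connectionC i j : M i *m M j = M j *m M i.
Proof.
apply/matrixP => b c; case: (unliftP ord0 b) => [k|] ->; last first.
  rewrite !connection_row0; case: (unliftP ord0 c) => [l|] ->.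
    by rewrite !connectionSS (shapeC LP _ _ _ Ut).
  by rewrite !connectionS0 gramC.
rewrite !connection_rowS; case: (unliftP ord0 c) => [l|] ->.
  have E p q : Complex (- g p k) 0 * M q ord0 (lift ord0 l) +
     \sum_r Complex 0 (S p k r) * M q (lift ord0 r) (lift ord0 l) =
     Complex (- (g p k * (l == q)%:R + \sum_r S p k r * S q r l)) 0.
    rewrite connection0S.
    under eq_bigr => r _.
      rewrite connectionSS.
      have -> : Complex 0 (S p k r) * Complex 0 (S q r l) = Complex (- (S p k r * S q r l)) 0.
        by apply/eqP; rewrite eq_complex /= !mul0r !mulr0 sub0r addr0 !eqxx.
      over.
    rewrite sumC sumrN big1_eq opprD.
    by case: eqP => _; apply/eqP; rewrite eq_complex /= ?(mulr1, mulr0, mul0r, subr0, addr0, oppr0, add0r) !eqxx.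
  rewrite !E; congr (Complex (- _) _).
  pose y a b l := g a k * (l == b)%:R + \sum_r S a k r * S b r l.
  rewrite -/(y i j l) -/(y j i l).
  suff yE : y i j =1 y j i by exact: yE.
  apply: (gram_inj LP Ut) => q; rewrite /y.
  have F p s : \sum_h (g p k * (h == s)%:R + \sum_r S p k r * S s r h) * g h q
     = g p k * g s q + \sum_r S p k r * cubic f s r q t.
    under eq_bigr do rewrite mulrDl mulr_suml.
    rewrite big_split /= (bigD1 s)//= eqxx mulr1 [X in _ + X + _]big1 ?addr0; last first.
      by move=> h hs; rewrite (negbTE hs) mulr0 mul0r.
    congr (_ + _); rewrite exchange_big; apply: eq_bigr => r _ /=.
    rewrite -(shape_gram LP s r q Ut) mulr_sumr.
    by apply: eq_bigr => h _; rewrite mulrA.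
  by rewrite !F; exact: (gauss LP flatU j i k q Ut).
have E p q : Complex (- g p k) 0 * M q ord0 ord0 +
     \sum_r Complex 0 (S p k r) * M q (lift ord0 r) ord0 =
     Complex 0 (- cubic f p k q t).
  rewrite connection00 mulr0 add0r -(shape_gram LP p k q Ut).
  under eq_bigr => r _.
    rewrite connectionS0.
    have -> : Complex 0 (S p k r) * Complex (- g q r) 0 = Complex 0 (- (S p k r * g r q)).
      apply/eqP; rewrite eq_complex /= !mul0r !mulr0 subr0 add0r mulrN (gramC _ _ q r).
      by rewrite !eqxx.
    over.
  by rewrite sumC sumrN big1_eq.
rewrite !E (cubicCr LP i k j Ut) (cubicC LP i j k Ut).
by rewrite (cubicCr LP j i k Ut).
Qed.

(** In a non-orthonormal basis with Gram matrix G, skewness of the endomorphism means that M G is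
    skew-hermitian. Its mixed entries are g and - g, and its tangent block is i times the symmetric
    matrix [cubic f i]. *)
Lemma connection_skew i :
  (M i *m Phi *m Phi^t*)^t* = - (M i *m Phi *m Phi^t*).
Proof.
have -> : M i *m Phi *m Phi^t* = M i *m map_mx (real_complex R) (frame_gram f t).
  by rewrite -mulmxA (frame_mx_adj LP Ut).
have fg0 : frame_gram f t ord0 ord0 = 1 by rewrite mxE frame0 (dot_ff LP Ut).
have fgl l : frame_gram f t (lift ord0 l) ord0 = 0.
  by rewrite mxE frame0 frameS (dot_df_f LP l Ut).
have fgr l : frame_gram f t ord0 (lift ord0 l) = 0.
  by rewrite mxE rdotC frame0 frameS (dot_df_f LP l Ut).
have fgS k l : frame_gram f t (lift ord0 k) (lift ord0 l) = g k l.
  by rewrite mxE !frameS gramE.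
have FE b c : map_mx (real_complex R) (frame_gram f t) b c = (frame_gram f t b c)%:C.
  by rewrite [LHS]mxE.
set N := M i *m _.
have N00 : N ord0 ord0 = 0 by rewrite /N connection_row0 FE fgl.
have N0S k : N ord0 (lift ord0 k) = (g i k)%:C by rewrite /N connection_row0 FE fgS.
have NS0 k : N (lift ord0 k) ord0 = - (g i k)%:C.
  rewrite /N connection_rowS FE fg0 mulr1 big1 => [|l _]; last by rewrite FE fgl mulr0.
  by apply/eqP; rewrite addr0 eq_complex /= oppr0 !eqxx.
have NSS k l : N (lift ord0 k) (lift ord0 l) = Complex 0 (cubic f i k l t).
  rewrite /N connection_rowS FE fgr mulr0 add0r -(shape_gram LP i k l Ut).
  under eq_bigr => r _.
    rewrite FE fgS.
    have -> : Complex 0 (S i k r) * (g r l)%:C = Complex 0 (S i k r * g r l).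
      by apply/eqP; rewrite eq_complex /= !mul0r !mulr0 subr0 add0r !eqxx.
    over.
  by rewrite sumC big1_eq.
clearbody N; apply/matrixP => b c; rewrite !mxE.
case: (unliftP ord0 b) => [k|] ->; case: (unliftP ord0 c) => [l|] ->.
- rewrite !NSS (cubicCr LP i l k Ut); apply/eqP.
  by rewrite eq_complex /= oppr0 !eqxx.
- by rewrite NS0 N0S opprK; apply/eqP; rewrite eq_complex /= oppr0 !eqxx.
- by rewrite NS0 N0S; apply/eqP; rewrite eq_complex /= !oppr0 !eqxx.
- by rewrite N00 oppr0 rmorph0.
Qed.

(** If Z holds the coordinates of the frame in the eigenbasis, then M_i Z = Z diag(i mu_i). The row
    of f yields d_i z_a = i mu_ia z_a; substituted in the tangent rows and divided by z_a, this
    yields the eigenvalue relation for S. *)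
Lemma shape_eigen : exists (E : 'I_m.+1 -> Cvec R m.+1) (mu : 'I_m -> 'I_m.+1 -> R),
  (forall a b, hdot (toC (E a)) (toC (E b)) = (a == b)%:R) /\
  forall a, let x := rdot (f t) (E a) in let y := rdot (f t) (Jmul (E a)) in
  [/\ 0 < x ^+ 2 + y ^+ 2,
      forall i, rdot (pd i f t) (E a) = - (mu i a * y),
      forall i, rdot (pd i f t) (Jmul (E a)) = mu i a * x &
      forall i j, \sum_k S i j k * mu k a = mu i a * mu j a - g i j].
Proof.
have uPhi : Phi \in unitmx by exact: (frame_mx_unit LP Ut).
have uPhis : Phi^t* \in unitmx by rewrite map_unitmx unitmx_tr.
pose K i := invmx Phi *m M i *m Phi.
have KE i : K i = invmx Phi *m (M i *m Phi *m Phi^t*) *m invmx (Phi^t*).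
  by rewrite !mulmxA mulmxK.
have KC i j : K i *m K j = K j *m K i.
  exact: (conj_comm uPhi (connectionC i j)).
have Kskew i : (K i)^t* = - K i.
  rewrite KE 2!adjM connection_skew mulNmx mulmxN -!mulmxA.
  by rewrite !trmx_inv !map_invmx trmxCK.
have [P uP [mu KP]] := skew_codiag KC Kskew.
pose E a : Cvec R m.+1 := (\row_k complex.Re (P a k), \row_k complex.Im (P a k)).
have EE a : toC (E a) = row a P.
  by apply/rowP => k; rewrite !mxE /=; case: (P a k).
pose Z := Phi *m P^t*.
have ZE b a : Z b a = Complex (rdot (frame f b t) (E a)) (rdot (frame f b t) (Jmul (E a))).
  rewrite -hdot_toC EE /Z mxE /hdot; apply: eq_bigr => k _.
  by rewrite !mxE.
have MZ i : M i *m Z = Z *m diag_mx (\row_a Complex 0 (mu i a)).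
  have MK : M i *m Phi = Phi *m K i by exact: conj_intertwine.
  by rewrite /Z mulmxA MK -mulmxA KP mulmxA.
have MZ' i b a : (M i *m Z) b a = Z b a * Complex 0 (mu i a).
  by rewrite MZ mul_mx_diag !mxE.
have Zu : Z \in unitmx.
  by rewrite unitmx_mul uPhi map_unitmx unitmx_tr unitarymx_unit.
exists E, mu; split=> [a b|a x y].
  have /unitarymxP/matrixP/(_ a b) := uP; rewrite [RHS]mxE => <-.
  by rewrite mxE !EE; apply: eq_bigr => k _; rewrite !mxE.
have Z0 : Z ord0 a = Complex x y by rewrite ZE frame0.
have ZS i : Z (lift ord0 i) a = Complex (- (mu i a * y)) (mu i a * x).
  rewrite -connection_row0 MZ' Z0; apply/eqP; rewrite eq_complex /=.
  by apply/andP; split; apply/eqP; ring.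
(* If z_a were zero, column a of the invertible matrix Z would vanish by [ZS]. *)
have xy : 0 < x ^+ 2 + y ^+ 2.
  rewrite lt_def addr_ge0 ?sqr_ge0// andbT paddr_eq0 ?sqr_ge0// !sqrf_eq0.
  apply/negP => /andP[/eqP x0 /eqP y0].
  have : \det Z = 0.
    rewrite (expand_det_col _ a) big1// => b _.
    case: (unliftP ord0 b) => [i|] ->; rewrite ?ZS ?Z0 x0 y0 ?mulr0 ?oppr0;
      by rewrite [Complex _ _](_ : _ = 0) ?mul0r.
  by move/eqP; rewrite -[_ == 0]negbK -unitfE -unitmxE Zu.
split=> // [i|i|i j].
- by have := ZS i; rewrite ZE frameS => -[].
- by have := ZS i; rewrite ZE frameS => -[].
have := MZ' i (lift ord0 j) a; rewrite connection_rowS Z0 ZS.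
have -> : \sum_k Complex 0 (S i j k) * Z (lift ord0 k) a =
  Complex (- ((\sum_k S i j k * mu k a) * x)) (- ((\sum_k S i j k * mu k a) * y)).
  rewrite !mulr_suml -!sumrN -sumC; apply: eq_bigr => k _; rewrite ZS.
  by apply/eqP; rewrite eq_complex /=; apply/andP; split; apply/eqP; ring.
move: (\sum_k _) => s /eqP; rewrite eq_complex /= => /andP[/eqP E1 /eqP E2].
have H1 : (s - (mu i a * mu j a - g i j)) * x = 0 by move: E1; lra.
have H2 : (s - (mu i a * mu j a - g i j)) * y = 0 by move: E2; lra.
apply/eqP; rewrite -subr_eq0; apply/negPn/negP => n0.
move: xy; move/eqP: H1; rewrite mulf_eq0 (negbTE n0) => /eqP ->.
by move/eqP: H2; rewrite mulf_eq0 (negbTE n0) => /eqP ->; rewrite expr0n addr0 ltxx.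
Qed.

End Diagonalization.

(** * Local constancy of the radii *)

Section LocalConstancy.
Variables (R : realType) (m : nat) (U : set 'rV[R]_m) (f : 'rV[R]_m -> Cvec R m.+1).
Hypothesis LP : legendrian_patch U f.
Hypothesis par : C_parallel_on f U.
Let oU : open U. Proof. exact: patch_open LP. Qed.
Let Sf : smoothV U f. Proof. exact: patch_smooth LP. Qed.
Implicit Types (t : 'rV[R]_m) (i j k l : 'I_m).
Variable e : Cvec R m.+1.

Local Notation S i j k t := (shape f i j k t).
Local Notation g i j t := (gram f t i j).
Local Notation Gam := (christoffel f).

(* The complex function z = <f, e> = X + i Y, and dz / z = rho + i theta. *)
Definition zre t := rdot (f t) e.
Definition zim t := rdot (f t) (Jmul e).
Definition znorm2 t := zre t ^+ 2 + zim t ^+ 2.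
Local Notation X := zre.
Local Notation Y := zim.
Local Notation r := znorm2.
Definition dlog_re i t := (X t * pd i X t + Y t * pd i Y t) / r t.
Definition dlog_im i t := (X t * pd i Y t - Y t * pd i X t) / r t.
Local Notation rho := dlog_re.
Local Notation theta := dlog_im.

Let SX : smoothF U X. Proof. exact: Sf. Qed.
Let SY : smoothF U Y. Proof. exact: Sf. Qed.
Let Sr : smoothF U r.
Proof. by apply: smoothD => //; apply: smoothM. Qed.

Let V : set 'rV[R]_m := [set t | U t /\ r t != 0].

Let VU : V `<=` U. Proof. by move=> t []. Qed.

Lemma zdomain_open : open V.
Proof.
rewrite openE => t [Ut rt]; apply: (@filterI _ (nbhs t) (nbhs_filter t)).
  exact: open_nbhs_nbhs.
exact: cvgr_neq0 (smooth_continuous Sr Ut) rt.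
Qed.
Let oV := zdomain_open.

Lemma pd_zre t i : U t -> pd i X t = rdot (pd i f t) e.
Proof. by move=> Ut; rewrite (pd_rdotl _ i Sf Ut). Qed.

Lemma pd_zim t i : U t -> pd i Y t = rdot (pd i f t) (Jmul e).
Proof. by move=> Ut; rewrite (pd_rdotl _ i Sf Ut). Qed.

Lemma smooth_dlog_re i : smoothF V (rho i).
Proof.
apply: smoothM => //; last by apply: smooth_inv => // [t []//|]; exact: smoothS VU Sr.
apply: smoothS VU _; apply: smoothD => //; apply: smoothM => //; exact: smooth_pd.
Qed.

Lemma smooth_dlog_im i : smoothF V (theta i).
Proof.
apply: smoothM => //; last by apply: smooth_inv => // [t []//|]; exact: smoothS VU Sr.
apply: smoothS VU _; apply: smoothB => //; apply: smoothM => //; exact: smooth_pd.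
Qed.

Lemma zre_dlog t i : V t -> pd i X t = X t * rho i t - Y t * theta i t.
Proof.
move=> [_ r0]; rewrite /rho /theta; move: r0; rewrite /r.
by move: (pd i X t) (pd i Y t) (X t) (Y t) => a b x y r0; field.
Qed.

Lemma zim_dlog t i : V t -> pd i Y t = Y t * rho i t + X t * theta i t.
Proof.
move=> [_ r0]; rewrite /rho /theta; move: r0; rewrite /r.
by move: (pd i X t) (pd i Y t) (X t) (Y t) => a b x y r0; field.
Qed.

Lemma sum_zre t (c : 'I_m -> R) : V t -> \sum_k c k * pd k X t =
  X t * (\sum_k c k * rho k t) - Y t * (\sum_k c k * theta k t).
Proof.
move=> Vt; rewrite !mulr_sumr -sumrB; apply: eq_bigr => k _.
by rewrite zre_dlog//; ring.
Qed.

Lemma sum_zim t (c : 'I_m -> R) : V t -> \sum_k c k * pd k Y t =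
  Y t * (\sum_k c k * rho k t) + X t * (\sum_k c k * theta k t).
Proof.
move=> Vt; rewrite !mulr_sumr -big_split; apply: eq_bigr => k _ /=.
by rewrite zim_dlog//; ring.
Qed.

Lemma dd_zre t i j : U t -> pd j (pd i X) t =
  \sum_k Gam j i k t * pd k X t - g j i t * X t - \sum_k S j i k t * pd k Y t.
Proof.
move=> Ut; rewrite (pd_ext oU j (fun s => @pd_zre s i) Ut).
rewrite (pd_rdotl e j (smoothV_pd oU i Sf) Ut) (ddfE LP j i Ut).
rewrite rdotDl rdotBl !rdot_suml rdotZl -sumrN; congr (_ - _ + _).
  by apply: eq_bigr => k _; rewrite rdotZl pd_zre.
by apply: eq_bigr => k _; rewrite rdotZl rdotJ pd_zim// mulrN.
Qed.

Lemma dd_zim t i j : U t -> pd j (pd i Y) t =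
  \sum_k Gam j i k t * pd k Y t - g j i t * Y t + \sum_k S j i k t * pd k X t.
Proof.
move=> Ut; rewrite (pd_ext oU j (fun s => @pd_zim s i) Ut).
rewrite (pd_rdotl (Jmul e) j (smoothV_pd oU i Sf) Ut) (ddfE LP j i Ut).
rewrite rdotDl rdotBl !rdot_suml rdotZl; congr (_ - _ + _).
  by apply: eq_bigr => k _; rewrite rdotZl pd_zim.
by apply: eq_bigr => k _; rewrite rdotZl rdotJJ pd_zre.
Qed.

Lemma pd_znorm2 t i : V t -> pd i r t = 2 * r t * rho i t.
Proof.
move=> Vt; have Ut := VU Vt.
have -> : pd i r t = 2 * (X t * pd i X t + Y t * pd i Y t).
  rewrite /r (pdD i (smoothM oU SX SX) (smoothM oU SY SY) Ut).
  by rewrite (pdM i SX SX Ut) (pdM i SY SY Ut); ring.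
by rewrite zre_dlog// zim_dlog// /r; ring.
Qed.

Definition eigen_defect i j t :=
  theta i t * theta j t - g i j t - \sum_k S i j k t * theta k t.
Local Notation q := eigen_defect.

(** Real part of the Riccati equation d_j w_i = Gamma_ji^k w_k - w_i w_j - g_ji + i S_ji^k w_k for w
    = rho + i theta; [pd_dlog_im] is the imaginary part. *)
Lemma pd_dlog_re t i j : V t -> pd j (rho i) t =
  \sum_k Gam j i k t * rho k t - rho i t * rho j t + q j i t.
Proof.
move=> Vt; have [Ut r0] := Vt; apply: (mulfI r0).
have E : pd j (fun s => r s * rho i s) t = pd j (fun s => X s * pd i X s + Y s * pd i Y s) t.
  apply: (pd_ext oV) => // s [_ rs]; rewrite /rho mulrCA mulfV// mulr1//.
have SXi := smooth_pd i SX; have SYi := smooth_pd i SY.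
rewrite (pdM j (smoothS VU Sr) (smooth_dlog_re i) Vt) in E.
rewrite (pdD j (smoothM oU SX SXi) (smoothM oU SY SYi) Ut) in E.
rewrite (pdM j SX SXi Ut) (pdM j SY SYi Ut) pd_znorm2// dd_zre// dd_zim// in E.
rewrite !sum_zre// !sum_zim// !zre_dlog// !zim_dlog// in E.
apply: (addrI (2 * r t * rho j t * rho i t)); rewrite E /q /r.
move: (X t) (Y t) (rho i t) (rho j t) (theta i t) (theta j t) => x y a b c d.
move: (\sum_k _) (\sum_k _) (\sum_k _) (\sum_k _) (g _ _ _) => *; ring.
Qed.

(* Linear in [dlog_re]; this is what makes the system satisfied by [dlog_re] and
   [eigen_defect] homogeneous. *)
Definition parallel_defect i j t :=
  \sum_k S i j k t * rho k t - rho i t * theta j t - theta i t * rho j t.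
Local Notation chi := parallel_defect.

Lemma pd_dlog_im t i j : V t -> pd j (theta i) t =
  \sum_k Gam j i k t * theta k t + chi j i t.
Proof.
move=> Vt; have [Ut r0] := Vt; apply: (mulfI r0).
have E : pd j (fun s => r s * theta i s) t = pd j (fun s => X s * pd i Y s - Y s * pd i X s) t.
  apply: (pd_ext oV) => // s [_ rs]; rewrite /theta mulrCA mulfV// mulr1//.
have SXi := smooth_pd i SX; have SYi := smooth_pd i SY.
rewrite (pdM j (smoothS VU Sr) (smooth_dlog_im i) Vt) in E.
rewrite (pdB j (smoothM oU SX SYi) (smoothM oU SY SXi) Ut) in E.
rewrite (pdM j SX SYi Ut) (pdM j SY SXi Ut) pd_znorm2// dd_zre// dd_zim// in E.
rewrite !sum_zre// !sum_zim// !zre_dlog// !zim_dlog// in E.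
apply: (addrI (2 * r t * rho j t * theta i t)); rewrite E /chi /r.
move: (X t) (Y t) (rho i t) (rho j t) (theta i t) (theta j t) => x y a b c d.
move: (\sum_k _) (\sum_k _) (\sum_k _) (\sum_k _) (g _ _ _) => *; ring.
Qed.

Lemma pd_gram t i j k : U t -> pd k (fun s => g i j s) t =
  \sum_p Gam k i p t * g p j t + \sum_p Gam k j p t * g i p t.
Proof.
move=> Ut; rewrite -pdE (derive_gram LP k i j Ut) [rdot (pd i f t) _]rdotC.
rewrite !(dot_ddf_df LP)//; congr (_ + _).
by apply: eq_bigr => p _; rewrite gramC.
Qed.

Lemma smooth_eigen_defect i j : smoothF V (q i j).
Proof.
apply: smoothB => //.
  apply: smoothB => //; first by apply: smoothM => //; exact: smooth_dlog_im.
  by apply: smoothS VU _; exact: (smooth_gram LP).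
apply: smooth_sum => // k; apply: smoothM => //; last exact: smooth_dlog_im.
by apply: smoothS VU _; exact: (smooth_shape LP).
Qed.

(** The metric is parallel, and so is S by [shape_parallel]. Up to Christoffel terms the derivative
    therefore falls on theta only, where it produces [parallel_defect]. *)
Lemma pd_eigen_defect t i j k : V t -> pd k (q i j) t =
  \sum_p Gam k i p t * q p j t + \sum_p Gam k j p t * q i p t
  + (chi k i t * theta j t + theta i t * chi k j t
     - \sum_l S i j l t * chi k l t).
Proof.
move=> Vt; have Ut := VU Vt.
have ST := smooth_dlog_im; have SG := smoothS VU (smooth_gram LP i j).
have SS l := smoothS VU (smooth_shape LP i j l).
have S1 l := smoothM oV (SS l) (ST l).
have S2 := smooth_sum (index_enum 'I_m) xpredT oV S1.
rewrite (pdB k (smoothB oV (smoothM oV (ST i) (ST j)) SG) S2 Vt).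
rewrite (pdB k (smoothM oV (ST i) (ST j)) SG Vt) (pdM k (ST i) (ST j) Vt).
rewrite !pd_dlog_im// pd_gram// (pd_sum oV _ k S1 Vt).
have -> : \sum_(l <- index_enum 'I_m) pd k (fun s => S i j l s * theta l s) t =
  \sum_p Gam k i p t * (\sum_l S p j l t * theta l t)
  + \sum_p Gam k j p t * (\sum_l S i p l t * theta l t)
  + \sum_l S i j l t * chi k l t.
  transitivity (\sum_l (((\sum_p Gam k i p t * S p j l t) * theta l t
     + (\sum_p Gam k j p t * S i p l t) * theta l t
     + S i j l t * chi k l t) + (S i j l t * (\sum_p Gam k l p t * theta p t)
        - (\sum_p Gam k p l t * S i j p t) * theta l t))).
    apply: eq_bigr => l _; rewrite (pdM k (SS l) (ST l) Vt) (shape_parallel LP par)//.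
    by rewrite pd_dlog_im//; ring.
  (* The Christoffel terms attached to the contracted index of S and theta cancel each other. *)
  rewrite big_split /= [X in _ + X](_ : _ = 0) ?addr0; last first.
    rewrite sumrB; apply/eqP; rewrite subr_eq0; apply/eqP.
    under eq_bigr do rewrite mulr_sumr; under [RHS]eq_bigr do rewrite mulr_suml.
    rewrite exchange_big; apply: eq_bigr => l _; apply: eq_bigr => p _; ring.
  rewrite !big_split /=; congr (_ + _ + _).
    under eq_bigr do rewrite mulr_suml; rewrite exchange_big.
    apply: eq_bigr => p _; rewrite mulr_sumr; apply: eq_bigr => l _; ring.
  under eq_bigr do rewrite mulr_suml; rewrite exchange_big.
  apply: eq_bigr => p _; rewrite mulr_sumr; apply: eq_bigr => l _; ring.
have E1 : \sum_p Gam k i p t * q p j t = (\sum_p Gam k i p t * theta p t) * theta j t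
  - \sum_p Gam k i p t * g p j t - \sum_p Gam k i p t * (\sum_l S p j l t * theta l t).
  rewrite mulr_suml -!sumrB; apply: eq_bigr => p _; rewrite /q.
  by move: (\sum_k _) => s; ring.
have E2 : \sum_p Gam k j p t * q i p t = theta i t * (\sum_p Gam k j p t * theta p t)
  - \sum_p Gam k j p t * g i p t - \sum_p Gam k j p t * (\sum_l S i p l t * theta l t).
  rewrite mulr_sumr -!sumrB; apply: eq_bigr => p _; rewrite /q.
  by move: (\sum_k _) => s; ring.
rewrite E1 E2.
move: (\sum_p _) (\sum_p _) (\sum_p _) (\sum_p _) (\sum_p _) (\sum_p _) (\sum_l _) => *.
ring.
Qed.

Variable t0 : 'rV[R]_m.
Hypotheses (Ut0 : U t0) (mu : 'I_m -> R) (r0 : 0 < r t0).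
Hypothesis Xmu : forall i, pd i X t0 = - (mu i * Y t0).
Hypothesis Ymu : forall i, pd i Y t0 = mu i * X t0.
Hypothesis Smu : forall i j, \sum_k S i j k t0 * mu k = mu i * mu j - g i j t0.

Let Vt0 : V t0. Proof. by split=> //; rewrite gt_eqF. Qed.

Lemma dlog_re_init i : rho i t0 = 0.
Proof. by rewrite /rho Xmu Ymu; rewrite (_ : _ + _ = 0) ?mul0r//; ring. Qed.

Lemma dlog_im_init i : theta i t0 = mu i.
Proof.
rewrite /theta Xmu Ymu; have := Vt0.2; rewrite /r.
by move: (X t0) (Y t0) => x y xy; field.
Qed.

Lemma eigen_defect_init i j : q i j t0 = 0.
Proof.
rewrite /q !dlog_im_init; under eq_bigr do rewrite dlog_im_init.
by rewrite Smu; ring.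
Qed.

Let defect (a : 'I_m + 'I_m * 'I_m) : 'rV[R]_m -> R :=
  match a with inl i => rho i | inr (i, j) => q i j end.
Let N t := \sum_a `|defect a t|.

Let domE a : dominated t0 N (defect a).
Proof.
exists 1 => //; apply: (@filterE _ (nbhs t0) (nbhs_filter t0)) => t.
by rewrite mul1r /N (bigD1 a)//= lerDl sumr_ge0.
Qed.

Let dom_near F G : (forall t, V t -> F t = G t) -> dominated t0 N F ->
  dominated t0 N G.
Proof.
move=> FG; apply: dominated_near.
by apply: (open_near_eq oV) Vt0 => t /[!inE]/FG.
Qed.

Let domM F G : smoothF V G -> dominated t0 N F -> dominated t0 N (fun t => G t * F t).
Proof. by move=> SG; apply: dominatedMl; exact: smooth_continuous SG Vt0. Qed.

Let SGam i j k : smoothF V (Gam i j k).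
Proof. by apply: smoothS VU _; exact: (smooth_christoffel LP). Qed.

Let SSh i j k : smoothF V (shape f i j k).
Proof. by apply: smoothS VU _; exact: (smooth_shape LP). Qed.

Let dom_rho i : dominated t0 N (rho i). Proof. exact: (domE (inl i)). Qed.
Let dom_q i j : dominated t0 N (q i j). Proof. exact: (domE (inr (i, j))). Qed.

Let domN F : dominated t0 N F -> dominated t0 N (fun t => - F t).
Proof. exact: dominatedN. Qed.

Let domC F G : dominated t0 N (fun t => G t * F t) -> dominated t0 N (fun t => F t * G t).
Proof. by apply: dom_near => t _; rewrite mulrC. Qed.

Let dom_chi i j : dominated t0 N (chi i j).
Proof.
apply: dominatedD; first apply: dominatedD.
- by apply: dominated_sum => k; exact: domM.
- by apply/domN/domC/domM => //; exact: smooth_dlog_im.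
- by apply/domN/domM => //; exact: smooth_dlog_im.
Qed.

Lemma dlog_re_near0 : \forall t \near t0, forall i, rho i t = 0.
Proof.
have H : \forall t \near t0, forall a, defect a t = 0.
  apply: uniqueness_near.
  - apply: (@filterS _ (nbhs t0) (nbhs_filter t0) V); last exact: open_nbhs_nbhs.
    move=> t Vt [i|[i j]] /=; first exact: smooth_diff (smooth_dlog_re i) Vt.
    exact: smooth_diff (smooth_eigen_defect i j) Vt.
  - move=> a k; have -> : 'D_(ebase R k) (defect a) = pd k (defect a) by rewrite pd.unlock.
    case: a => [i|[i j]] /=.
      apply: (dom_near (fun t Vt => esym (pd_dlog_re i k Vt))).
      apply: dominatedD => //; apply: dominatedD.
        by apply: dominated_sum => p; exact: domM.
      by apply/domN/domM => //; exact: smooth_dlog_re.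
    apply: (dom_near (fun t Vt => esym (pd_eigen_defect i j k Vt))).
    apply: dominatedD; first apply: dominatedD.
    + by apply: dominated_sum => p; exact: domM.
    + by apply: dominated_sum => p; exact: domM.
    apply: dominatedD; first apply: dominatedD.
    + by apply/domC/domM => //; exact: smooth_dlog_im.
    + by apply: domM => //; exact: smooth_dlog_im.
    by apply/domN/dominated_sum => p; exact: domM.
  - by case=> [i|[i j]] /=; [exact: dlog_re_init|exact: eigen_defect_init].
by apply: (@filterS _ (nbhs t0) (nbhs_filter t0) _ _ _ H) => t Ht i; exact: (Ht (inl i)).
Qed.

(** Since dr = 2 r rho vanishes near [t0], the uniqueness lemma applies to the single function r -
    r(t0). *)
Lemma znorm2_near : \forall t \near t0, r t = r t0.
Proof.
pose G (_ : unit) t := r t - r t0.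
have H : \forall t \near t0, forall a, G a t = 0.
  apply: uniqueness_near => [|a k|a]; last by rewrite /G subrr.
    apply: (@filterS _ (nbhs t0) (nbhs_filter t0) U); last exact: open_nbhs_nbhs.
    move=> t Ut a; apply: differentiableB; first exact: smooth_diff Sr Ut.
    exact: differentiable_cst.
  have -> : 'D_(ebase R k) (G a) = pd k (G a) by rewrite pd.unlock.
  apply: (@dominated_near _ _ _ _ (fun=> 0)); last exact: dominated0.
  have NV : nbhs t0 V by exact: open_nbhs_nbhs.
  apply: (@filterS2 _ (nbhs t0) (nbhs_filter t0) _ _ _ _ NV dlog_re_near0) => t Vt rt.
  rewrite /G (pdB k Sr (@smooth_cst _ _ U (r t0)) (VU Vt)) pd_cst subr0.
  by rewrite pd_znorm2// rt mulr0.
apply: (@filterS _ (nbhs t0) (nbhs_filter t0) _ _ _ H) => t Ht.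
by apply/eqP; rewrite -subr_eq0; apply/eqP; exact: (Ht tt).
Qed.

End LocalConstancy.

(** * The biharmonic equation on a torus *)

Section SphereCurvature.
Variables (R : realType) (n : nat).
Local Notation W := (Cvec R n).
Implicit Types (u v w y z a b c : W).

Lemma differentiable_rdot_test (V : normedModType R) (F : V -> W) (x : V) :
  (forall w, differentiable (fun s => rdot (F s) w) x) -> differentiable F x.
Proof.
move=> dF; have -> : F = (fun s => ((F s).1, (F s).2)).
  by apply/funext => s; rewrite -surjective_pairing.
apply: differentiable_pair; apply: differentiable_rV => k.
  by under eq_fun do rewrite re_rdot; exact: dF.
by under eq_fun do rewrite im_rdot; exact: dF.
Qed.

Lemma derive_rdot_test (V : normedModType R) (F : V -> W) (x v : V) a :
  (forall w, differentiable (fun s => rdot (F s) w) x) ->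
  (forall w, 'D_v (fun s => rdot (F s) w) x = rdot a w) -> 'D_v F x = a.
Proof.
move=> dF DF; apply: rdot_ext => w; rewrite -DF; apply: esym.
exact: (derive_linear_comp (L := rdotl w) v (@rdotl_continuous _ _ w)
  (differentiable_rdot_test dF)).2.
Qed.

Lemma differentiable_rdotl b x : differentiable (fun y : W => rdot y b) x.
Proof.
have := (derive_linear_comp (L := rdotl b) 0 (@rdotl_continuous _ _ b)
  (differentiable_id x)).1.
by [].
Qed.

Lemma is_derive_rdotl_id x v b : is_derive x v (fun y : W => rdot y b) (rdot v b).
Proof.
apply: DeriveDef; first exact: diff_derivable (differentiable_rdotl b x).
have := (derive_linear_comp (L := rdotl b) v (@rdotl_continuous _ _ b)
  (differentiable_id x)).2.
by rewrite derive_id.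
Qed.

Lemma is_derive_rdot_id x v : is_derive x v (fun y : W => rdot y y) (2 * rdot x v).
Proof.
have H := @is_derive_rdot _ _ _ id id x v v v (fun w => is_derive_rdotl_id x v w)
  (fun w => is_derive_rdotl_id x v w).
by apply: (is_derive_eq H); rewrite (rdotC v); ring.
Qed.

Lemma differentiable_rdot_id x : differentiable (fun y : W => rdot y y) x.
Proof.
under eq_fun do rewrite rdot_coord.
have -> : (fun y : W => \sum_k (rdot y (delta_mx 0 k, 0) * rdot y (delta_mx 0 k, 0) +
          rdot y (0, delta_mx 0 k) * rdot y (0, delta_mx 0 k))) =
   \sum_k (fun y : W => rdot y (delta_mx 0 k, 0) * rdot y (delta_mx 0 k, 0) +
          rdot y (0, delta_mx 0 k) * rdot y (0, delta_mx 0 k)).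
  by apply/funext => y; rewrite fct_sumE.
apply: differentiable_sum => k; apply: differentiableD; apply: differentiableM;
  exact: differentiable_rdotl.
Qed.

Lemma derive_tang c y v :
  'D_v (fun y => tang y c) y = - (rdot c v *: y + rdot c y *: v).
Proof.
have E w : (fun s => rdot (tang s c) w) = (fun s => rdot c w - rdot s c * rdot s w).
  by apply/funext => s; rewrite /tang rdotBl rdotZl (rdotC c s).
apply: derive_rdot_test => w; rewrite E.
  apply: differentiableB; first exact: differentiable_cst.
  apply: (@differentiableM _ _ (fun s => rdot s c)); exact: differentiable_rdotl.
have [_ ->] := is_deriveB (is_derive_cst (rdot c w) y v)
  (is_derive_mulr (is_derive_rdotl_id y v c) (is_derive_rdotl_id y v w)).
by rewrite rdotNl rdotDl !rdotZl (rdotC v c) (rdotC y c) sub0r.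
Qed.

(** The formula is needed at every y of the flat space, because [sphere_curv] differentiates it once
    more with flat derivatives. On the sphere the term with 1 - <y, y> vanishes. *)
Lemma sphere_nabla_tang b c : sphere_nabla (fun y => tang y b) (fun y => tang y c) = fun y =>
  ((2 * rdot y b * rdot y c - rdot c b) * (1 - rdot y y) + rdot y b * rdot y c) *: y
  - rdot y c *: b.
Proof.
apply/funext => y; rewrite /sphere_nabla derive_tang; apply: rdot_ext => w.
rewrite /tang !(rdotBl, rdotBr, rdotNl, rdotDl, rdotZl, rdotZr).
rewrite (rdotC c y) (rdotC b y); ring.
Qed.

Lemma derive_sphere_nabla z a b c : rdot z z = 1 ->
  rdot z a = 0 -> rdot z b = 0 -> rdot z c = 0 ->
  'D_a (sphere_nabla (fun y => tang y b) (fun y => tang y c)) z = - (rdot c a *: b).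
Proof.
move=> zz za zb zc; rewrite sphere_nabla_tang.
pose F w y := ((2 * rdot y b * rdot y c - rdot c b) * (1 - rdot y y) +
   rdot y b * rdot y c) * rdot y w - rdot y c * rdot b w.
have E w : (fun y => rdot (((2 * rdot y b * rdot y c - rdot c b) * (1 - rdot y y) +
   rdot y b * rdot y c) *: y - rdot y c *: b) w) = F w.
  by apply/funext => y; rewrite rdotBl !rdotZl.
have dl := differentiable_rdotl.
apply: derive_rdot_test => w; rewrite E /F.
  have dbc := differentiableM (dl b z) (dl c z).
  have d1 := differentiableM (differentiable_cst (2 : R) z) (dl b z).
  have d2 := differentiableB (differentiableM d1 (dl c z)) (differentiable_cst (rdot c b) z).
  have d3 := differentiableB (differentiable_cst (1 : R) z) (differentiable_rdot_id z).
  have d4 := differentiableM (differentiableD (differentiableM d2 d3) dbc) (dl w z).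
  exact: (differentiableB d4 (differentiableM (dl c z) (differentiable_cst (rdot b w) z))).
have Dl := is_derive_rdotl_id z a.
have D1 := is_derive_mulr (is_derive_mulr (is_derive_cst (2 : R) z a) (Dl b)) (Dl c).
have D2 := is_deriveB D1 (is_derive_cst (rdot c b) z a).
have D3 := is_deriveB (is_derive_cst (1 : R) z a) (is_derive_rdot_id z a).
have D4 := is_deriveD (is_derive_mulr D2 D3) (is_derive_mulr (Dl b) (Dl c)).
have D5 := is_deriveB (is_derive_mulr D4 (Dl w)) (is_derive_mulr (Dl c) (is_derive_cst (rdot b w) z a)).
have [_ ->] := D5.
rewrite /= rdotNl rdotZl (rdotC a c) /cst /= !fctE za zb zc zz; ring.
Qed.

Lemma tang_id z v : rdot z v = 0 -> tang z v = v.
Proof. by rewrite /tang rdotC => ->; rewrite scale0r subr0. Qed.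

Lemma sphere_nabla2 z a b c : rdot z z = 1 ->
  rdot z a = 0 -> rdot z b = 0 -> rdot z c = 0 ->
  sphere_nabla (fun y => tang y a) (sphere_nabla (fun y => tang y b) (fun y => tang y c)) z
  = - (rdot c a *: b).
Proof.
move=> zz za zb zc; have D := derive_sphere_nabla zz za zb zc.
transitivity (tang z ('D_(tang z a) (sphere_nabla (fun y => tang y b) (fun y => tang y c)) z)).
  by [].
by rewrite (tang_id za) D tang_id// rdotNr rdotZr zb mulr0 oppr0.
Qed.

Lemma sphere_nabla_bracket z a b c : rdot z a = 0 -> rdot z b = 0 ->
  sphere_nabla (sphere_bracket (fun y => tang y a) (fun y => tang y b))
    (fun y => tang y c) z = 0.
Proof.
move=> za zb; rewrite {1}/sphere_nabla /sphere_bracket !derive_tang.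
rewrite !(tang_id za) !(tang_id zb).
rewrite (rdotC b z) (rdotC a z) zb za !scale0r !addr0 (rdotC b a) subrr.
by rewrite rdot0r scale0r scaler0 addr0 oppr0 /tang rdot0l scale0r subr0.
Qed.

Lemma sphere_curvE z a b c : rdot z z = 1 ->
  rdot z a = 0 -> rdot z b = 0 -> rdot z c = 0 ->
  sphere_curv z a b c = rdot c b *: a - rdot c a *: b.
Proof.
move=> zz za zb zc; rewrite /sphere_curv (sphere_nabla_bracket c za zb) subr0.
have -> := sphere_nabla2 zz za zb zc; have -> := sphere_nabla2 zz zb za zc.
by rewrite opprK addrC.
Qed.

End SphereCurvature.

(** * Operators diagonal in a unitary basis *)

Section UnitaryBasis.
Local Open Scope sesquilinear_scope.
Variables (R : realType) (n : nat) (E : 'I_n -> Cvec R n).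
Hypothesis uE : forall a b, hdot (toC (E a)) (toC (E b)) = (a == b)%:R.
Implicit Types (v w : Cvec R n).

Lemma parseval v w : rdot v w =
  \sum_a (rdot v (E a) * rdot w (E a) + rdot v (Jmul (E a)) * rdot w (Jmul (E a))).
Proof.
pose P : 'M[R[i]]_n := \matrix_a toC (E a).
have PP : P *m P^t* = 1%:M.
  apply/matrixP => a b; rewrite [RHS]mxE -uE mxE.
  by apply: eq_bigr => k _; rewrite !mxE.
have PP' : P^t* *m P = 1%:M by exact: mulmx1C.
have H : toC v *m (toC w)^t* = (toC v *m P^t*) *m (toC w *m P^t*)^t*.
  rewrite trmx_mul map_mxM trmxCK -!mulmxA; congr (_ *m _).
  by rewrite mulmxA PP' mul1mx.
have Ev u a : (toC u *m P^t*) 0 a = hdot (toC u) (toC (E a)).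
  by rewrite mxE; apply: eq_bigr => k _; rewrite !mxE.
have /matrixP/(_ 0 0)/(congr1 (@complex.Re R)) := H.
have -> : (toC v *m (toC w)^t*) 0 0 = hdot (toC v) (toC w).
  by rewrite mxE; apply: eq_bigr => k _; rewrite !mxE.
rewrite hdot_toC /= => ->; rewrite mxE.
elim: (index_enum _) => [|a r IH]; first by rewrite !big_nil.
rewrite !big_cons raddfD /= IH; congr (_ + _).
rewrite Ev mxE mxE Ev !hdot_toC /=; ring.
Qed.

Lemma unitary_dot a b : rdot (E a) (E b) = (a == b)%:R.
Proof.
have := uE a b; rewrite hdot_toC => /(congr1 (@complex.Re R)) /= ->.
by case: (a == b).
Qed.

Lemma unitary_norm a : rdot (E a) (E a) = 1.
Proof. by rewrite unitary_dot eqxx. Qed.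

Lemma unitary_neq a b : b != a -> rdot (E a) (E b) = 0.
Proof. by rewrite unitary_dot eq_sym => /negbTE ->. Qed.

Lemma unitary_dotJ a b : rdot (E a) (Jmul (E b)) = 0.
Proof.
have := uE a b; rewrite hdot_toC => /(congr1 (@complex.Im R)) /= ->.
by case: (a == b).
Qed.

Lemma unitary_ext v w : (forall a, rdot v (E a) = rdot w (E a)) ->
  (forall a, rdot v (Jmul (E a)) = rdot w (Jmul (E a))) -> v = w.
Proof.
move=> H1 H2; apply: rdot_ext => u; rewrite !(parseval _ u).
by apply: eq_bigr => a _; rewrite H1 H2.
Qed.

Variable s : 'I_n -> R.

(** Real form of the Hermitian operator with eigenvalue [s a] on [E a]. *)
Definition diag_op v : Cvec R n :=
  \sum_a (s a * rdot v (E a)) *: E a + \sum_a (s a * rdot v (Jmul (E a))) *: Jmul (E a).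

Lemma dot_diag_op v w : rdot (diag_op v) w = \sum_a s a *
  (rdot v (E a) * rdot w (E a) + rdot v (Jmul (E a)) * rdot w (Jmul (E a))).
Proof.
rewrite rdotDl !rdot_suml -big_split; apply: eq_bigr => a _ /=.
by rewrite !rdotZl !(rdotC _ w); ring.
Qed.

Lemma diag_opC v w : rdot (diag_op v) w = rdot v (diag_op w).
Proof.
rewrite (rdotC v) !dot_diag_op; apply: eq_bigr => a _; ring.
Qed.

Lemma dot_diag_op_basis v a : rdot (diag_op v) (E a) = s a * rdot v (E a).
Proof.
rewrite dot_diag_op (bigD1 a)//= unitary_norm unitary_dotJ big1 => [|b ba].
  by ring.
by rewrite (unitary_neq ba) unitary_dotJ; ring.
Qed.

Lemma dot_diag_op_Jbasis v a : rdot (diag_op v) (Jmul (E a)) = s a * rdot v (Jmul (E a)).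
Proof.
rewrite dot_diag_op (bigD1 a)//= rdotJJ rdotJ unitary_dotJ unitary_norm.
rewrite big1 => [|b ba]; first by ring.
by rewrite rdotJJ rdotJ unitary_dotJ (unitary_neq ba); ring.
Qed.

Lemma diag_opD v w : diag_op (v + w) = diag_op v + diag_op w.
Proof. by apply: rdot_ext => u; rewrite rdotDl !diag_opC rdotDl. Qed.

Lemma diag_opZ c v : diag_op (c *: v) = c *: diag_op v.
Proof. by apply: rdot_ext => u; rewrite rdotZl !diag_opC rdotZl. Qed.

Lemma diag_opN v : diag_op (- v) = - diag_op v.
Proof. by rewrite -scaleN1r diag_opZ scaleN1r. Qed.

Lemma diag_op_sum I (r : seq I) (F : I -> Cvec R n) :
  diag_op (\sum_(i <- r) F i) = \sum_(i <- r) diag_op (F i).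
Proof.
apply: rdot_ext => u; rewrite diag_opC !rdot_suml.
by apply: eq_bigr => i _; rewrite diag_opC.
Qed.

Lemma smoothV_diag_op m (U : set 'rV[R]_m) (F : 'rV[R]_m -> Cvec R n) :
  open U -> smoothV U F -> smoothV U (fun t => diag_op (F t)).
Proof.
by move=> oU SF w; apply: smooth_ext (SF (diag_op w)) => // t _; rewrite diag_opC.
Qed.

Lemma pd_diag_op m (U : set 'rV[R]_m) (F : 'rV[R]_m -> Cvec R n) t i :
  open U -> smoothV U F -> U t ->
  pd i (fun t => diag_op (F t)) t = diag_op (pd i F t).
Proof.
move=> oU SF Ut; apply: rdot_ext => w.
rewrite -(pd_rdotl w i (smoothV_diag_op oU SF) Ut) diag_opC -(pd_rdotl _ i SF Ut).
by apply: (pd_ext oU) => // u _; rewrite diag_opC.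
Qed.

End UnitaryBasis.

(** * Tension and bitension in the eigenbasis *)

Section Representation.
Local Open Scope sesquilinear_scope.
Variables (R : realType) (m : nat) (U : set 'rV[R]_m) (f : 'rV[R]_m -> Cvec R m.+1).
Hypothesis LP : legendrian_patch U f.
Let oU : open U. Proof. exact: patch_open LP. Qed.
Let Sf : smoothV U f. Proof. exact: patch_smooth LP. Qed.
Implicit Types (t : 'rV[R]_m) (i j k l : 'I_m).
Variables (E : 'I_m.+1 -> Cvec R m.+1) (p : 'I_m.+1 -> R).
Hypothesis uE : forall a b, hdot (toC (E a)) (toC (E b)) = (a == b)%:R.
Hypothesis p_gt0 : forall a, 0 < p a.
Hypothesis Ep : forall t, U t -> forall a, znorm2 f (E a) t = p a.

Local Notation g i j t := (gram f t i j).
Local Notation Gam := (christoffel f).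
Local Notation dd i j t := (pd i (pd j f) t).
Local Notation X a := (zre f (E a)).
Local Notation Y a := (zim f (E a)).
Local Notation theta a i := (dlog_im f (E a) i).

Let VE a t : U t -> U t /\ znorm2 f (E a) t != 0.
Proof. by move=> Ut; rewrite Ep// gt_eqF. Qed.

Lemma rep_rho t a i : U t -> dlog_re f (E a) i t = 0.
Proof.
move=> Ut; have := pd_znorm2 LP i (VE a Ut).
rewrite (pd_const i oU (fun s Us => Ep Us a) Ut) => /esym/eqP.
by rewrite mulf_eq0 Ep// mulf_eq0 pnatr_eq0 (gt_eqF (p_gt0 a)) /= => /eqP.
Qed.

Lemma rep_dX t a i : U t -> pd i (X a) t = - (Y a t * theta a i t).
Proof.
by move=> Ut; rewrite (zre_dlog i (VE a Ut)) rep_rho// mulr0 sub0r.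
Qed.

Lemma rep_dY t a i : U t -> pd i (Y a) t = X a t * theta a i t.
Proof.
by move=> Ut; rewrite (zim_dlog i (VE a Ut)) rep_rho// mulr0 add0r.
Qed.

Lemma rep_dotdf t a i : U t -> rdot (pd i f t) (E a) = - (Y a t * theta a i t).
Proof. by move=> Ut; rewrite -(pd_zre LP (E a) i Ut) rep_dX. Qed.

Lemma rep_dotJdf t a i : U t -> rdot (pd i f t) (Jmul (E a)) = X a t * theta a i t.
Proof. by move=> Ut; rewrite -(pd_zim LP (E a) i Ut) rep_dY. Qed.

(** Once rho is identically 0, [pd_dlog_re] reduces to the vanishing of the defect, so the
    eigenvalue relation holds on all of U. *)
Lemma rep_shape t a i j : U t ->
  \sum_k shape f i j k t * theta a k t = theta a i t * theta a j t - g i j t.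
Proof.
move=> Ut; have := pd_dlog_re LP j i (VE a Ut).
rewrite (pd_const i oU (fun s Us => rep_rho a j Us) Ut).
rewrite big1 => [|k _]; last by rewrite rep_rho// mulr0.
rewrite rep_rho// mul0r subrr add0r /eigen_defect => /esym/eqP.
by rewrite subr_eq0 => /eqP <-.
Qed.

Lemma rep_XY t a : U t -> X a t ^+ 2 + Y a t ^+ 2 = p a.
Proof. by move=> Ut; rewrite -(Ep Ut a). Qed.

(* The Hessian of f as a map into the flat C^(m+1), not into the sphere. *)
Definition flat_hess i j t := dd i j t - \sum_k Gam i j k t *: pd k f t.

Lemma flat_hess_re t a i j : U t ->
  rdot (flat_hess i j t) (E a) = - (theta a i t * theta a j t * X a t).
Proof.
move=> Ut; rewrite rdotBl rdot_suml.
rewrite -(pd_rdotl (E a) i (smoothV_pd oU j Sf) Ut).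
rewrite -(pd_ext oU i (fun s => @pd_zre _ _ _ _ LP (E a) s j) Ut) (dd_zre LP (E a) j i Ut).
have -> : \sum_k rdot (Gam i j k t *: pd k f t) (E a) = \sum_k Gam i j k t * pd k (X a) t.
  by apply: eq_bigr => k _; rewrite rdotZl (pd_zre LP).
have -> : \sum_k shape f i j k t * pd k (Y a) t =
   X a t * (\sum_k shape f i j k t * theta a k t).
  by rewrite mulr_sumr; apply: eq_bigr => k _; rewrite rep_dY//; ring.
by rewrite rep_shape//; move: (\sum_k _) => s; ring.
Qed.

Lemma flat_hess_im t a i j : U t ->
  rdot (flat_hess i j t) (Jmul (E a)) = - (theta a i t * theta a j t * Y a t).
Proof.
move=> Ut; rewrite rdotBl rdot_suml.
rewrite -(pd_rdotl (Jmul (E a)) i (smoothV_pd oU j Sf) Ut).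
rewrite -(pd_ext oU i (fun s => @pd_zim _ _ _ _ LP (E a) s j) Ut) (dd_zim LP (E a) j i Ut).
have -> : \sum_k rdot (Gam i j k t *: pd k f t) (Jmul (E a)) = \sum_k Gam i j k t * pd k (Y a) t.
  by apply: eq_bigr => k _; rewrite rdotZl (pd_zim LP).
have -> : \sum_k shape f i j k t * pd k (X a) t =
   - (Y a t * (\sum_k shape f i j k t * theta a k t)).
  by rewrite mulr_sumr -sumrN; apply: eq_bigr => k _; rewrite rep_dX//; ring.
by rewrite rep_shape//; move: (\sum_k _) => s; ring.
Qed.

Lemma rep_sum_p t : U t -> \sum_a p a = 1.
Proof.
move=> Ut; rewrite -(dot_ff LP Ut) (parseval uE); apply: eq_bigr => a _.
by rewrite -(rep_XY a Ut).
Qed.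

Lemma rep_sum_ptheta t i : U t -> \sum_a p a * theta a i t = 0.
Proof.
move=> Ut; rewrite -[RHS](dot_df_Jf LP i Ut) (parseval uE); apply: eq_bigr => a _.
rewrite rep_dotdf// rep_dotJdf// rdotJ rdotJJ -/(X a t) -/(Y a t) -(rep_XY a Ut).
by ring.
Qed.

Lemma rep_gram t i j : U t -> g i j t = \sum_a p a * (theta a i t * theta a j t).
Proof.
move=> Ut; rewrite gramE (parseval uE); apply: eq_bigr => a _.
by rewrite !rep_dotdf// !rep_dotJdf// -(rep_XY a Ut); ring.
Qed.

(* The orthogonality relations summed over a say that Q P = 1 for the square
   matrices P and Q of the proof; the statement is P Q = 1. *)
Lemma rep_dual t a b : U t ->
  p b * (1 + \sum_i \sum_j ginv f t i j * (theta a i t * theta b j t)) = (a == b)%:R.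
Proof.
move=> Ut.
pose P : 'M[R]_m.+1 := \matrix_(a, c)
  if unlift ord0 c is Some i then theta a i t else 1.
pose Q : 'M[R]_m.+1 := \matrix_(c, b)
  if unlift ord0 c is Some i then \sum_j ginv f t i j * (theta b j t * p b) else p b.
have P0 c : P c ord0 = 1 by rewrite mxE unlift_none.
have PS c i : P c (lift ord0 i) = theta c i t by rewrite mxE liftK.
have Q0 c : Q ord0 c = p c by rewrite mxE unlift_none.
have QS c i : Q (lift ord0 i) c = \sum_j ginv f t i j * (theta c j t * p c).
  by rewrite mxE liftK.
have QP : Q *m P = 1%:M.
  apply/matrixP => c d; rewrite [LHS]mxE [RHS]mxE.
  case: (unliftP ord0 c) => [i|] ->; case: (unliftP ord0 d) => [k|] ->.
  - rewrite (inj_eq lift_inj).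
    transitivity (\sum_j ginv f t i j * g j k t).
      under eq_bigr do rewrite PS QS mulr_suml.
      rewrite exchange_big; apply: eq_bigr => j _ /=.
      by rewrite rep_gram// mulr_sumr; apply: eq_bigr => x _; ring.
    have /matrixP/(_ i k) := mulVmx (gram_unit LP Ut); rewrite [RHS]mxE => <-.
    by rewrite [RHS]mxE.
  - under eq_bigr do rewrite P0 mulr1 QS.
    rewrite exchange_big big1//= => j _; rewrite -mulr_sumr.
    by under eq_bigr do rewrite mulrC; rewrite rep_sum_ptheta// mulr0.
  - by under eq_bigr do rewrite PS Q0; rewrite rep_sum_ptheta.
  - by under eq_bigr do rewrite P0 Q0 mulr1; rewrite (rep_sum_p Ut) eqxx.
have /matrixP/(_ a b) := mulmx1C QP; rewrite [RHS]mxE => <-.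
rewrite mxE big_ord_recl P0 Q0 mul1r mulrDr mulr1; congr (_ + _).
rewrite mulr_sumr; apply: eq_bigr => i _; rewrite PS QS !mulr_sumr.
by apply: eq_bigr => j _; ring.
Qed.

Lemma rep_trace_theta t a : U t ->
  \sum_i \sum_j ginv f t i j * (theta a i t * theta a j t) = (p a)^-1 - 1.
Proof.
move=> Ut; have := rep_dual a a Ut; rewrite eqxx.
have : p a != 0 by rewrite gt_eqF.
move: (\sum_i _) (p a) => x y y0 H; have {}H : y * (1 + x) = 1 := H.
apply: (mulfI y0); rewrite mulrBr mulfV// mulr1.
by rewrite -H; ring.
Qed.

Lemma trace_gram t : U t -> \sum_i \sum_j ginv f t i j * g i j t = m%:R.
Proof.
move=> Ut; transitivity (\sum_(i < m) (1 : R)); last first.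
  by rewrite sumr_const card_ord.
apply: eq_bigr => i _.
have H : (ginv f t *m gram f t) i i = 1.
  by rewrite mulVmx ?(gram_unit LP)// mxE eqxx.
by rewrite -[RHS]H mxE; apply: eq_bigr => j _; rewrite gramC.
Qed.

(** The trace of [flat_hess] contributes - (1 / p_a - 1) to the component along E_a, and the
    tangential projection adds m. *)
Definition spec a := m.+1%:R - (p a)^-1.
Local Notation L := (diag_op E spec).

Lemma dot_trace_g (Q : ('rV[R]_m -> 'rV[R]_m) -> ('rV[R]_m -> 'rV[R]_m) ->
    'rV[R]_m -> Cvec R m.+1) t w :
  rdot (trace_g f Q t) w = \sum_i \sum_j ginv f t i j *
    rdot (Q (cst (ebase R i)) (cst (ebase R j)) t) w.
Proof.
rewrite rdot_suml; apply: eq_bigr => i _; rewrite rdot_suml.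
by apply: eq_bigr => j _; rewrite rdotZl.
Qed.

Lemma hess_map_cst t i j : U t ->
  hess_map f (cst (ebase R i)) (cst (ebase R j)) t = flat_hess i j t + g i j t *: f t.
Proof.
move=> Ut; rewrite /hess_map /nabla_pull push_cstF pdE /tang (dot_ddf_f LP)//.
rewrite nabla_cst /push (derive_pdV _ Sf Ut) /flat_hess scaleNr opprK addrAC.
by congr (_ - _ + _); apply: eq_bigr => k _; rewrite mxE.
Qed.

Lemma dot_trace_hess t (c d : R) (h : 'I_m -> 'I_m -> R) (a : 'I_m.+1) : U t ->
  (forall i j, h i j = - (theta a i t * theta a j t * c) + g i j t * d) ->
  \sum_i \sum_j ginv f t i j * h i j = - (((p a)^-1 - 1) * c) + m%:R * d.
Proof.
move=> Ut hE; rewrite -(rep_trace_theta a Ut) -(trace_gram Ut) !mulr_suml -sumrN -big_split.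
apply: eq_bigr => i _ /=; rewrite !mulr_suml -sumrN -big_split.
by apply: eq_bigr => j _ /=; rewrite hE; ring.
Qed.

Lemma tensionE t : U t -> tension f t = L (f t).
Proof.
move=> Ut; apply: (unitary_ext uE) => a.
  rewrite (dot_diag_op_basis uE) dot_trace_g.
  rewrite (dot_trace_hess (c := X a t) (d := X a t) (a := a))// => [|i j].
    by rewrite -/(X a t) /spec -natr1; ring.
  by rewrite hess_map_cst// rdotDl rdotZl flat_hess_re.
rewrite (dot_diag_op_Jbasis uE) dot_trace_g.
rewrite (dot_trace_hess (c := Y a t) (d := Y a t) (a := a))// => [|i j].
  by rewrite -/(Y a t) /spec -natr1; ring.
by rewrite hess_map_cst// rdotDl rdotZl flat_hess_im.
Qed.

Lemma dot_Ldf_f t i : U t -> rdot (L (pd i f t)) (f t) = 0.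
Proof.
move=> Ut; rewrite dot_diag_op big1// => a _.
by rewrite rep_dotdf// rep_dotJdf// -/(X a t) -/(Y a t); ring.
Qed.

Lemma dot_L_f t : U t -> rdot (L (f t)) (f t) = 0.
Proof.
move=> Ut; transitivity (\sum_a (m.+1%:R * p a - 1)).
  rewrite dot_diag_op; apply: eq_bigr => a _; rewrite /spec -!expr2 (rep_XY a Ut).
  by field; rewrite gt_eqF.
by rewrite sumrB -mulr_sumr (rep_sum_p Ut) sumr_const card_ord mulr1 subrr.
Qed.

Definition spec_norm := \sum_a p a * spec a ^+ 2.

Lemma dot_L_L t : U t -> rdot (L (f t)) (L (f t)) = spec_norm.
Proof.
move=> Ut; rewrite dot_diag_op; apply: eq_bigr => a _.
rewrite (dot_diag_op_basis uE) (dot_diag_op_Jbasis uE) -/(X a t) -/(Y a t).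
by rewrite -(rep_XY a Ut); ring.
Qed.

Lemma dot_tension t : U t -> rdot (tension f t) (tension f t) = spec_norm.
Proof. by move=> Ut; rewrite tensionE// dot_L_L. Qed.

(** The tension field is L f, and its derivative L(df) is already tangent to the sphere by
    [dot_Ldf_f]. Only the second differentiation leaves a component along f to be removed. *)
Lemma hess_pull_tension t i j : U t ->
  hess_pull f (tension f) (cst (ebase R i)) (cst (ebase R j)) t =
  L (flat_hess i j t) - rdot (L (flat_hess i j t)) (f t) *: f t.
Proof.
move=> Ut.
have SL : smoothV U (fun t => L (f t)) by exact: smoothV_diag_op.
have ST : smoothV U (tension f) by apply: smoothV_ext SL => // s Us; rewrite tensionE.
have DT k s : U s -> pd k (tension f) s = L (pd k f s).
  by move=> Us; rewrite (pd_ext oU k tensionE Us) (pd_diag_op E spec k oU Sf Us).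
have E1 s : U s -> nabla_pull f (cst (ebase R j)) (tension f) s = L (pd j f s).
  by move=> Us; rewrite /nabla_pull pdE DT// /tang dot_Ldf_f// scale0r subr0.
have E2 : 'D_(cst (ebase R i) t) (nabla_pull f (cst (ebase R j)) (tension f)) t = L (dd i j t).
  by rewrite pdE (pd_ext oU i E1 Ut) (pd_diag_op E spec i oU (smoothV_pd oU j Sf) Ut).
have E3 : 'D_(nabla f (cst (ebase R i)) (cst (ebase R j)) t) (tension f) t =
    L (\sum_k Gam i j k t *: pd k f t).
  rewrite nabla_cst (derive_pdV _ ST Ut) diag_op_sum; apply: eq_bigr => k _.
  by rewrite mxE diag_opZ DT.
have E4 : rdot (L (\sum_k Gam i j k t *: pd k f t)) (f t) = 0.
  rewrite diag_op_sum rdot_suml big1// => k _.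
  by rewrite diag_opZ rdotZl dot_Ldf_f// mulr0.
rewrite /hess_pull {1 3}/nabla_pull E2 E3 /tang E4 scale0r subr0.
by rewrite /flat_hess diag_opD diag_opN rdotBl E4 subr0 addrAC.
Qed.

(** The vector w stands for E_a or J E_a. With s = [spec a], the second derivatives give - (1 / p_a
    - 1) s, the projection gives - [spec_norm], and the curvature of the sphere gives m s; the terms
    in s add up to s^2. *)
Lemma bitension_dot t (w : Cvec R m.+1) a : U t ->
  (forall i j, rdot (flat_hess i j t) w = - (theta a i t * theta a j t * rdot (f t) w)) ->
  (forall v, rdot (L v) w = spec a * rdot v w) ->
  rdot (bitension f t) w = (spec a ^+ 2 - spec_norm) * rdot (f t) w.
Proof.
move=> Ut Hw Lw.
(* L is self-adjoint, the trace of [flat_hess] is the tension minus m f, and <f, L f> = 0. *)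
have TRf : \sum_i \sum_j ginv f t i j * rdot (L (flat_hess i j t)) (f t) = spec_norm.
  transitivity (rdot (tension f t - m%:R *: f t) (L (f t))).
    rewrite rdotBl dot_trace_g rdotZl -(trace_gram Ut) mulr_suml -sumrB.
    apply: eq_bigr => i _; rewrite mulr_suml -sumrB; apply: eq_bigr => j _.
    by rewrite hess_map_cst// (rdotDl (flat_hess i j t)) rdotZl diag_opC; ring.
  by rewrite rdotBl rdotZl tensionE// dot_L_L// rdotC dot_L_f// mulr0 subr0.
have E1 : rdot (trace_g f (hess_pull f (tension f)) t) w =
    spec a * (- (((p a)^-1 - 1) * rdot (f t) w)) - spec_norm * rdot (f t) w.
  apply: etrans (dot_trace_g _ _ _) _.
  transitivity (\sum_i \sum_j ginv f t i j * rdot (L (flat_hess i j t)) w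
     - \sum_i \sum_j ginv f t i j * rdot (L (flat_hess i j t)) (f t) * rdot (f t) w).
    rewrite -sumrB; apply: eq_bigr => i _; rewrite -sumrB; apply: eq_bigr => j _.
    by rewrite hess_pull_tension// rdotBl rdotZl; ring.
  congr (_ - _).
    rewrite (dot_trace_hess (c := spec a * rdot (f t) w) (d := 0) (a := a))// => [|i j].
      by ring.
    by rewrite Lw Hw; ring.
  by rewrite -TRf mulr_suml; apply: eq_bigr => i _; rewrite mulr_suml.
have E2 : rdot (trace_g f (fun X Y s => sphere_curv (f s) (push f X s) (tension f s)
    (push f Y s)) t) w = - (m%:R * (spec a * rdot (f t) w)).
  apply: etrans (dot_trace_g _ _ _) _.
  rewrite -(trace_gram Ut) mulr_suml -sumrN; apply: eq_bigr => i _.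
  rewrite mulr_suml -sumrN; apply: eq_bigr => j _.
  have f0 k : rdot (f t) (pd k f t) = 0 by rewrite rdotC (dot_df_f LP).
  rewrite !push_cst tensionE// sphere_curvE ?(dot_ff LP)//; last by rewrite rdotC dot_L_f.
  rewrite -diag_opC dot_Ldf_f// scale0r sub0r rdotNl rdotZl Lw -gramE gramC.
  by ring.
have D (v1 v2 : Cvec R m.+1) c1 c2 : rdot v1 w = c1 -> rdot v2 w = c2 ->
    rdot (v1 - v2) w = c1 - c2 by move=> <- <-; rewrite rdotBl.
rewrite /bitension /laplacian opprK; apply: etrans (D _ _ _ _ E1 E2) _.
rewrite /spec -natr1; move: (rdot (f t) w) (p a)^-1 spec_norm => z q N; ring.
Qed.

Lemma biharmonic_spec t a : U t -> biharmonic_on f U (- 4) ->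
  spec a ^+ 2 + 4 * spec a = spec_norm.
Proof.
move=> Ut bih; have B := bih t Ut.
have H w : (forall i j, rdot (flat_hess i j t) w = - (theta a i t * theta a j t * rdot (f t) w)) ->
   (forall v, rdot (L v) w = spec a * rdot v w) ->
   (spec a ^+ 2 + 4 * spec a - spec_norm) * rdot (f t) w = 0.
  move=> Hw Lw; have := congr1 (fun v => rdot v w) B.
  rewrite rdot0l rdotBl rdotZl (bitension_dot Ut Hw Lw) tensionE// Lw => <-.
  by ring.
have HX := H (E a) (fun i j => flat_hess_re a i j Ut) (fun v => dot_diag_op_basis uE spec v a).
have HY := H (Jmul (E a)) (fun i j => flat_hess_im a i j Ut)
  (fun v => dot_diag_op_Jbasis uE spec v a).
apply/eqP; rewrite -subr_eq0; apply/negPn/negP => n0.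
move: HX HY => /eqP; rewrite mulf_eq0 (negbTE n0) /= => /eqP X0 /eqP.
rewrite mulf_eq0 (negbTE n0) /= => /eqP Y0.
have := p_gt0 a; rewrite -(rep_XY a Ut) /zre /zim X0 Y0.
by rewrite expr0n addr0 ltxx.
Qed.

End Representation.

(** * The three tori *)

Section Classification.
Variable R : realType.

(** The numbers 4 - 1 / p_a are roots of s^2 + 4 s = T. Two distinct roots have sum - 4, hence 1 / P
    + 1 / Q = 12, and product - T, hence T = 32 - 1 / (P Q). *)
Lemma two_values (p : 'I_4 -> R) (T : R) :
  (forall a, 0 < p a) -> \sum_a p a = 1 ->
  (forall a, (4 - (p a)^-1) ^+ 2 + 4 * (4 - (p a)^-1) = T) -> T != 0 ->
  exists (P Q : R) (k : nat) (sigma : 'I_4 -> 'I_4),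
  [/\ injective sigma, forall a, p (sigma a) = if (a < k)%N then P else Q,
      0 < P < Q, (0 < k < 4)%N &
      P^-1 + Q^-1 = 12 /\ T = 32 - P^-1 * Q^-1].
Proof.
move=> p0 sp pT T0.
pose a0 := [arg min_(a < ord0) p a]%O.
have a0min a : p a0 <= p a.
  by rewrite /a0; case: Order.TotalTheory.arg_minP => // i _ /(_ a isT).
have quad a b : p a != p b -> (p a)^-1 + (p b)^-1 = 12.
  move=> ab; have d0 : (p a)^-1 - (p b)^-1 != 0.
    by rewrite subr_eq0; apply: contra ab => /eqP/invr_inj ->.
  apply: (mulfI d0); have := pT a; rewrite -(pT b).
  by move: (p a)^-1 (p b)^-1 => x y; lra.
have [a1 a1a0] : exists a1, p a1 != p a0.
  apply/existsP; rewrite -negb_forall; apply/negP => /forallP eqp.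
  have pE a : p a = 4^-1.
    have : \sum_a p a = 4 * p a0.
      rewrite (eq_bigr (fun=> p a0)) => [|b _]; last exact/eqP/eqp.
      by rewrite sumr_const card_ord mulr_natl.
    rewrite sp (eqP (eqp a)) => H; apply: (@mulfI _ 4); first by rewrite pnatr_eq0.
    by rewrite -H mulfV// pnatr_eq0.
  by move/eqP: T0; apply; rewrite -(pT ord0) pE invrK subrr expr0n mulr0 addr0.
pose B : {set 'I_4} := [set a | p a == p a0]%SET.
have pB a : a \in B -> p a = p a0 by rewrite inE => /eqP.
have pNB a : a \notin B -> p a = p a1.
  rewrite inE => aB; have := quad _ _ aB; rewrite -(quad _ _ a1a0) => /addIr.
  exact: invr_inj.
(* The permutation lists the indices of the smaller weight first. *)
pose s := enum B ++ enum (~: B)%SET.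
have us : uniq s.
  rewrite cat_uniq !enum_uniq /= andbT; apply/hasPn => a.
  by rewrite !mem_enum inE.
have ss : size s = 4%N by rewrite size_cat -!cardE cardsC card_ord.
exists (p a0), (p a1), #|B|, (fun a => nth ord0 s a); split.
- by move=> a b /eqP; rewrite nth_uniq ?ss// => /eqP/val_inj.
- move=> a; rewrite nth_cat -cardE; case: ltnP => aB.
    by apply: pB; rewrite -mem_enum mem_nth// -cardE.
  apply: pNB; set b := nth _ _ _.
  suff : b \in (~: B)%SET by rewrite inE.
  by rewrite -mem_enum mem_nth// -cardE ltn_subLR// cardsC card_ord.
- by rewrite p0 lt_neqAle eq_sym a1a0 a0min.
- apply/andP; split; first by apply/card_gt0P; exists a0; rewrite inE.
  apply: (@leq_trans (#|B| + #|(~: B)%SET|)); last by rewrite cardsC card_ord.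
  rewrite -[X in (X < _)%N]addn0 ltn_add2l; apply/card_gt0P; exists a1.
  by rewrite !inE.
- have q := quad _ _ a1a0; split; first by rewrite addrC.
  by rewrite -(pT a0); move: q; move: (p a0)^-1 (p a1)^-1 => x y q; nra.
Qed.

Lemma sqrt_sqr (x : R) : 0 <= x -> Num.sqrt x * Num.sqrt x = x.
Proof. by move=> x0; rewrite -expr2 sqr_sqrtr. Qed.

Local Notation s13 := (Num.sqrt (13 : R)).
Local Notation s3 := (Num.sqrt (3 : R)).

Lemma s13_sqr : s13 * s13 = 13. Proof. exact: sqrt_sqr. Qed.
Lemma s3_sqr : s3 * s3 = 3. Proof. exact: sqrt_sqr. Qed.

Lemma s13_bounds : 36 / 10 < s13 < 361 / 100.
Proof.
have := s13_sqr; have : 0 <= s13 by exact: sqrtr_ge0.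
by move: s13 => s s0 ss; apply/andP; split; nra.
Qed.

Lemma s3_bounds : 17 / 10 < s3 < 174 / 100.
Proof.
have := s3_sqr; have : 0 <= s3 by exact: sqrtr_ge0.
by move: s3 => s s0 ss; apply/andP; split; nra.
Qed.

(** Eliminating one weight by the linear relation leaves a quadratic equation for the other. Since
    the weights average to 1/4, P < 1/4 < Q, and this selects the root. *)
Lemma values_case (P Q : R) (k : nat) : 0 < P < Q -> (0 < k < 4)%N ->
  k%:R * P + (4 - k)%N%:R * Q = 1 -> P^-1 + Q^-1 = 12 ->
  [\/ [/\ k = 1%N, P = (5 - s13) / 12 & Q = (7 + s13) / 36],
      [/\ k = 2%N, P = (3 - s3) / 12 & Q = (3 + s3) / 12] |
      [/\ k = 3%N, P = (7 - s13) / 36 & Q = (5 + s13) / 12]].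
Proof.
move=> /andP[P0 PQ] k14 kPQ PQ12; have Q0 : 0 < Q by exact: lt_trans PQ.
have PQE : P + Q = 12 * (P * Q).
  by rewrite -PQ12; field; rewrite !gt_eqF.
have := s13_bounds; have := s3_bounds; have := s13_sqr; have := s3_sqr.
move: s13 s3 => s s' ss' ss /andP[s'l s'u] /andP[sl su].
case: k k14 kPQ => [//|[|[|[|//]]]] _ /= kPQ.
- apply: Or31.
  rewrite (_ : (4 - 1)%N = 3%N)// in kPQ.
  have PE : P = 1 - 3 * Q by move: kPQ; lra.
  have QE : (Q - (7 + s) / 36) * (Q - (7 - s) / 36) = 0 by nra.
  have Q14 : 1 / 4 < Q by lra.
  have QE1 : Q = (7 + s) / 36.
    move/eqP: QE; rewrite mulf_eq0 => /orP[/eqP|/eqP] H; lra.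
  by split => //; lra.
- apply: Or32.
  rewrite (_ : (4 - 2)%N = 2%N)// in kPQ.
  have PE : P = 1 / 2 - Q by move: kPQ; lra.
  have QE : (Q - (3 + s') / 12) * (Q - (3 - s') / 12) = 0 by nra.
  have QE1 : Q = (3 + s') / 12.
    move/eqP: QE; rewrite mulf_eq0 => /orP[/eqP|/eqP] H; lra.
  by split => //; lra.
- apply: Or33.
  rewrite (_ : (4 - 3)%N = 1%N)// in kPQ.
  have QE' : Q = 1 - 3 * P by move: kPQ; lra.
  have PE : (P - (7 + s) / 36) * (P - (7 - s) / 36) = 0 by nra.
  have P14 : P < 1 / 4 by lra.
  have PE1 : P = (7 - s) / 36.
    move/eqP: PE; rewrite mulf_eq0 => /orP[/eqP|/eqP] H; lra.
  by split => //; lra.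
Qed.

(* k is the number of coordinates carrying the smaller of the two weights. *)
Definition weights (k : nat) (a : 'I_4) : R :=
  match k with
  | 1 => if (a < 1)%N then (5 - s13) / 12 else (7 + s13) / 36
  | 2 => if (a < 2)%N then (3 - s3) / 12 else (3 + s3) / 12
  | _ => if (a < 3)%N then (7 - s13) / 36 else (5 + s13) / 12
  end.

(** The value 32 - 1 / (P Q) of T for the weights of type k. *)
Definition energy (k : nat) : R :=
  match k with 1 => 10 - 2 * s13 | 2 => 8 | _ => 10 + 2 * s13 end.

Lemma energy_inj k l : (0 < k < 4)%N -> (0 < l < 4)%N -> energy k = energy l -> k = l.
Proof.
have /andP[sl su] := s13_bounds; rewrite /energy; move: s13 sl su => s sl su.
by case: k => [|[|[|[|]]]] //; case: l => [|[|[|[|]]]] // _ _ H; exfalso; lra.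
Qed.

Lemma classification (p : 'I_4 -> R) (T : R) :
  (forall a, 0 < p a) -> \sum_a p a = 1 ->
  (forall a, (4 - (p a)^-1) ^+ 2 + 4 * (4 - (p a)^-1) = T) -> T != 0 ->
  exists2 k, (0 < k < 4)%N & T = energy k /\
    exists2 sigma : 'I_4 -> 'I_4, injective sigma & forall a, p (sigma a) = weights k a.
Proof.
move=> p0 sp pT T0.
have [P [Q [k [sigma [isig psig PQ k14 [PQ12 TE]]]]]] := two_values p0 sp pT T0.
exists k => //.
have kPQ : k%:R * P + (4 - k)%N%:R * Q = 1.
  rewrite -[RHS]sp [RHS](reindex sigma) /=; last by apply: onW_bij; exact: injF_bij.
  under [RHS]eq_bigr do rewrite psig.
  rewrite !big_ord_recl big_ord0; case: k k14 {psig TE} => [//|[|[|[|//]]]] _ /=.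
  - by rewrite (_ : (4 - 1)%N = 3%N)//; ring.
  - by rewrite (_ : (4 - 2)%N = 2%N)//; ring.
  - by rewrite (_ : (4 - 3)%N = 1%N)//; ring.
have := s13_sqr; have := s3_sqr; have /andP[s13l s13u] := s13_bounds.
have /andP[s3l s3u] := s3_bounds => ss3 ss13.
have [[kE PE QE]|[kE PE QE]|[kE PE QE]] := values_case PQ k14 kPQ PQ12.
- split; last first.
    by exists sigma => // a; rewrite psig kE PE QE.
  rewrite TE kE PE QE /energy.
  have -> : ((5 - s13) / 12)^-1 = 5 + s13.
    move: s13 ss13 s13l s13u => s ss sl su.
    apply: (@mulfI _ ((5 - s) / 12)); first by rewrite gt_eqF//; lra.
    by rewrite mulfV ?gt_eqF//; [nra|lra].
  have -> : ((7 + s13) / 36)^-1 = 7 - s13.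
    move: s13 ss13 s13l s13u => s ss sl su.
    apply: (@mulfI _ ((7 + s) / 36)); first by rewrite gt_eqF//; lra.
    by rewrite mulfV ?gt_eqF//; [nra|lra].
  by move: s13 ss13 => s ss; nra.
- split; last first.
    by exists sigma => // a; rewrite psig kE PE QE.
  rewrite TE kE PE QE /energy.
  have -> : ((3 - s3) / 12)^-1 = 6 + 2 * s3.
    move: s3 ss3 s3l s3u => s ss sl su.
    apply: (@mulfI _ ((3 - s) / 12)); first by rewrite gt_eqF//; lra.
    by rewrite mulfV ?gt_eqF//; [nra|lra].
  have -> : ((3 + s3) / 12)^-1 = 6 - 2 * s3.
    move: s3 ss3 s3l s3u => s ss sl su.
    apply: (@mulfI _ ((3 + s) / 12)); first by rewrite gt_eqF//; lra.
    by rewrite mulfV ?gt_eqF//; [nra|lra].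
  by move: s3 ss3 => s ss; nra.
- split; last first.
    by exists sigma => // a; rewrite psig kE PE QE.
  rewrite TE kE PE QE /energy.
  have -> : ((7 - s13) / 36)^-1 = 7 + s13.
    move: s13 ss13 s13l s13u => s ss sl su.
    apply: (@mulfI _ ((7 - s) / 36)); first by rewrite gt_eqF//; lra.
    by rewrite mulfV ?gt_eqF//; [nra|lra].
  have -> : ((5 + s13) / 12)^-1 = 5 - s13.
    move: s13 ss13 s13l s13u => s ss sl su.
    apply: (@mulfI _ ((5 + s) / 12)); first by rewrite gt_eqF//; lra.
    by rewrite mulfV ?gt_eqF//; [nra|lra].
  by move: s13 ss13 => s ss; nra.
Qed.

End Classification.

(** * The listed parameters and their frequencies *)

Section Tuples.
Variable R : realType.
Local Notation s13 := (Num.sqrt (13 : R)).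
Local Notation s3 := (Num.sqrt (3 : R)).

Definition rho_plus (alpha gamma delta : R) : R :=
  2^-1 * (Num.sqrt (4 * gamma * (2 * gamma - alpha) + delta ^+ 2) + delta).
Definition rho_minus (alpha gamma delta : R) : R :=
  2^-1 * (Num.sqrt (4 * gamma * (2 * gamma - alpha) + delta ^+ 2) - delta).

Definition admissible (lambda alpha gamma delta : R) : Prop :=
  [/\ - 1 < lambda < 0,
      0 < alpha <= (lambda ^+ 2 - 1) / lambda,
      alpha >= delta /\ delta >= 0,
      alpha > 2 * gamma
    & lambda ^+ 2 != 1 / 3].

Definition listed (lambda alpha gamma delta : R) : Prop :=
  [\/ [/\ lambda = - Num.sqrt ((4 - Num.sqrt 13) / 3),
          alpha = Num.sqrt ((7 - Num.sqrt 13) / 6),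
          gamma = - Num.sqrt ((7 - Num.sqrt 13) / 6)
        & delta = 0],
      [/\ lambda = - Num.sqrt (1 / (5 + 2 * Num.sqrt 3)),
          alpha = Num.sqrt ((45 + 21 * Num.sqrt 3) / 13),
          gamma = - Num.sqrt (6 / (21 + 11 * Num.sqrt 3))
        & delta = 0]
    | [/\ lambda = - Num.sqrt (1 / (6 + Num.sqrt 13)),
          alpha = Num.sqrt ((523 + 139 * Num.sqrt 13) / 138),
          gamma = - Num.sqrt ((79 - 17 * Num.sqrt 13) / 138)
        & delta = Num.sqrt ((14 + 2 * Num.sqrt 13) / 3)]].

(** What the relations <mu_a, mu_b> = - 1 + delta_ab / p_a amount to for the rows of [frequency].
    The first equation is the orthogonality relation of row 1 with rows 2 and 3; the others give the
    norms of the four rows, simplified by the first one and by the value of rho1 rho2. *)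
Definition frequencies_for (lambda alpha gamma delta : R) (p : 'I_4 -> R) : Prop :=
  let r1 := rho_plus alpha gamma delta in let r2 := rho_minus alpha gamma delta in
  [/\ gamma * (gamma - alpha) = lambda ^+ 2 + 1,
      lambda ^+ 2 / (lambda ^+ 2 + 1) = p 0,
      (gamma - alpha) * (2 * gamma - alpha) = (p 1)^-1,
      r1 * (r1 + r2) = (p 2)^-1 & r2 * (r1 + r2) = (p 3)^-1].

Lemma ler_of_sqr (x y : R) : 0 <= y -> x * x <= y * y -> x <= y.
Proof.
move=> y0; rewrite -!expr2 => xy; apply: le_trans (ler_norm x) _.
by rewrite -(ger0_norm y0) -ler_sqr ?nnegrE// !real_normK ?num_real.
Qed.

Lemma ltr_of_sqr (x y : R) : 0 <= y -> x * x < y * y -> x < y.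
Proof.
move=> y0; rewrite !ltNge; apply: contra => yx; exact: ler_pM.
Qed.

Lemma eqr_of_sqr (x y : R) : 0 <= x -> 0 <= y -> x * x = y * y -> x = y.
Proof. by move=> x0 y0 xy; apply/le_anti/andP; split; apply: ler_of_sqr => //; rewrite xy. Qed.

Lemma sqrt_gt0 (x : R) : 0 < x -> 0 < Num.sqrt x /\ Num.sqrt x * Num.sqrt x = x.
Proof. by move=> x0; rewrite sqrtr_gt0 sqrt_sqr ?ltW. Qed.

(** The parameters are nested radicals, but their squares are rational expressions in a single
    square root, so the inequalities are checked on squares. *)
Lemma admissible_of_sqr (L A G D : R) : 0 < L -> L * L < 1 -> 0 < A ->
  (A * A) * (L * L) <= (1 - L * L) * (1 - L * L) -> 0 <= D -> D * D <= A * A ->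
  0 < G -> L * L != 1 / 3 -> admissible (- L) A (- G) D.
Proof.
move=> L0 L1 A0 AL D0 DA G0 L3; split.
- by rewrite ltrN2 oppr_lt0 L0 andbT ltr_of_sqr// mul1r.
- rewrite A0 /= sqrrN invrN mulrN -mulNr opprB expr2 ler_pdivlMr//.
  by apply: ler_of_sqr; lra.
- by split=> //; apply: ler_of_sqr => //; exact: ltW.
- by lra.
- by rewrite sqrrN expr2.
Qed.

Lemma rho_prod (alpha gamma delta S : R) : 0 <= S ->
  S * S = 4 * gamma * (2 * gamma - alpha) + delta ^+ 2 ->
  let r1 := rho_plus alpha gamma delta in let r2 := rho_minus alpha gamma delta in
  r1 * (r1 + r2) = (S * S + S * delta) / 2 /\ r2 * (r1 + r2) = (S * S - S * delta) / 2.
Proof.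
move=> S0 SS; rewrite /rho_plus /rho_minus -SS -expr2 sqrtr_sqr ger0_norm//.
by split; field.
Qed.

Lemma weights_gt0 k a : 0 < weights R k a.
Proof.
have /andP[a1 a2] := s13_bounds R; have /andP[b1 b2] := s3_bounds R.
rewrite /weights; move: s13 s3 a1 a2 b1 b2 => s s' a1 a2 b1 b2.
by case: k => [|[|[|k]]] /=; case: ifP => _; lra.
Qed.

Lemma inv_eq (x y : R) : x * y = 1 -> x = y^-1.
Proof.
move=> xy; have y0 : y != 0.
  by apply/eqP => y0; move/eqP: xy; rewrite y0 mulr0 eq_sym oner_eq0.
by apply: (mulIf y0); rewrite mulVf.
Qed.

Lemma div_eq (x y z : R) : y != 0 -> x = z * y -> x / y = z.
Proof. by move=> y0 ->; rewrite mulfK. Qed.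

Lemma tuple_type1 : exists lambda alpha gamma delta : R,
  [/\ admissible lambda alpha gamma delta, listed lambda alpha gamma delta &
      frequencies_for lambda alpha gamma delta (weights R 1)].
Proof.
have /andP[sl su] := s13_bounds R; have ss := s13_sqr R.
have [|L0 LL] := @sqrt_gt0 ((4 - s13) / 3); first by lra.
have [|A0 AA] := @sqrt_gt0 ((7 - s13) / 6); first by lra.
exists (- Num.sqrt ((4 - s13) / 3)), (Num.sqrt ((7 - s13) / 6)),
  (- Num.sqrt ((7 - s13) / 6)), 0.
split; last 2 first.
- exact: Or31.
- move: (Num.sqrt (_ / 3)) (Num.sqrt (_ / 6)) L0 LL A0 AA => L A L0 LL A0 AA.
  rewrite /frequencies_for.
  (* With gamma = - alpha and delta = 0 the radicand in rho is 12 alpha^2. *)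
  have [|//|r1E r2E] := @rho_prod A (- A) 0 (Num.sqrt (12 * (A * A))); first exact: sqrtr_ge0.
    by rewrite sqrt_sqr; [ring|lra].
  rewrite r1E r2E !mulr0 subr0 addr0 sqrt_sqr; last by lra.
  rewrite sqrrN expr2 LL /weights /=; split.
  + by lra.
  + by apply: div_eq; [rewrite gt_eqF//; lra|lra].
  + rewrite [LHS](_ : _ = 6 * (A * A)); last by ring.
    by rewrite AA; apply: inv_eq; lra.
  + by rewrite AA; apply: inv_eq; lra.
  + by rewrite AA; apply: inv_eq; lra.
- apply: admissible_of_sqr => //; rewrite ?LL ?AA ?mulr0 ?lexx//; move: s13 ss sl su => s ss sl su.
  + by lra.
  + by lra.
  + by lra.
  + by apply/eqP => H; lra.
Qed.

Lemma tuple_type2 : exists lambda alpha gamma delta : R,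
  [/\ admissible lambda alpha gamma delta, listed lambda alpha gamma delta &
      frequencies_for lambda alpha gamma delta (weights R 2)].
Proof.
have /andP[sl su] := s3_bounds R; have ss := s3_sqr R.
have XL : 1 / (5 + 2 * s3) = (5 - 2 * s3) / 13.
  by apply: div_eq; [rewrite gt_eqF//; lra|lra].
have XG : 6 / (21 + 11 * s3) = (21 - 11 * s3) / 13.
  by apply: div_eq; [rewrite gt_eqF//; lra|lra].
have [|L0 LL] := @sqrt_gt0 (1 / (5 + 2 * s3)); first by rewrite XL; lra.
have [|A0 AA] := @sqrt_gt0 ((45 + 21 * s3) / 13); first by lra.
have [|G0 GG] := @sqrt_gt0 (6 / (21 + 11 * s3)); first by rewrite XG; lra.
exists (- Num.sqrt (1 / (5 + 2 * s3))), (Num.sqrt ((45 + 21 * s3) / 13)),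
  (- Num.sqrt (6 / (21 + 11 * s3))), 0.
split; last 2 first.
- exact: Or32.
- rewrite {}XL in L0 LL *; rewrite {}XG in G0 GG *.
  move: (Num.sqrt ((5 - _) / 13)) (Num.sqrt ((45 + _) / 13)) (Num.sqrt ((21 - _) / 13))
    L0 LL A0 AA G0 GG => L A G L0 LL A0 AA G0 GG.
  (* The product of the two nested radicals lies in Q(sqrt 3): (45 + 21 sqrt 3)(21 - 11 sqrt 3) =
     252 - 54 sqrt 3 = (9 sqrt 3 - 3)^2. *)
  have AG : A * G = (9 * s3 - 3) / 13.
    apply: eqr_of_sqr; [exact: mulr_ge0 (ltW A0) (ltW G0)|by lra|].
    by rewrite mulrACA AA GG; move: s3 ss => s ss; lra.
  have HS : 4 * - G * (2 * - G - A) + 0 ^+ 2 = 8 * (G * G) + 4 * (A * G) by ring.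
  rewrite /frequencies_for.
  have [|//|r1E r2E] := @rho_prod A (- G) 0 (Num.sqrt (8 * (G * G) + 4 * (A * G))).
  + exact: sqrtr_ge0.
  + by rewrite sqrt_sqr ?HS// AG GG; lra.
  rewrite r1E r2E !mulr0 subr0 addr0 sqrt_sqr; last by rewrite AG GG; lra.
  rewrite sqrrN expr2 LL /weights /= AG GG; split.
  + by rewrite [LHS](_ : _ = G * G + A * G); [rewrite AG GG; lra|ring].
  + by apply: div_eq; [rewrite gt_eqF//; lra|lra].
  + rewrite [LHS](_ : _ = 2 * (G * G) + 3 * (A * G) + A * A); last by ring.
    by rewrite AG GG AA; apply: inv_eq; lra.
  + by apply: inv_eq; lra.
  + by apply: inv_eq; lra.
- apply: admissible_of_sqr => //; rewrite ?LL ?AA ?XL ?mulr0 ?lexx//; move: s3 ss sl su => s ss sl su.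
  + by lra.
  + by lra.
  + by lra.
Qed.

Lemma tuple_type3 : exists lambda alpha gamma delta : R,
  [/\ admissible lambda alpha gamma delta, listed lambda alpha gamma delta &
      frequencies_for lambda alpha gamma delta (weights R 3)].
Proof.
have /andP[sl su] := s13_bounds R; have ss := s13_sqr R.
have XL : 1 / (6 + s13) = (6 - s13) / 23.
  by apply: div_eq; [rewrite gt_eqF//; lra|lra].
have [|L0 LL] := @sqrt_gt0 (1 / (6 + s13)); first by rewrite XL; lra.
have [|A0 AA] := @sqrt_gt0 ((523 + 139 * s13) / 138); first by lra.
have [|G0 GG] := @sqrt_gt0 ((79 - 17 * s13) / 138); first by lra.
have [|D0 DD] := @sqrt_gt0 ((14 + 2 * s13) / 3); first by lra.
exists (- Num.sqrt (1 / (6 + s13))), (Num.sqrt ((523 + 139 * s13) / 138)),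
  (- Num.sqrt ((79 - 17 * s13) / 138)), (Num.sqrt ((14 + 2 * s13) / 3)).
split; last 2 first.
- exact: Or33.
- rewrite {}XL in L0 LL *.
  move: (Num.sqrt ((6 - _) / 23)) (Num.sqrt ((523 + _) / 138)) (Num.sqrt ((79 - _) / 138))
    (Num.sqrt ((14 + _) / 3)) L0 LL A0 AA G0 GG D0 DD => L A G D L0 LL A0 AA G0 GG D0 DD.
  have AG : A * G = (95 + 11 * s13) / 138.
    apply: eqr_of_sqr; [exact: mulr_ge0 (ltW A0) (ltW G0)|by lra|].
    by rewrite mulrACA AA GG; move: s13 ss => s ss; lra.
  (* In the radicand 8 G^2 + 4 A G + D^2 of rho the terms in sqrt 13 cancel and 12 remains. *)
  have [|S0 SS] := @sqrt_gt0 12; first by [].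
  have SD : Num.sqrt 12 * D = 2 + 2 * s13.
    apply: eqr_of_sqr; [exact: mulr_ge0 (ltW S0) (ltW D0)|by lra|].
    by rewrite mulrACA SS DD; move: s13 ss => s ss; lra.
  have HS : 4 * - G * (2 * - G - A) + D ^+ 2 = 8 * (G * G) + 4 * (A * G) + D * D by ring.
  rewrite /frequencies_for.
  have [|//|r1E r2E] := @rho_prod A (- G) D (Num.sqrt 12).
  + exact: sqrtr_ge0.
  + by rewrite SS HS AG GG DD; lra.
  rewrite r1E r2E SS SD sqrrN expr2 LL /weights /=; split.
  + by rewrite [LHS](_ : _ = G * G + A * G); [rewrite AG GG; lra|ring].
  + by apply: div_eq; [rewrite gt_eqF//; lra|lra].
  + rewrite [LHS](_ : _ = 2 * (G * G) + 3 * (A * G) + A * A); last by ring.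
    by rewrite AG GG AA; apply: inv_eq; lra.
  + by apply: inv_eq; lra.
  + by apply: inv_eq; lra.
- apply: admissible_of_sqr => //; rewrite ?LL ?AA ?DD ?XL ?ltW//; move: s13 ss sl su => s ss sl su.
  + by lra.
  + by lra.
  + by lra.
  + by apply/eqP => H; lra.
Qed.

Lemma tuple_exists k : (0 < k < 4)%N -> exists lambda alpha gamma delta : R,
  [/\ admissible lambda alpha gamma delta, listed lambda alpha gamma delta &
      frequencies_for lambda alpha gamma delta (weights R k)].
Proof.
by case: k => [//|[|[|[|//]]]] _; [exact: tuple_type1|exact: tuple_type2|exact: tuple_type3].
Qed.

End Tuples.

(** * Constancy of the type *)

Section LocalFrame.
Variables (R : realType) (m : nat).
Implicit Types (U V : set 'rV[R]_m) (f : 'rV[R]_m -> Cvec R m.+1).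

Definition unitary_frame (E : 'I_m.+1 -> Cvec R m.+1) : Prop :=
  forall a b, hdot (toC (E a)) (toC (E b)) = (a == b)%:R.

Lemma legendrian_patchS U V f :
  legendrian_patch U f -> open V -> V `<=` U -> legendrian_patch V f.
Proof.
move=> LP oV VU; split=> //.
- exact: smoothVS VU (patch_smooth LP).
- by move=> t /VU; exact: (patch_sphere LP).
- by move=> t v /VU; exact: (patch_immersion LP).
- by move=> X t /VU; exact: (patch_integral LP).
Qed.

Lemma local_frame U f t0 : legendrian_patch U f -> flat_on f U ->
  C_parallel_on f U -> U t0 ->
  exists E, [/\ unitary_frame E, forall a, 0 < znorm2 f (E a) t0 &
    \forall t \near t0, forall a, znorm2 f (E a) t = znorm2 f (E a) t0].
Proof.
move=> LP flatU parU Ut0.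
have [E [mu [uE H]]] := shape_eigen LP flatU Ut0.
exists E; split=> // [a|]; first by have [] := H a.
apply: (@filter_forall _ _ _ (nbhs t0) (nbhs_filter t0)) => a; have [r0 X Y S] := H a.
apply: (znorm2_near LP parU Ut0 (mu := fun i => mu i a)) => //.
- by move=> i; rewrite (pd_zre LP).
- by move=> i; rewrite (pd_zim LP).
Qed.

End LocalFrame.

Section GlobalFrame.
Variables (R : realType) (m : nat) (M : topologicalType).
Variables (A : set (chart R m M)) (x : M -> Cvec R m.+1).
Hypothesis atlasA : smooth_atlas A.
Hypothesis x_sub : sphere_submanifold A x.
Hypothesis x_flat : flat A x.
Hypothesis x_par : integral_C_parallel A x.
Implicit Types (c : chart R m M) (pt : M).

Lemma chart_patch c : A c -> legendrian_patch (target c) (x \o param c).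
Proof.
move=> Ac; have [xS xA] := x_sub; have [xs xi] := xA c Ac; split.
- exact: open_target.
- exact: (smooth_on_smoothV (@open_target _ _ _ c) xs).
- by move=> t _; exact: xS.
- exact: xi.
- by have [] := x_par Ac.
Qed.

(** Formulated on M itself, with a constant basis: the condition is open in the point, and frames
    seen in different charts can be compared. *)
Definition frame_at pt E p : Prop :=
  [/\ unitary_frame E, forall a, 0 < p a &
    \forall q \near pt, forall a,
      rdot (x q) (E a) ^+ 2 + rdot (x q) (Jmul (E a)) ^+ 2 = p a].

Lemma frame_at_chart pt E p c : A c -> source c pt -> frame_at pt E p ->
  exists U, [/\ legendrian_patch U (x \o param c), U `<=` target c, U (Defs.coord c pt) &
    forall t, U t -> forall a, znorm2 (x \o param c) (E a) t = p a].
Proof.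
move=> Ac cpt [uE p0 near_p].
have tc := coord_target cpt.
(* Asking for a whole neighbourhood of constant radii makes this set open. *)
pose U := [set t | target c t /\
  (nbhs t [set s | forall a, znorm2 (x \o param c) (E a) s = p a])].
have oU : open U.
  rewrite openE => t [ct Nt]; apply: (@filterI _ (nbhs t) (nbhs_filter t)).
    by apply: open_nbhs_nbhs; split=> //; exact: open_target.
  exact: (nbhs_interior Nt).
exists U; split.
- by apply: (legendrian_patchS (chart_patch Ac) oU) => t [].
- by move=> t [].
- split=> //; have := @param_continuous _ _ _ c _ tc.
  rewrite /prop_for /continuous_at (coordK cpt) => H; exact: H near_p.
- by move=> t [_ /nbhs_singleton].
Qed.

Lemma frame_exists pt : exists E p, frame_at pt E p.
Proof.
have [c Ac cpt] := atlasA.1 pt; have tc := coord_target cpt.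
have [E [uE r0 near_r]] :=
  local_frame (chart_patch Ac) (x_flat Ac) (x_par Ac).2 tc.
exists E, (fun a => znorm2 (x \o param c) (E a) (Defs.coord c pt)); split=> //.
have H := @Defs.coord_continuous _ _ _ _ _ cpt _ near_r.
have S : nbhs pt (source c) by apply: open_nbhs_nbhs; split=> //; exact: open_source.
apply: (@filterS2 _ (nbhs pt) (nbhs_filter pt) _ _ _ _ H S) => q /= {}H Sq a; rewrite -(H a) /znorm2 /zre /zim /=.
by rewrite /= coordK.
Qed.

Lemma frame_spec_unique pt E p E' p' :
  frame_at pt E p -> frame_at pt E' p' -> spec_norm p = spec_norm p'.
Proof.
move=> F F'; have [c Ac cpt] := atlasA.1 pt.
have [U [LP _ Ut H]] := frame_at_chart Ac cpt F.
have [U' [LP' _ Ut' H']] := frame_at_chart Ac cpt F'.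
have [uE p0 _] := F; have [uE' p0' _] := F'.
by rewrite -(dot_tension LP uE p0 H Ut) (dot_tension LP' uE' p0' H' Ut').
Qed.

Lemma frame_near pt E p : frame_at pt E p ->
  \forall q \near pt, frame_at q E p.
Proof.
move=> [uE p0 N]; apply: filterS (nbhs_interior N) => q Nq; split => //.
Qed.

Hypothesis conM : connected [set: M].

(** The set of points having a frame with this norm is open. So is its complement: every point has a
    frame, which also serves nearby points, and the norm at a point does not depend on the frame. *)
Lemma frame_spec_const pt pt' E p E' p' :
  frame_at pt E p -> frame_at pt' E' p' -> spec_norm p = spec_norm p'.
Proof.
move=> F F'.
pose B := [set q | exists E1 p1, frame_at q E1 p1 /\ spec_norm p1 = spec_norm p].
have oB : open B.
  rewrite openE => q [E1 [p1 [F1 T1]]]; apply: filterS (frame_near F1) => r Fr.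
  by exists E1, p1.
have cB : closed B.
  rewrite -openC openE => q nBq; have [E1 [p1 F1]] := frame_exists q.
  apply: filterS (frame_near F1) => r Fr [E2 [p2 [F2 T2]]]; apply: nBq.
  by exists E1, p1; split=> //; rewrite (frame_spec_unique Fr F2).
have BT : B = [set: M].
  apply: conM; first by exists pt, E, p.
  - by exists B => //; rewrite setTI.
  - by exists B => //; rewrite setTI.
have : B pt' by rewrite BT.
move=> [E1 [p1 [F1 <-]]]; exact: frame_spec_unique F1 F'.
Qed.

Hypothesis x_not_minimal : ~ minimal A x.

Lemma frame_spec_neq0 pt E p : frame_at pt E p -> spec_norm p != 0.
Proof.
move=> F; apply/eqP => T0; apply: x_not_minimal => c Ac t ct.
have cpt := param_source ct.
have [E' [p' F']] := frame_exists (param c t).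
have [U [LP _ Ut H]] := frame_at_chart Ac cpt F'; have [uE' p0' _] := F'.
have := dot_tension LP uE' p0' H Ut; rewrite (paramK ct).
by rewrite -(frame_spec_const F F') T0 => /rdot_eq0.
Qed.

Hypothesis x_bih : biharmonic A (- 4) x.

Lemma frame_spec_eq pt E p a : frame_at pt E p ->
  spec p a ^+ 2 + 4 * spec p a = spec_norm p.
Proof.
move=> F; have [c Ac cpt] := atlasA.1 pt; have [uE p0 _] := F.
have [U [LP UT Ut H]] := frame_at_chart Ac cpt F.
apply: (biharmonic_spec LP uE p0 H a Ut) => t /UT; exact: x_bih.
Qed.

Lemma frame_sum pt E p : frame_at pt E p -> \sum_a p a = 1.
Proof.
move=> F; have [c Ac cpt] := atlasA.1 pt; have [uE p0 _] := F.
by have [U [LP UT Ut H]] := frame_at_chart Ac cpt F; exact: (rep_sum_p LP uE H Ut).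
Qed.

End GlobalFrame.

(** * Phases as coordinates *)

Section Phase.
Variable R : realType.

Lemma differentiable_atan (x : R) : differentiable (atan : R -> R) x.
Proof. by apply/derivable1_diffP; exact: derivable_atan. Qed.

Lemma derive_atan (x w : R) : 'D_w (atan : R -> R) x = w * (1 + x ^+ 2)^-1.
Proof.
have dx := differentiable_atan x.
rewrite deriveE// -[w in LHS]mulr1 -[w * 1]/(w *: (1 : R^o)) linearZ -deriveE//.
by rewrite (@derive_val _ _ _ _ _ _ _ (is_derive1_atan x)).
Qed.

Lemma smooth_of_pd m (U : set 'rV[R]_m) (F : 'rV[R]_m -> R) (G : 'I_m -> 'rV[R]_m -> R) :
  open U -> (forall t, U t -> differentiable F t) ->
  (forall i t, U t -> pd i F t = G i t) -> (forall i, smoothF U (G i)) -> smoothF U F.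
Proof.
move=> oU dF FG SG; case=> [//|k]; split=> // i.
by apply: Ck_ext oU _ (SG i k) => t Ut; rewrite -FG// pdE.
Qed.

Lemma const_of_pd m (F : 'rV[R]_m -> R) (t0 t : 'rV[R]_m) r :
  0 < r -> smoothF (ball t0 r) F -> ball t0 r t ->
  (forall i s, ball t0 r s -> pd i F s = 0) -> F t = F t0.
Proof.
move=> r0 SF Bt F0.
have Bs s : 0 <= s <= 1 -> ball t0 r (t0 + s *: (t - t0)).
  by move=> s01; apply: ball_segment => //; exact: ballxx.
have [s s01] := mean_value_segment (fun s s01 => smooth_diff SF (Bs s s01)).
rewrite [t0 + (t - t0)]addrC subrK derive_pd; last exact: smooth_diff (Bs s s01).
rewrite big1 => [/eqP|i _]; first by rewrite subr_eq0 => /eqP.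
by rewrite F0 ?scaler0//; exact: Bs.
Qed.

Variables (m : nat) (U : set 'rV[R]_m) (f : 'rV[R]_m -> Cvec R m.+1).
Hypothesis LP : legendrian_patch U f.
Let oU : open U. Proof. exact: patch_open LP. Qed.
Let Sf : smoothV U f. Proof. exact: patch_smooth LP. Qed.
Variables (E : 'I_m.+1 -> Cvec R m.+1) (p : 'I_m.+1 -> R).
Hypothesis uE : unitary_frame E.
Hypothesis p_gt0 : forall a, 0 < p a.
Hypothesis Ep : forall t, U t -> forall a, znorm2 f (E a) t = p a.
Hypothesis X_gt0 : forall t, U t -> forall a, 0 < zre f (E a) t.
Local Notation X a := (zre f (E a)).
Local Notation Y a := (zim f (E a)).
Implicit Types (t : 'rV[R]_m).

(* An argument of z_a, which has positive real part on U. *)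
Definition phase a t : R := atan (Y a t / X a t).

Let SX a : smoothF U (X a). Proof. exact: Sf. Qed.
Let SY a : smoothF U (Y a). Proof. exact: Sf. Qed.
Let X0 a t : U t -> X a t != 0. Proof. by move=> Ut; rewrite gt_eqF// X_gt0. Qed.
Let Sq a : smoothF U (fun t => Y a t / X a t).
Proof. by apply: smoothM => //; apply: smooth_inv => // t; exact: X0. Qed.

Lemma phase_diff a t : U t -> differentiable (phase a) t.
Proof.
move=> Ut; apply: (@differentiable_comp _ _ _ _ (fun t => Y a t / X a t) atan).
  exact: smooth_diff (Sq a) Ut.
exact: differentiable_atan.
Qed.

Lemma pd_phase a i t : U t -> pd i (phase a) t = dlog_im f (E a) i t.
Proof.
move=> Ut; have dq := smooth_diff (Sq a) Ut.
have Dq : pd i (fun t => Y a t / X a t) t * X a t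
    + Y a t / X a t * pd i (X a) t = pd i (Y a) t.
  rewrite -(pdM i (Sq a) (SX a) Ut); apply: (pd_ext oU) Ut => s Us.
  by rewrite divfK// X0.
rewrite -pdE (derive_chain (F := fun t => Y a t / X a t) (G := atan) _ dq).
  2: exact: differentiable_atan.
rewrite pdE derive_atan; move: Dq; rewrite (rep_dX LP p_gt0 Ep a i Ut).
rewrite (rep_dY LP p_gt0 Ep a i Ut); have x0 := X0 a Ut.
have r0 : (X a t) ^+ 2 + (Y a t) ^+ 2 != 0 by rewrite -/(znorm2 f (E a) t) (Ep Ut) gt_eqF.
move: (pd i _ t) (dlog_im _ _ _ _) x0 r0; move: (X a t) (Y a t) => x y d th x0 r0 H.
have -> : d = (x ^+ 2 + y ^+ 2) / x ^+ 2 * th.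
  by apply: (mulIf x0); apply/eqP; rewrite -subr_eq0 -(subrr (x * th)) -{1}H; apply/eqP; field.
by field; rewrite x0.
Qed.

(** The partial derivatives of the phase are the functions [dlog_im], already known to be smooth, so
    only the first derivative of [atan] enters. *)
Lemma smooth_phase a : smoothF U (phase a).
Proof.
apply: (smooth_of_pd oU (@phase_diff a) (fun i t => @pd_phase a i t)) => i.
apply: smoothS (@smooth_dlog_im _ _ _ _ LP (E a) i).
by move=> t Ut; split=> //; rewrite Ep// gt_eqF.
Qed.

Lemma sqrt_frac a t : U t ->
  Num.sqrt (1 + (Y a t / X a t) ^+ 2) = Num.sqrt (p a) / X a t.
Proof.
move=> Ut; rewrite -(Ep Ut) /znorm2; have x0 := X_gt0 Ut a; have x1 := X0 a Ut.
move: (X a t) (Y a t) x0 x1 => x y x0 x1.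
have -> : 1 + (y / x) ^+ 2 = (x ^+ 2 + y ^+ 2) * (x^-1) ^+ 2 by field.
rewrite sqrtrM; last by rewrite addr_ge0 ?sqr_ge0.
by rewrite sqrtr_sqr ger0_norm// invr_ge0 ltW.
Qed.

Lemma zre_phase a t : U t -> X a t = Num.sqrt (p a) * cos (phase a t).
Proof.
move=> Ut; rewrite /phase cos_atan sqrt_frac// invfM invrK mulrA mulfV ?mul1r//.
by rewrite gt_eqF ?sqrtr_gt0.
Qed.

Lemma zim_phase a t : U t -> Y a t = Num.sqrt (p a) * sin (phase a t).
Proof.
move=> Ut; have c0 : cos (phase a t) != 0.
  by apply: contra (X0 a Ut) => /eqP H; rewrite zre_phase// H mulr0.
have := atanK (Y a t / X a t); rewrite -/(phase a t) /tan => H.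
have -> : sin (phase a t) = Y a t / X a t * cos (phase a t) by rewrite -H divfK.
by rewrite mulrCA -zre_phase// divfK// X0.
Qed.

Lemma frame_expand t : U t -> toC (f t) =
  \sum_a ((Num.sqrt (p a))%:C * expi (phase a t)) *: toC (E a).
Proof.
move=> Ut.
have -> : f t = diag_op E (fun=> 1) (f t).
  by apply: (unitary_ext uE) => a;
    rewrite (dot_diag_op_basis uE, dot_diag_op_Jbasis uE) mul1r.
rewrite /diag_op -big_split toC_sum; apply: eq_bigr => a _.
rewrite toCD !toCZ toCJ !mul1r -[rdot (f t) _]/(X a t) -[rdot (f t) (Jmul _)]/(Y a t).
rewrite zre_phase// zim_phase// scalerA -scalerDl; congr (_ *: _).
by apply/eqP; rewrite eq_complex /=; apply/andP; split; apply/eqP; ring.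
Qed.

End Phase.

Section Coordinates.
Variables (R : realType) (m : nat) (U : set 'rV[R]_m) (f : 'rV[R]_m -> Cvec R m.+1).
Hypothesis LP : legendrian_patch U f.
Let oU : open U. Proof. exact: patch_open LP. Qed.
Let Sf : smoothV U f. Proof. exact: patch_smooth LP. Qed.
Variables (E : 'I_m.+1 -> Cvec R m.+1) (p : 'I_m.+1 -> R).
Hypothesis uE : unitary_frame E.
Hypothesis p_gt0 : forall a, 0 < p a.
Hypothesis Ep : forall t, U t -> forall a, znorm2 f (E a) t = p a.
Variable t0 : 'rV[R]_m.
Hypothesis Ut0 : U t0.
Hypothesis X0 : forall a, 0 < zre f (E a) t0.
Hypothesis Y0 : forall a, zim f (E a) t0 = 0.
Variable mu : 'I_m.+1 -> 'I_m -> R.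
Hypothesis dot_mu : forall a b, p a * (1 + \sum_j mu a j * mu b j) = (a == b)%:R.

Definition phase_coord (t : 'rV[R]_m) : 'rV[R]_m :=
  \row_j \sum_a p a * phase f E a t * mu a j.

Lemma phase_coords : exists W,
  [/\ open W, W `<=` U, W t0,
      forall j, smoothF W (fun t => phase_coord t 0 j) &
      (forall v, 'D_v phase_coord t0 = 0 -> v = 0) /\
      forall t, W t -> toC (f t) = \sum_a ((Num.sqrt (p a))%:C *
        expi (\sum_j mu a j * phase_coord t 0 j)) *: toC (E a)].
Proof.
have near_X : \forall t \near t0, U t /\ forall a, 0 < zre f (E a) t.
  apply: (@filterI _ (nbhs t0) (nbhs_filter t0)).
    by apply: open_nbhs_nbhs; split.
  apply: (@filter_forall _ _ _ (nbhs t0) (nbhs_filter t0)) => a.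
  have cX : {for t0, continuous (zre f (E a))} by exact: (smooth_continuous (Sf (E a))).
  exact: (cX [set y | 0 < y] (open_nbhs_nbhs (conj (@open_gt R 0) (X0 a)))).
have /nbhs_ballP[r /= r0 Wr] := near_X.
pose W := ball t0 r.
have oW : open W by exact: ball_open.
have WU : W `<=` U by move=> t /Wr[].
have Wt0 : W t0 by exact: ballxx.
have LPW := legendrian_patchS LP oW WU.
have EpW t : W t -> forall a, znorm2 f (E a) t = p a by move=> /WU; exact: Ep.
have XW t : W t -> forall a, 0 < zre f (E a) t by move=> /Wr[].
have Sph a : smoothF W (phase f E a) := smooth_phase LPW p_gt0 EpW XW a.
have Dph t a v : W t ->
    'D_v (phase f E a) t = \sum_i v 0 i * dlog_im f (E a) i t.
  move=> Wt; rewrite derive_pd; last exact: smooth_diff (Sph a) Wt.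
  by apply: eq_bigr => i _; rewrite (pd_phase LPW p_gt0 EpW XW a i Wt).
(* The weighted sum of phases is constant by the Legendrian condition, and the constant is 0 because
   every z_a is real and positive at [t0]. *)
have sum_phase t : W t -> \sum_a p a * phase f E a t = 0.
  move=> Wt; transitivity (\sum_a p a * phase f E a t0); last first.
    by rewrite big1// => a _; rewrite /phase Y0 mul0r atan0 mulr0.
  have SP a : smoothF W (fun s => p a * phase f E a s).
    by apply: smoothM => //; exact: smooth_cst.
  apply: (@const_of_pd R m (fun t => \sum_a p a * phase f E a t) t0 t r r0) => //.
    exact: smooth_sum.
  move=> i s Ws; rewrite (pd_sum oW (index_enum _) i SP Ws).
  rewrite -[RHS](rep_sum_ptheta LPW uE p_gt0 EpW i Ws).
  apply: eq_bigr => a _; rewrite (pdM i (smooth_cst W (p a)) (Sph a) Ws) pd_cst mul0r add0r.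
  by rewrite (pd_phase LPW p_gt0 EpW XW a i Ws).
(* On the hyperplane of weighted sum 0 the 1 in [dot_mu] disappears, and pairing with the mu_b
   inverts F -> sum_a p_a F_a mu_a. *)
have inv_mu (F : 'I_m.+1 -> R) b : \sum_a p a * F a = 0 ->
    \sum_j mu b j * (\sum_a p a * F a * mu a j) = F b.
  move=> sF; under eq_bigr do rewrite mulr_sumr.
  rewrite exchange_big /=.
  transitivity (\sum_a (p a * F a + \sum_j mu b j * (p a * F a * mu a j))).
    by rewrite big_split /= sF add0r.
  rewrite (eq_bigr (fun a => F a * (a == b)%:R)) => [|a _].
    by rewrite (bigD1 b)//= eqxx mulr1 big1 ?addr0// => a /negbTE ->; rewrite mulr0.
  rewrite -dot_mu mulrDr mulrDr mulr1 [F a * p a]mulrC; congr (_ + _).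
  by rewrite !mulr_sumr; apply: eq_bigr => j _; ring.
have Su j : smoothF W (fun t => phase_coord t 0 j).
  apply: (smooth_ext (F := fun t => \sum_a p a * phase f E a t * mu a j)) => //.
    by move=> t _; rewrite mxE.
  apply: smooth_sum => // a; apply: smoothM => //; last exact: smooth_cst.
  by apply: smoothM => //; exact: smooth_cst.
exists W; split=> //; split=> [v Dv|t Wt]; last first.
  rewrite (frame_expand uE p_gt0 EpW XW Wt); apply: eq_bigr => a _.
  congr ((_ * expi _) *: _); rewrite -[LHS](inv_mu (fun a => phase f E a t)).
    by apply: eq_bigr => j _; rewrite mxE.
  exact: sum_phase.
have du : derivable phase_coord t0 v.
  by apply: diff_derivable; apply: differentiable_rV => j; exact: smooth_diff (Su j) Wt0.
have Duj j : \sum_a p a * 'D_v (phase f E a) t0 * mu a j = 0.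
  have : ('D_v phase_coord t0) 0 j = 0 by rewrite Dv mxE.
  rewrite (derive_mx du) mxE derive_pd; last exact: smooth_diff (Su j) Wt0.
  have pdu i : pd i (fun t => phase_coord t 0 j) t0 =
      \sum_a p a * dlog_im f (E a) i t0 * mu a j.
    rewrite (pd_ext oW (G := fun t => \sum_a p a * phase f E a t * mu a j)) => // [|s _].
      2: by rewrite mxE.
    have SPa a : smoothF W (fun s => p a * phase f E a s).
      by apply: smoothM => //; exact: smooth_cst.
    have SP a : smoothF W (fun s => p a * phase f E a s * mu a j).
      by apply: smoothM => //; exact: smooth_cst.
    rewrite (pd_sum oW (index_enum _) i SP Wt0); apply: eq_bigr => a _.
    rewrite (pdM i (SPa a) (smooth_cst W (mu a j)) Wt0) pd_cst mulr0 addr0.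
    rewrite (pdM i (smooth_cst W (p a)) (Sph a) Wt0) pd_cst mul0r add0r.
    by rewrite (pd_phase LPW p_gt0 EpW XW a i Wt0).
  move=> H; rewrite -[RHS]H; under [RHS]eq_bigr do rewrite pdu scaler_sumr.
  rewrite exchange_big /=; apply: eq_bigr => a _; rewrite Dph// mulr_sumr mulr_suml.
  by apply: eq_bigr => i _; rewrite /GRing.scale /=; ring.
(* The derivatives of the phases also have weighted sum 0, so [inv_mu] recovers them from the
   derivative of the coordinates; if that is 0 then df(v) = 0 and the immersion property gives v =
   0. *)
have D0 b : 'D_v (phase f E b) t0 = 0.
  rewrite -[LHS](inv_mu (fun a => 'D_v (phase f E a) t0)).
    by rewrite big1// => j _; rewrite Duj mulr0.
  under eq_bigr do rewrite Dph// mulr_sumr.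
  rewrite exchange_big /= big1// => i _.
  under eq_bigr do rewrite mulrCA.
  by rewrite -mulr_sumr (rep_sum_ptheta LPW uE p_gt0 EpW i Wt0) mulr0.
apply: (patch_immersion LP Ut0); apply: (unitary_ext uE) => a.
- rewrite rdot0l (derive_pdV v Sf Ut0) rdot_suml.
  transitivity (- (zim f (E a) t0 * 'D_v (phase f E a) t0)); last by rewrite D0; ring.
  rewrite Dph// mulr_sumr -sumrN; apply: eq_bigr => i _.
  by rewrite rdotZl (rep_dotdf LP p_gt0 Ep a i Ut0); ring.
- rewrite rdot0l (derive_pdV v Sf Ut0) rdot_suml.
  transitivity (zre f (E a) t0 * 'D_v (phase f E a) t0); last by rewrite D0; ring.
  rewrite Dph// mulr_sumr; apply: eq_bigr => i _.
  by rewrite rdotZl (rep_dotJdf LP p_gt0 Ep a i Ut0); ring.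
Qed.

End Coordinates.

(** * Normalizing the phases at a point *)

Section Rotation.
Variables (R : realType) (m : nat) (M : topologicalType) (x : M -> Cvec R m.+1).

(** Each E_a is multiplied by the unit complex number z_a / |z_a| taken at [pt]. All z_a become
    positive there, so near [pt] they stay in the right half-plane, where [atan] computes the
    argument. *)
Lemma frame_rotate pt E p : frame_at x pt E p -> exists E', [/\ frame_at x pt E' p,
  forall a, rdot (x pt) (E' a) = Num.sqrt (p a) &
  forall a, rdot (x pt) (Jmul (E' a)) = 0].
Proof.
move=> [uE p0 N]; have N0 := nbhs_singleton N.
pose c a := rdot (x pt) (E a) / Num.sqrt (p a).
pose d a := rdot (x pt) (Jmul (E a)) / Num.sqrt (p a).
have q0 a : Num.sqrt (p a) != 0 by rewrite gt_eqF// sqrtr_gt0.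
have qq a : Num.sqrt (p a) ^+ 2 = p a by rewrite sqr_sqrtr// ltW.
have cd a : c a ^+ 2 + d a ^+ 2 = 1.
  by rewrite /c /d !expr_div_n -mulrDl N0 qq mulfV// gt_eqF.
pose E' a := c a *: E a + d a *: Jmul (E a).
have dE v a : rdot v (E' a) = c a * rdot v (E a) + d a * rdot v (Jmul (E a)).
  by rewrite rdotDr !rdotZr.
have dJ v a : rdot v (Jmul (E' a)) = c a * rdot v (Jmul (E a)) - d a * rdot v (E a).
  by rewrite JmulD !JmulZ JmulJ rdotDr !rdotZr rdotNr mulrN.
have e1 a b : rdot (E' a) (E b) = c a * (a == b)%:R.
  rewrite rdotDl !rdotZl rdotJ (unitary_dot uE) (unitary_dotJ uE).
  by rewrite oppr0 mulr0 addr0.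
have e2 a b : rdot (E' a) (Jmul (E b)) = d a * (a == b)%:R.
  rewrite rdotDl !rdotZl rdotJJ (unitary_dot uE) (unitary_dotJ uE).
  by rewrite mulr0 add0r.
exists E'; split.
- split=> //.
  + move=> a b; rewrite hdot_toC dE dJ !e1 !e2.
    have [<-|ab] := eqVneq a b; apply/eqP; rewrite eq_complex /=; apply/andP.
      by have := cd a; move: (c a) (d a) => y z yz; split; apply/eqP; [lra|ring].
    by split; apply/eqP; ring.
  + apply: filterS N => q H a; rewrite -H dE dJ -[RHS]mul1r -[X in _ = X * _](cd a); ring.
- move=> a; rewrite dE /c /d; rewrite (_ : _ + _ = p a / Num.sqrt (p a)).
    by rewrite -{1}(qq a) expr2 mulfK.
  by rewrite -[X in _ = X / _]N0; field.
- by move=> a; rewrite dJ /c /d; field.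
Qed.

End Rotation.

(** * New charts from local diffeomorphisms *)

Section Reparametrization.
Variables (R : realType).

Lemma smooth_on_coord m n (U : set 'rV[R]_m) (h : 'rV[R]_m -> 'rV[R]_n) j :
  open U -> smooth_on U h -> smoothF U (fun t => h t 0 j).
Proof.
move=> oU Sh k; elim: k h Sh => [//|k IH] h Sh.
have dh t : U t -> differentiable h t by exact: (Sh [::]).
split=> [t Ut|i].
  exact: (@differentiable_comp _ _ _ _ h (fun s : 'rV[R]_n => s 0 j) t (dh t Ut)
    (differentiable_coord _ _ _)).
apply: Ck_ext (IH _ (smooth_on_partial i Sh)) => // t Ut.
by rewrite derive_mx ?mxE//; apply: diff_derivable; exact: dh.
Qed.

Variables (m : nat) (M : topologicalType).
Implicit Types (c : chart R m M) (A : set (chart R m M)).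

Lemma open_param_preimage c (S : set M) :
  open S -> open (target c `&` param c @^-1` S).
Proof.
move=> oS; rewrite openE => t [ct St]; apply: (@filterI _ (nbhs t) (nbhs_filter t)).
  by apply: open_nbhs_nbhs; split=> //; exact: open_target.
exact: (@param_continuous _ _ _ c t ct _ (open_nbhs_nbhs (conj oS St))).
Qed.

Lemma open_coord_preimage c (V : set 'rV[R]_m) :
  open V -> open (source c `&` Defs.coord c @^-1` V).
Proof.
move=> oV; rewrite openE => q [cq Vq]; apply: (@filterI _ (nbhs q) (nbhs_filter q)).
  by apply: open_nbhs_nbhs; split=> //; exact: open_source.
exact: (@Defs.coord_continuous _ _ _ c q cq _ (open_nbhs_nbhs (conj oV Vq))).
Qed.

(** Transition maps of the new chart are those of c preceded by g or followed by u, on the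
    corresponding smaller domains. *)
Lemma reparametrize A c (V : set 'rV[R]_m) (u g : 'rV[R]_m -> 'rV[R]_m) :
  smooth_atlas A -> A c -> open V -> V `<=` target c ->
  (forall j, smoothF V (fun t => u t 0 j)) ->
  open (u @` V) -> (forall t, V t -> g (u t) = t) ->
  (forall y, (u @` V) y -> {for y, continuous g}) ->
  (forall F, smoothF V F -> smoothF (u @` V) (F \o g)) ->
  exists c', [/\ smooth_chart A c', source c' = source c `&` Defs.coord c @^-1` V,
    target c' = u @` V & param c' = param c \o g].
Proof.
move=> [_ comp] Ac oV VT Su oT gu cg Sg.
have Vg y : (u @` V) y -> V (g y) by move=> [t Vt <-]; rewrite gu.
have ug y : (u @` V) y -> u (g y) = y by move=> [t Vt <-]; rewrite gu.
have du t : V t -> differentiable u t.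
  by move=> Vt; apply: differentiable_rV => j; exact: smooth_diff (Su j) Vt.
have dg y : (u @` V) y -> differentiable g y.
  move=> Ty; apply: differentiable_rV => j.
  exact: smooth_diff (Sg _ (@smooth_coord _ _ V j)) Ty.
pose S := source c `&` Defs.coord c @^-1` V.
have oS : open S by exact: open_coord_preimage.
have ct q : S q -> (u @` V) (u (Defs.coord c q)) by move=> [_ Vq]; exists (Defs.coord c q).
have ps y : (u @` V) y -> S ((param c \o g) y).
  move=> Ty; split => /=; first by apply: param_source; exact/VT/Vg.
  by rewrite paramK; [exact: Vg|exact/VT/Vg].
have ck q : S q -> (param c \o g) (u (Defs.coord c q)) = q.
  by move=> [Sq Vq] /=; rewrite gu// coordK.
have pk y : (u @` V) y -> (u \o Defs.coord c) ((param c \o g) y) = y.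
  by move=> Ty /=; rewrite paramK; [exact: ug|exact/VT/Vg].
have cc q : S q -> {for q, continuous (u \o Defs.coord c)}.
  move=> [Sq Vq]; apply: continuous_comp; first exact: Defs.coord_continuous.
  by apply: differentiable_continuous; exact: du.
have pc y : (u @` V) y -> {for y, continuous (param c \o g)}.
  move=> Ty; apply: continuous_comp; first exact: cg.
  by apply: param_continuous; exact/VT/Vg.
pose c' := @Chart R m M S (u @` V) (u \o Defs.coord c) (param c \o g) oS oT ct ps ck pk cc pc.
exists c'; split=> // c2 Ac2; have [S12 S21] := comp c c2 Ac Ac2; split.
- have oO : open (target c' `&` param c' @^-1` source c2).
    by apply: open_param_preimage; exact: open_source.
  have oQ : open (target c `&` param c @^-1` source c2).
    by apply: open_param_preimage; exact: open_source.
  apply: smooth_on_rV => // j.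
  apply: (smooth_comp (V := target c `&` param c @^-1` source c2) (h := g)
    (F := fun t => (Defs.coord c2 \o param c) t 0 j)) => //.
  + by move=> t [Tt St]; split=> //; exact/VT/Vg.
  + by move=> t [Tt _]; exact: dg.
  + move=> k; apply: smoothS (Sg _ (@smooth_coord _ _ V k)); by move=> t [].
  + exact: smooth_on_coord.
- have oO : open (target c2 `&` param c2 @^-1` source c').
    by apply: open_param_preimage; exact: open_source.
  have oQ : open (target c2 `&` param c2 @^-1` source c).
    by apply: open_param_preimage; exact: open_source.
  have OQ : target c2 `&` param c2 @^-1` source c' `<=` target c2 `&` param c2 @^-1` source c.
    by move=> t [? []].
  apply: smooth_on_rV => // j.
  apply: (smooth_comp (V := V) (h := Defs.coord c \o param c2)
    (F := fun t => u t 0 j)) => //.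
  + by move=> t [_ []].
  + by move=> t /OQ; exact: (S21 [::]).
  + by move=> k; apply: smoothS OQ _; exact: smooth_on_coord.
Qed.

End Reparametrization.

Section Chart.
Variables (R : realType) (n : nat) (M : topologicalType).
Variables (A : set (chart R n.+1 M)) (x : M -> Cvec R n.+2).
Hypothesis atlasA : smooth_atlas A.
Hypothesis x_sub : sphere_submanifold A x.
Hypothesis x_par : integral_C_parallel A x.
Variable mu : 'I_n.+2 -> 'I_n.+1 -> R.

Lemma phase_chart pt E p : frame_at x pt E p ->
  (forall a b, p a * (1 + \sum_j mu a j * mu b j) = (a == b)%:R) ->
  exists c E', [/\ smooth_chart A c, source c pt, unitary_frame E' &
    forall t, target c t -> toC (x (param c t)) =
      \sum_a ((Num.sqrt (p a))%:C * expi (\sum_j mu a j * t 0 j)) *: toC (E' a)].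
Proof.
move=> F mumu; have [E' [F' X0 Y0]] := frame_rotate F.
have [c Ac cpt] := atlasA.1 pt; have [uE p0 _] := F'.
have [U [LP UT Ut H]] := frame_at_chart x_sub x_par Ac cpt F'.
have X0' a : 0 < zre (x \o param c) (E' a) (Defs.coord c pt).
  by rewrite /zre /= coordK// X0 sqrtr_gt0.
have Y0' a : zim (x \o param c) (E' a) (Defs.coord c pt) = 0.
  by rewrite /zim /= coordK.
have [W [oW WU Wt0 Su [Du fE]]] := phase_coords LP uE p0 H Ut X0' Y0' mumu.
have [V [g [[oV VW Vt0] [oT gu cg Sg]]]] := inverse_function oW Su Wt0 Du.
have VT : V `<=` target c by move=> t /VW /WU /UT.
have [c' [Sc' sE tE pE]] := reparametrize atlasA Ac oV VT
  (fun j => smoothS VW (Su j)) oT gu cg Sg.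
exists c', E'; split=> //; first by rewrite sE.
by rewrite tE pE => _ [t Vt <-] /=; rewrite gu// -fE//; exact: VW.
Qed.

End Chart.

(** * The frequency vectors of the theorem *)

Section Frequencies.
Variables (R : realType) (lambda alpha gamma delta : R) (p : 'I_4 -> R).
Hypothesis lambda_lt0 : lambda < 0.
Hypothesis p_gt0 : forall a, 0 < p a.
Hypothesis freq : frequencies_for lambda alpha gamma delta p.
Local Notation r1 := (rho_plus alpha gamma delta).
Local Notation r2 := (rho_minus alpha gamma delta).

Definition frequency (a : 'I_4) (j : 'I_3) : R :=
  nth 0 (nth [::]
    [:: [:: 1 / lambda; 0; 0];
        [:: - lambda; gamma - alpha; 0];
        [:: - lambda; - gamma; - r1];
        [:: - lambda; - gamma; r2]] a) j.

Lemma rho_mul : r1 * r2 = gamma * (2 * gamma - alpha).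
Proof.
have [_ _ _ H _] := freq; have := p_gt0 2; rewrite -invr_gt0 -H /rho_plus /rho_minus.
(* For a negative radicand [Num.sqrt] is 0, so rho1 + rho2 = 0, which contradicts rho1 (rho1 + rho2)
   = 1 / p_2 > 0. *)
set q := (X in Num.sqrt X); have [q0 _|q0] := leP 0 q.
  by move: (Num.sqrt q) (sqr_sqrtr q0) => s; rewrite /q => ss; lra.
by rewrite ler0_sqrtr ?ltW// => H'; exfalso; lra.
Qed.

Lemma frequency_dot a b :
  p a * (1 + \sum_j frequency a j * frequency b j) = (a == b)%:R.
Proof.
have [HL H0 H1 H2 H3] := freq; have RM := rho_mul.
have l0 : lambda != 0 by rewrite lt_eqF.
have l1 : lambda ^+ 2 + 1 != 0 by rewrite gt_eqF// ltr_wpDl ?sqr_ge0.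
have P q c : q = (p c)^-1 -> p c * q = 1 by move=> ->; rewrite mulfV// gt_eqF.
have p0E h : p (@Ordinal 4 0 h) = p 0 by congr p; apply: val_inj.
have p1E h : p (@Ordinal 4 1 h) = p 1 by congr p; apply: val_inj.
have p2E h : p (@Ordinal 4 2 h) = p 2 by congr p; apply: val_inj.
have p3E h : p (@Ordinal 4 3 h) = p 3 by congr p; apply: val_inj.
rewrite !big_ord_recl big_ord0 /frequency /=.
case: a => [[|[|[|[|//]]]] ha]; case: b => [[|[|[|[|//]]]] hb] /=; rewrite ?(p0E, p1E, p2E, p3E).
all: rewrite ?mul1r ?mulr0 ?mul0r ?addr0.
- by rewrite -H0; field; rewrite l0.
- by rewrite mulrN mulVf// subrr mulr0.
- by rewrite mulrN mulVf// subrr mulr0.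
- by rewrite mulrN mulVf// subrr mulr0.
- by rewrite mulNr mulfV// subrr mulr0.
- by apply: P; rewrite -H1; lra.
- by rewrite (_ : 1 + _ = 0) ?mulr0//; lra.
- by rewrite (_ : 1 + _ = 0) ?mulr0//; lra.
- by rewrite mulNr mulfV// subrr mulr0.
- by rewrite (_ : 1 + _ = 0) ?mulr0//; lra.
- by apply: P; rewrite -H2; lra.
- by rewrite (_ : 1 + _ = 0) ?mulr0//; lra.
- by rewrite mulNr mulfV// subrr mulr0.
- by rewrite (_ : 1 + _ = 0) ?mulr0//; lra.
- by rewrite (_ : 1 + _ = 0) ?mulr0//; lra.
- by apply: P; rewrite -H3; lra.
Qed.

Lemma sum_I4 (V : zmodType) (F : 'I_4 -> V) : \sum_a F a = F 0 + F 1 + F 2 + F 3.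
Proof.
rewrite !big_ord_recl big_ord0 addr0 !addrA.
by congr (F _ + F _ + F _ + F _); apply: val_inj.
Qed.

Lemma sum_I3 (V : zmodType) (F : 'I_3 -> V) : \sum_a F a = F 0 + F 1 + F 2.
Proof.
rewrite !big_ord_recl big_ord0 addr0 !addrA.
by congr (F _ + F _ + F _); apply: val_inj.
Qed.

Lemma sum4_eq (V : zmodType) (a b c d a' b' c' d' : V) :
  a = a' -> b = b' -> c = c' -> d = d' -> a + b + c + d = a' + b' + c' + d'.
Proof. by move=> -> -> -> ->. Qed.

Lemma wave_eq n (k : R[i]) (s t : R) (v : 'rV[R[i]]_n) :
  s = t -> (k * expi s) *: v = (k * expi t) *: v.
Proof. by move=> ->. Qed.

Lemma hdotNl n (v w : 'rV[R[i]]_n) : hdot (- v) w = - hdot v w.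
Proof. by rewrite /hdot -sumrN; apply: eq_bigr => k _; rewrite mxE mulNr. Qed.

Lemma hdotNr n (v w : 'rV[R[i]]_n) : hdot v (- w) = - hdot v w.
Proof.
by rewrite /hdot -sumrN; apply: eq_bigr => k _; rewrite mxE rmorphN mulrN.
Qed.

Lemma weight_coef0 : Num.sqrt (p 0) = - (lambda / Num.sqrt (lambda ^+ 2 + 1)).
Proof.
have [_ <- _ _ _] := freq; rewrite sqrtrM ?sqr_ge0// sqrtr_sqr ltr0_norm//.
by rewrite sqrtrV ?mulNr// addr_ge0 ?sqr_ge0.
Qed.

Lemma weight_coef a q : q = (p a)^-1 -> Num.sqrt (p a) = 1 / Num.sqrt q.
Proof. by move=> ->; rewrite sqrtrV ?ltW// div1r invrK. Qed.

End Frequencies.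

Section Locus.
Variables (R : realType) (M : topologicalType).
Variables (A : set (chart R 3 M)) (x : M -> Cvec R 4).
Hypothesis M_manifold : connected_manifold A.
Hypothesis x_submanifold : sphere_submanifold A x.
Hypothesis x_flat : flat A x.
Hypothesis x_C_parallel : integral_C_parallel A x.
Hypothesis x_biharmonic : biharmonic A (- 4) x.
Hypothesis x_not_minimal : ~ minimal A x.

Let conM : connected [set: M]. Proof. by have [] := M_manifold. Qed.
Let atlasA : smooth_atlas A. Proof. by have [] := M_manifold. Qed.

Lemma frame_permute pt E p (sigma : 'I_4 -> 'I_4) : injective sigma ->
  frame_at x pt E p -> frame_at x pt (E \o sigma) (p \o sigma).
Proof.
move=> sI [uE p0 N]; split=> [a b|a|].
- by rewrite uE (inj_eq sI).
- exact: p0.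
- by apply: filterS N => q H a; exact: H.
Qed.

Lemma weights_const : exists2 k, (0 < k < 4)%N &
  forall pt, exists E, frame_at x pt E (weights R k).
Proof.
have rep pt : exists k E, [/\ (0 < k < 4)%N, frame_at x pt E (weights R k) &
    forall E' p', frame_at x pt E' p' -> spec_norm p' = energy R k].
  have [E [p F]] := frame_exists atlasA x_submanifold x_flat x_C_parallel pt.
  have [_ p0 _] := F.
  have sp := frame_sum atlasA x_submanifold x_C_parallel F.
  have pT a : (4 - (p a)^-1) ^+ 2 + 4 * (4 - (p a)^-1) = spec_norm p.
    exact: (frame_spec_eq atlasA x_submanifold x_C_parallel x_biharmonic a F).
  have T0 : spec_norm p != 0.
    exact: (frame_spec_neq0 atlasA x_submanifold x_flat x_C_parallel conM x_not_minimal F).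
  have [k k4 [Tk [sigma sI pk]]] := classification p0 sp pT T0.
  exists k, (E \o sigma); split=> //.
    rewrite (_ : weights R k = p \o sigma); last by apply/funext => a; rewrite -pk.
    exact: frame_permute.
  move=> E' p' F'; rewrite -Tk.
  exact: (frame_spec_unique atlasA x_submanifold x_C_parallel F' F).
(* On an empty M minimality would hold vacuously. *)
have [pt0 _] : exists pt : M, True.
  apply: contrapT => no; apply: x_not_minimal => c _ t _.
  by exfalso; apply: no; exists (param c t).
have [k [E0 [k4 F0 T0]]] := rep pt0; exists k => // pt.
have [l [E [l4 F T]]] := rep pt.
have kl : k = l.
  apply: (@energy_inj R) => //; rewrite -(T0 _ _ F0) -(T _ _ F).
  exact: (frame_spec_const atlasA x_submanifold x_flat x_C_parallel conM F0 F).
by exists E; rewrite kl.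
Qed.

End Locus.

(** The parameters are chosen before the point, so one tuple serves the whole of M; only the chart
    and the basis vary. Non-minimality excludes the torus with all p_a = 1/4, whose tension
    vanishes. *)
Theorem corollary6p4 (R : realType) (M : topologicalType)
    (A : set (chart R 3 M)) (x : M -> Cvec R 4)
    (M_manifold : connected_manifold A)
    (x_submanifold : sphere_submanifold A x)
    (x_flat : flat A x)
    (x_C_parallel : integral_C_parallel A x)
    (x_biharmonic : biharmonic A (- 4) x)
    (x_not_minimal : ~ minimal A x) :
  exists lambda alpha gamma delta : R,
  let rho1 :=
    2^-1 * (Num.sqrt (4 * gamma * (2 * gamma - alpha) + delta ^+ 2) + delta) in
  let rho2 :=
    2^-1 * (Num.sqrt (4 * gamma * (2 * gamma - alpha) + delta ^+ 2) - delta) in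
  [/\ [/\ - 1 < lambda < 0,
          0 < alpha <= (lambda ^+ 2 - 1) / lambda,
          alpha >= delta /\ delta >= 0,
          alpha > 2 * gamma
        & lambda ^+ 2 != 1 / 3],
      [\/ [/\ lambda = - Num.sqrt ((4 - Num.sqrt 13) / 3),
              alpha = Num.sqrt ((7 - Num.sqrt 13) / 6),
              gamma = - Num.sqrt ((7 - Num.sqrt 13) / 6)
            & delta = 0],
          [/\ lambda = - Num.sqrt (1 / (5 + 2 * Num.sqrt 3)),
              alpha = Num.sqrt ((45 + 21 * Num.sqrt 3) / 13),
              gamma = - Num.sqrt (6 / (21 + 11 * Num.sqrt 3))
            & delta = 0]
        | [/\ lambda = - Num.sqrt (1 / (6 + Num.sqrt 13)),
              alpha = Num.sqrt ((523 + 139 * Num.sqrt 13) / 138),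
              gamma = - Num.sqrt ((79 - 17 * Num.sqrt 13) / 138)
            & delta = Num.sqrt ((14 + 2 * Num.sqrt 13) / 3)]]
    & forall p : M,
      exists (c : chart R 3 M) (E : 'I_4 -> 'rV[R[i]]_4),
      [/\ smooth_chart A c,
          source c p,
          (forall i j : 'I_4, hdot (E i) (E j) = (i == j)%:R)
        & forall t : 'rV[R]_3, target c t ->
          let u := t 0 0 in let v := t 0 1 in let w := t 0 2 in
          toC (x (param c t)) =
            ((lambda / Num.sqrt (lambda ^+ 2 + 1))%:C
               * expi (1 / lambda * u)) *: E 0
          + ((1 / Num.sqrt ((gamma - alpha) * (2 * gamma - alpha)))%:C
               * expi (- (lambda * u - (gamma - alpha) * v))) *: E 1
          + ((1 / Num.sqrt (rho1 * (rho1 + rho2)))%:C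
               * expi (- (lambda * u + gamma * v + rho1 * w))) *: E 2
          + ((1 / Num.sqrt (rho2 * (rho1 + rho2)))%:C
               * expi (- (lambda * u + gamma * v - rho2 * w))) *: E 3]].

Proof.
have [k k4 frame] := weights_const M_manifold x_submanifold x_flat x_C_parallel
  x_biharmonic x_not_minimal.
have [lambda [alpha [gamma [delta [adm lis freq]]]]] := tuple_exists R k4.
exists lambda, alpha, gamma, delta => rho1 rho2; split=> // pt.
have w0 := @weights_gt0 R k.
have l0 : lambda < 0 by have [/andP[]] := adm.
have [E F] := frame pt.
have [_ _ _ atlasA] := M_manifold.
have [c [E' [Sc cpt uE' H]]] := phase_chart atlasA x_submanifold x_C_parallel F
  (frequency_dot l0 w0 freq).
(* As lambda < 0, the first coefficient of the theorem is - sqrt(p_0); the sign is absorbed into the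
   first basis vector. *)
exists c, (fun a => if a == 0 then - toC (E' a) else toC (E' a)).
have [_ _ F1 F2 F3] := freq.
split=> // [a b|t ct u v w].
  have [<-|ab] := eqVneq a b; first by case: ifP => _; rewrite ?hdotNl ?hdotNr ?opprK uE' eqxx.
  have ab0 : hdot (toC (E' a)) (toC (E' b)) = 0 by rewrite uE' (negbTE ab).
  by case: ifP => _; case: ifP => _; rewrite ?hdotNl ?hdotNr ab0 ?oppr0.
rewrite (H t ct) sum_I4 /= !sum_I3 /frequency /=.
rewrite (weight_coef0 l0 freq) (weight_coef w0 F1) (weight_coef w0 F2).
rewrite (weight_coef w0 F3).
apply: sum4_eq.
- rewrite scalerN -scaleNr rmorphN mulNr; congr (- (_ * expi _) *: _).
  by rewrite /u !mul0r !addr0.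
- by apply: wave_eq; rewrite /u /v; ring.
- by apply: wave_eq; rewrite /u /v /w /rho1 /rho_plus; ring.
- by apply: wave_eq; rewrite /u /v /w /rho2 /rho_minus; ring.
Qed.
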